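(* Let $d\ge 2$, $\alpha\in(0,2)$, let $\nu$ be the L\'evy measure on $\mathbb{R}^d$ with spectral measure $\mu$, assume that $\nu$ is a $\gamma$-measure on the unit sphere, and put $\kappa_0=\gamma-(d-2\alpha)$. Assume that $\kappa_0>0$. If $\kappa_0\notin\mathbb{N}$, then the potential kernel $V$ belongs to the local H\''older space $C^{\kappa_0}_{loc}(\mathbb{R}^d\setminus\{0\})$. If $\kappa_0\in\mathbb{N}$, then $V\in C^{\kappa_0-}_{loc}(\mathbb{R}^d\setminus\{0\})$. Moreover, for every multiindex $\beta\in\mathbb{N}_0^d$ such that $0\le|\beta|<\kappa_0$ there exists a constant $c=c(\beta)$ such that $$|D^\beta V(x)|\le c\,|x|^{\alpha-d-|\beta|},\qquad x\in\mathbb{R}^d,\ |x|>0.$$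
   Context: Setting. $d\ge2$ is an integer, $\alpha\in(0,2)$, $B(x,r)$ is the open Euclidean ball, $\mathbb{S}=\{x\in\mathbb{R}^d:|x|=1\}$. The spectral measure $\mu$ is a finite positive Borel measure on $\mathbb{S}$ that is symmetric ($\mu(D)=\mu(-D)$) and nondegenerate (its support is not contained in a proper linear subspace of $\mathbb{R}^d$; in particular $\mu\ne0$). The L\'evy measure is $\nu(D)=\int_{\mathbb{S}}\int_0^\infty \mathbf{1}_D(r\xi)\,r^{-1-\alpha}\,dr\,\mu(d\xi)$. We say that $\nu$ is a $\gamma$-measure on $\mathbb{S}$ if there is a constant $c$ with $\nu(B(x,r))\le c r^\gamma$ for all $|x|=1$, $0<r<1/2$ (necessarily $\gamma\le d$). Semigroup and potential kernel. $\{P_t,t>0\}$ is the convolution semigroup of symmetric $\alpha$-stable probability measures on $\mathbb{R}^d$ with $\int e^{iu\cdot y}P_t(dy)=\exp(-t\Phi(u))$, $\Phi(u)=\int(1-\cos(u\cdot y))\,\nu(dy)$. $P_t$ has a smooth bounded density $p_t$, and $V(x)=\int_0^\infty p_t(x)\,dt$, $x\in\mathbb{R}^d$. Function spaces. For $D\subset\mathbb{R}^d$ open, $C^0(D)$ is the set of bounded uniformly continuous functions on $D$; for $n\in\mathbb{N}$, $C^n(D)=\{f: D^\beta f\in C^0(D)\text{ for all }|\beta|\le n\}$ with $\|f\|_{C^n(D)}=\sum_{|\beta|\le n}\sup_D|D^\beta f|$. For $s>0$, $s\notin\mathbb{N}$, with $[s]$ the integer part and $\{s\}=s-[s]$, $C^s(D)$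 is the set of $f\in C^{[s]}(D)$ with $\|f\|_{C^s(D)}=\|f\|_{C^{[s]}(D)}+\sum_{|\beta|=[s]}\sup_{x,y\in D,\,x\neq y}\frac{|D^\beta f(y)-D^\beta f(x)|}{|y-x|^{\{s\}}}<\infty$. $f\in C^{s-}(D)$ means $f\in C^{s-\delta}(D)$ for every $\delta\in(0,s]$. $C^s_{loc}(D)$ (resp. $C^{s-}_{loc}(D)$) is the set of functions belonging to $C^s(U)$ (resp. $C^{s-}(U)$) for every bounded open $U$ with $\overline U\subset D$. Convention on constants: constants $c$ depend only on $\mu,\gamma,d,\alpha$, and additionally on the quantities explicitly indicated. *)

(* Defs.v *)
From HB Require Import structures.
From mathcomp Require Import all_boot all_order all_algebra.
From mathcomp Require Import all_classical all_reals all_analysis.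
From mathcomp Require Import measurable_realfun.

Set Implicit Arguments.
Unset Strict Implicit.
Unset Printing Implicit Defensive.

Import Order.TTheory GRing.Theory Num.Theory.
Import numFieldNormedType.Exports.

Local Open Scope classical_set_scope.
Local Open Scope ring_scope.

Section borel_rV.
Context {R : realType} {n : nat}.

Definition borel_rV : set (set 'rV[R]_n) := <<s [set U | open U] >>.

Let borel_rV0 : borel_rV set0. Proof. exact: sigma_algebra0. Qed.

Let borel_rVC A : borel_rV A -> borel_rV (~` A).
Proof. exact: sigma_algebraC. Qed.

Let borel_rV_bigcup (F : (set 'rV[R]_n)^nat) :
  (forall i, borel_rV (F i)) -> borel_rV (\bigcup_i F i).
Proof. exact: sigma_algebra_bigcup. Qed.

HB.instance Definition _ := @isMeasurable.Build default_measure_display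
  'rV[R]_n borel_rV borel_rV0 borel_rVC borel_rV_bigcup.

Lemma open_measurable_rV (U : set 'rV[R]_n) : open U -> measurable U.
Proof. by move=> oU; exact: sub_sigma_algebra. Qed.

Lemma measurable_coord (i : 'I_n) :
  measurable_fun setT (fun x : 'rV[R]_n => x ord0 i).
Proof.
apply: (measurability [set A | exists x y : R, A = `]x, y[%classic]).
  exact: RGenOpens.measurableE.
move=> _ [_ [x [y ->]] <-]; rewrite setTI; apply: open_measurable_rV.
have /continuousP := @coord_continuous R 1 n ord0 i.
by apply; exact: interval_open.
Qed.

Lemma measurable_fun_rV d (T : measurableType d) (f : T -> 'rV[R]_n) :
  (forall i, measurable_fun setT (fun t => f t ord0 i)) ->
  measurable_fun setT f.
Proof.
move=> mf; apply: (measurability [set U : set 'rV[R]_n | open U]) => //.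
move=> _ [U oU <-]; rewrite setTI.
pose B (qk : 'rV[rat]_n * nat) : set 'rV[R]_n :=
  ball (\row_i (ratr (qk.1 ord0 i) : R)) (qk.2.+1%:R^-1).
have -> : U = \bigcup_(qk : 'rV[rat]_n * nat)
    (if `[< B qk `<=` U >] then B qk else set0).
  apply/seteqP; split => [x Ux|x [qk _]]; last first.
    by case: ifPn => // /asboolP; apply.
  have /nbhs_ballP[e /= e0 eU] := open_nbhs_nbhs (conj oU Ux).
  have [k ke] : exists k, k.+1%:R^-1 < e / 2.
    have [k _ /(_ k (leqnn k))] := near_infty_natSinv_lt (PosNum (divr_gt0 e0 (ltr0n R 2))).
    by exists k.
  have qP i : exists q : rat, `|ratr q - x ord0 i| < k.+1%:R^-1.
    have [|q] := @rat_in_itvoo R (x ord0 i) (x ord0 i + k.+1%:R^-1).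
      by rewrite ltrDl invr_gt0.
    rewrite in_itv/= => /andP[q1 q2]; exists q.
    by rewrite gtr0_norm ?subr_gt0// ltrBlDl.
  pose q : 'rV[rat]_n := \row_i projT1 (cid (qP i)).
  have Bx : B (q, k) x.
    split => [|i j]; first by rewrite invr_gt0.
    by rewrite (ord1 i) !mxE; exact: (projT2 (cid (qP j))).
  exists (q, k) => //; case: ifPn => // /asboolP []; move=> y Bqy.
  apply: eU; have := ball_triangle (ball_sym Bx) Bqy.
  by apply: le_ball; rewrite [leRHS]splitr lerD// ltW.
rewrite preimage_bigcup; apply: countable_bigcupT_measurable => // qk.
case: ifPn => _; last by rewrite preimage_set0.
have -> : f @^-1` B qk = \bigcap_(i in [set: 'I_n])
    ((fun t => f t ord0 i) @^-1` ball (ratr (qk.1 ord0 i) : R) (qk.2.+1%:R^-1)).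
  apply/seteqP; split => t /=.
    by move=> [_ h] i _ /=; have := h ord0 i; rewrite mxE.
  move=> h; split => [|i j]; first by rewrite invr_gt0.
  by rewrite (ord1 i) mxE; exact: h.
apply: fin_bigcap_measurable => // i _; rewrite -[X in measurable X]setTI.
by apply: mf => //; exact: measurable_ball.
Qed.

End borel_rV.

Section euclidean.
Context {R : realType} {n : nat}.
Implicit Types x y u : 'rV[R]_n.

Definition dotp u x : R := \sum_i u ord0 i * x ord0 i.

(* The library norm on 'rV[R]_n is the sup norm. *)
Definition enorm x : R := Num.sqrt (dotp x x).

Definition eball x (r : R) : set 'rV[R]_n := [set y | enorm (y - x) < r].

Definition sphere : set 'rV[R]_n := [set x | enorm x = 1].

Lemma measurable_enorm : measurable_fun setT enorm.
Proof.
apply: (@measurableT_comp _ _ _ _ _ _ (@Num.sqrt R)).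
  by apply: continuous_measurable_fun; exact: sqrt_continuous.
apply: measurable_sum => i.
by apply: measurable_funM; exact: measurable_coord.
Qed.

Lemma measurable_sphere : measurable sphere.
Proof.
rewrite (_ : sphere = setT `&` enorm @^-1` [set 1]).
  exact: measurable_enorm.
by rewrite setTI.
Qed.

End euclidean.

Section lebesgue_rV.
Context {R : realType}.

Definition consrV n (xv : measurableTypeR R * 'rV[R]_n) : 'rV[R]_n.+1 :=
  row_mx (const_mx (xv.1 : R) : 'rV[R]_1) xv.2.

Lemma measurable_consrV n : measurable_fun setT (@consrV n).
Proof.
apply: measurable_fun_rV => i.
have [j ->|j ->] := split_ordP (i : 'I_(1 + n)).
  rewrite (_ : (fun _ => _) = fst); first exact: measurable_fst.
  apply/funext => xv; apply: etrans (row_mxEl _ _ _ _) _.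
  by rewrite mxE.
rewrite (_ : (fun _ => _) = (fun x : 'rV[R]_n => x ord0 j) \o snd).
  by apply: measurableT_comp; [exact: measurable_coord|exact: measurable_snd].
by apply/funext => xv; exact: row_mxEr.
Qed.

Section step.
Context n (m : {sigma_finite_measure set 'rV[R]_n -> \bar R}).
Local Open Scope ereal_scope.

Definition lebesgue_step : set 'rV[R]_n.+1 -> \bar R :=
  pushforward (@lebesgue_measure R \x m) (@consrV n).

Let mpre A : measurable A -> measurable (@consrV n @^-1` A).
Proof.
by move=> mA; rewrite -[X in measurable X]setTI; exact: measurable_consrV.
Qed.

Let step0 : lebesgue_step set0 = 0.
Proof. by rewrite /lebesgue_step /pushforward preimage_set0 measure0. Qed.

Let step_ge0 A : 0 <= lebesgue_step A.
Proof. by rewrite /lebesgue_step /pushforward measure_ge0. Qed.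

Let step_sigma_additive : semi_sigma_additive lebesgue_step.
Proof.
move=> F mF tF mUF; rewrite /lebesgue_step /pushforward preimage_bigcup.
apply: measure_semi_sigma_additive.
- by move=> k; exact: mpre.
- apply/trivIsetP => /= i j _ _ ij; rewrite -preimage_setI.
  by move/trivIsetP : tF => /(_ _ _ _ _ ij) ->//; rewrite preimage_set0.
- by rewrite -preimage_bigcup; exact: mpre.
Qed.

HB.instance Definition _ := isMeasure.Build _ _ _ lebesgue_step
  step0 step_ge0 step_sigma_additive.

Let step_sigma_finite : sigma_finite setT lebesgue_step.
Proof.
have [F TF mF] : sigma_finite setT (@lebesgue_measure R \x m).
  have /sigma_finiteP[F [TF ndF Foo]] := sigma_finiteT (@lebesgue_measure R).
  have /sigma_finiteP[G [TG ndG Goo]] := sigma_finiteT m.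
  exists (fun k => F k `*` G k).
    rewrite -setXTT TF TG predeqE => -[x y]; split.
      move=> [/= [k _ Fkx] [l _ Gly]]; exists (maxn k l) => //; split.
      - by move: x Fkx; exact/subsetPset/ndF/leq_maxl.
      - by move: y Gly; exact/subsetPset/ndG/leq_maxr.
    by move=> [k _ []/= ? ?]; split; exists k.
  move=> k; have [? ?] := Foo k; have [? ?] := Goo k.
  split; first exact: measurableX.
  by rewrite product_measure1E// lte_mul_pinfty// ge0_fin_numE.
pose hd (v : 'rV[R]_n.+1) : measurableTypeR R := v ord0 ord0.
pose tl (v : 'rV[R]_n.+1) : 'rV[R]_n := \row_j v ord0 (lift ord0 j).
have consK : cancel (@consrV n) (fun v => (hd v, tl v)).
  move=> [x v]; congr pair; rewrite /hd /tl /consrV.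
    have -> : ord0 = lshift n (ord0 : 'I_1) by exact/val_inj.
    by apply: etrans (row_mxEl _ _ _ _) _; rewrite mxE.
  apply/rowP => j; rewrite mxE.
  have -> : lift ord0 j = rshift 1 j by exact/val_inj.
  exact: row_mxEr.
exists (fun k => (fun v => (hd v, tl v)) @^-1` F k).
  by rewrite -preimage_bigcup -TF preimage_setT.
move=> k; have [mFk Fk] := mF k; split.
  rewrite -[X in measurable X]setTI.
  have : measurable_fun setT (fun v => (hd v, tl v)); last exact.
  apply: measurable_fun_pair; first exact: measurable_coord.
  apply: measurable_fun_rV => i; under eq_fun do rewrite mxE.
  exact: measurable_coord.
rewrite /lebesgue_step /pushforward -comp_preimage.
rewrite (_ : _ @^-1` F k = F k)//.
by apply/seteqP; split => xv /=; rewrite consK.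
Qed.

HB.instance Definition _ := Measure_isSigmaFinite.Build _ _ _ lebesgue_step
  step_sigma_finite.

End step.

Fixpoint lebesgue_rV (n : nat) : {sigma_finite_measure set 'rV[R]_n -> \bar R} :=
  match n with
  | 0 => dirac (0 : 'rV[R]_0)
  | n'.+1 => lebesgue_step (lebesgue_rV n')
  end.

Lemma lebesgue_rVS n (A : set (measurableTypeR R)) (B : set 'rV[R]_n) :
  measurable A -> measurable B ->
  (lebesgue_rV n.+1 [set v : 'rV[R]_n.+1 |
     A (v ord0 ord0) /\ B (\row_j v ord0 (lift ord0 j))] =
   lebesgue_measure A * lebesgue_rV n B)%E.
Proof.
move=> mA mB; rewrite -(product_measure1E lebesgue_measure (lebesgue_rV n))//=.
rewrite /lebesgue_step /pushforward; congr (product_measure1 _ _ _).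
have E (x : measurableTypeR R) (v : 'rV[R]_n) :
    consrV (x, v) ord0 ord0 = x /\
    \row_j consrV (x, v) ord0 (lift ord0 j) = v.
  split.
    have -> : ord0 = lshift n (ord0 : 'I_1) by exact/val_inj.
    by apply: etrans (row_mxEl _ _ _ _) _; rewrite mxE.
  apply/rowP => j; rewrite mxE.
  have -> : lift ord0 j = rshift 1 j by exact/val_inj.
  exact: row_mxEr.
by apply/seteqP; split => -[x v] /=; have [-> ->] := E x v.
Qed.

End lebesgue_rV.

Section levy_measure.
Context {R : realType} {d : nat}.
Variables (alpha : R) (mu : {finite_measure set 'rV[R]_d -> \bar R}).
Local Open Scope ereal_scope.

Definition levy_measure (A : set 'rV[R]_d) : \bar R :=
  \int[mu]_(xi in sphere) \int[lebesgue_measure]_(r in `]0%R, +oo[)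
    (\1_A (r *: xi) * r `^ (- 1 - alpha))%:E.

Let f A (xr : 'rV[R]_d * measurableTypeR R) : \bar R :=
  (\1_A ((xr.2 : R) *: xr.1) * (xr.2 : R) `^ (- 1 - alpha))%:E.

Let f_ge0 A xr : 0 <= f A xr.
Proof. by rewrite lee_fin mulr_ge0// powR_ge0. Qed.

Let measurable_f A : measurable A -> measurable_fun setT (f A).
Proof.
move=> mA; apply/measurable_EFinP/measurable_funM.
  apply: (@measurableT_comp _ _ _ _ _ _ (\1_A : 'rV[R]_d -> R) _
    (fun xr : 'rV[R]_d * measurableTypeR R => (xr.2 : R) *: xr.1)).
    exact: measurable_indic.
  apply: measurable_fun_rV => i; under eq_fun do rewrite mxE.
  apply: measurable_funM; first exact: measurable_snd.
  apply: (@measurableT_comp _ _ _ _ _ _ (fun x : 'rV[R]_d => x ord0 i)).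
    exact: measurable_coord.
  exact: measurable_fst.
apply: (@measurableT_comp _ _ _ _ _ _ (fun r : R => (r `^ (- 1 - alpha))%R)).
  exact: measurable_powR.
exact: measurable_snd.
Qed.

Let F A (xi : 'rV[R]_d) : \bar R :=
  \int[lebesgue_measure]_(r in `]0%R, +oo[) f A (xi, r).

Let F_ge0 A xi : 0 <= F A xi.
Proof. by apply: integral_ge0 => r _; exact: f_ge0. Qed.

Let measurable_F A : measurable A -> measurable_fun setT (F A).
Proof.
move=> mA; pose S : set ('rV[R]_d * measurableTypeR R) :=
  setT `*` `]0%R, +oo[%classic.
have mS : measurable S by apply: measurableX => //; exact: measurable_itv.
rewrite (_ : F A = fubini_F lebesgue_measure (f A \_ S)).
  apply: measurable_fun_fubini_tonelli_F.
  - apply/(measurable_restrictT _ mS).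
    exact: measurable_funS (measurable_f mA).
  - by move=> xr; rewrite patchE; case: ifP.
apply/funext => xi; rewrite /F /fubini_F [LHS]integral_mkcond.
apply: eq_integral => r _; rewrite !patchE.
by congr (if _ then _ else _); apply/idP/idP; rewrite !inE// => -[].
Qed.

Let levy0 : levy_measure set0 = 0.
Proof.
rewrite /levy_measure integral0_eq// => xi _; rewrite integral0_eq// => r _.
by rewrite indic0 mul0r.
Qed.

Let levy_ge0 A : 0 <= levy_measure A.
Proof. by apply: integral_ge0 => xi _; exact: F_ge0. Qed.

Let levy_sigma_additive : semi_sigma_additive levy_measure.
Proof.
move=> G mG tG mUG.
rewrite [X in _ --> X](_ : _ = \sum_(n <oo) levy_measure (G n)).
  by apply/cvg_closeP; split; [exact: is_cvg_nneseries|rewrite closeE].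
rewrite -(integral_nneseries mu measurable_sphere)//; first last.
  - by move=> n x _; exact: F_ge0.
  - by move=> n; apply: measurable_funTS; exact: measurable_F.
apply: eq_integral => xi _.
rewrite -(integral_nneseries lebesgue_measure (measurable_itv _))//; first last.
  - by move=> n r _; exact: (f_ge0 _ (xi, r)).
  - move=> n; apply: measurable_funTS.
    exact: measurable_fun_pair2 (measurable_f (mG n)).
apply: eq_integral => r _; rewrite EFinM indic_bigcup// muleC -nneseriesZl//.
by apply: eq_eseriesr => n _; rewrite EFinM muleC.
Qed.

HB.instance Definition _ := isMeasure.Build _ _ _ levy_measure
  levy0 levy_ge0 levy_sigma_additive.

End levy_measure.

Section assumptions.
Context {R : realType} {d : nat}.
Implicit Types (alpha gamma t : R) (u x : 'rV[R]_d).
Implicit Types (mu : {finite_measure set 'rV[R]_d -> \bar R}).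
Implicit Types (P : R -> probability 'rV[R]_d R) (p : R -> 'rV[R]_d -> R).

Definition measure_support (m : set 'rV[R]_d -> \bar R) : set 'rV[R]_d :=
  [set x | forall r, 0 < r -> (0 < m (eball x r))%E].

(* A Borel measure on the sphere is represented by the Borel measure on R^d
   that it induces, which vanishes off the sphere. *)
Definition spectral_measure mu : Prop :=
  [/\ mu (~` sphere) = 0%E,
      forall A : set 'rV[R]_d, measurable A -> mu [set - x | x in A] = mu A &
      forall W : {vspace 'rV[R]_d},
        measure_support mu `<=` [set` W] -> W = fullv].

Definition gamma_measure_on_sphere (nu : set 'rV[R]_d -> \bar R) gamma : Prop :=
  exists c : R, forall x r, enorm x = 1 -> 0 < r < 1 / 2 ->
    (nu (eball x r) <= (c * r `^ gamma)%:E)%E.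

Definition levy_exponent alpha mu u : \bar R :=
  (\int[levy_measure alpha mu]_y (1 - cos (dotp u y))%:E)%E.

(* The two integrals are the real and imaginary parts of the characteristic
   function of P t. *)
Definition stable_semigroup alpha mu P : Prop :=
  (forall s t, 0 < s -> 0 < t -> forall A : set 'rV[R]_d, measurable A ->
     P (s + t) A = (\int[P s]_x P t [set y | A (x + y)%R])%E) /\
  (forall t u, 0 < t ->
     (\int[P t]_y (cos (dotp u y))%:E)%E =
       expeR (- (t%:E * levy_exponent alpha mu u)) /\
     (\int[P t]_y (sin (dotp u y))%:E)%E = 0%E).

End assumptions.

Section derivatives.
Context {R : realType} {d : nat}.
Implicit Types (f : 'rV[R]_d -> R) (b : {ffun 'I_d -> nat}).

Definition unit_vec (i : 'I_d) : 'rV[R]_d := delta_mx ord0 i.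

Definition mi_size b : nat := (\sum_i b i)%N.

Definition pderiv (i : 'I_d) f : 'rV[R]_d -> R := fun x => 'D_(unit_vec i) f x.

(* D^b = D_0^(b 0) ... D_(d-1)^(b (d-1)), the last variable first.  Where a
   derivative does not exist the value is a default one, so existence has to be
   stated separately. *)
Definition mderiv b f : 'rV[R]_d -> R :=
  foldr (fun i g => iter (b i) (pderiv i) g) f (enum 'I_d).

Definition smooth f : Prop := forall b,
  continuous (mderiv b f) /\ forall i x, derivable (mderiv b f) x (unit_vec i).

End derivatives.

Section potential.
Context {R : realType} {d : nat}.
Local Open Scope ereal_scope.

Definition smooth_bounded_density (Q : set 'rV[R]_d -> \bar R)
    (q : 'rV[R]_d -> R) : Prop :=
  [/\ smooth q, exists M : R, forall x, (0 <= q x <= M)%R &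
      forall A, measurable A -> Q A = \int[lebesgue_rV d]_(y in A) (q y)%:E].

Definition potential_kernel (p : R -> 'rV[R]_d -> R) (x : 'rV[R]_d) : \bar R :=
  \int[lebesgue_measure]_(t in `]0%R, +oo[) (p t x)%:E.

End potential.

Section hoelder_spaces.
Context {R : realType} {d : nat}.
Implicit Types (D : set 'rV[R]_d) (f : 'rV[R]_d -> R) (s : R) (n : nat).

Definition C0_space D f : Prop :=
  (exists M : R, forall x, D x -> `|f x| <= M) /\
  forall e : R, 0 < e -> exists2 r : R, 0 < r &
    forall x y, D x -> D y -> enorm (y - x) < r -> `|f y - f x| < e.

Definition Cn_space n D f : Prop :=
  (forall b i x, (mi_size b < n)%N -> D x ->
     derivable (mderiv b f) x (unit_vec i)) /\
  (forall b, (mi_size b <= n)%N -> C0_space D (mderiv b f)).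

(* In both suprema 0 is added so that they are 0 when they range over the
   empty set. *)
Definition sup_norm D f : \bar R :=
  ereal_sup ([set 0%E] `|` [set `|f x|%:E | x in D]).

Definition hoelder_seminorm s D f : \bar R :=
  ereal_sup ([set 0%E] `|` [set z | exists x y, [/\ D x, D y, x != y &
    z = (`|f y - f x| / enorm (y - x) `^ s)%:E]]).

Definition Cn_norm n D f : \bar R :=
  \esum_(b in [set b : {ffun 'I_d -> nat} | (mi_size b <= n)%N])
    sup_norm D (mderiv b f).

Definition hoelder_norm s D f : \bar R :=
  (Cn_norm (Num.truncn s) D f +
   \esum_(b in [set b : {ffun 'I_d -> nat} | mi_size b = Num.truncn s])
     hoelder_seminorm (s - (Num.truncn s)%:R) D (mderiv b f))%E.

Definition C_space s D f : Prop :=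
  if s \is a Num.nat then Cn_space (Num.truncn s) D f
  else Cn_space (Num.truncn s) D f /\ (hoelder_norm s D f < +oo)%E.

Definition C_minus_space s D f : Prop :=
  forall delta : R, 0 < delta <= s -> C_space (s - delta) D f.

Definition locally_in (X : set 'rV[R]_d -> ('rV[R]_d -> R) -> Prop) D f : Prop :=
  forall U, bounded_set U -> open U -> closure U `<=` D -> X U f.

End hoelder_spaces.

(* Main.v *)
Require Import Defs.
From HB Require Import structures.
From mathcomp Require Import all_boot all_order all_algebra.
From mathcomp Require Import all_classical all_reals all_analysis.
From mathcomp Require Import measurable_realfun ring lra.

Import Order.TTheory GRing.Theory Num.Theory.
Import numFieldNormedType.Exports.

Local Open Scope classical_set_scope.
Local Open Scope ring_scope.
Set Implicit Arguments.
Unset Strict Implicit.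
Unset Printing Implicit Defensive.

(** By scaling, p_t(x) is a constant times r^d H(r x), where r = t^(-1/alpha)
    and H is the Fourier transform of exp(-Phi); everything then follows from
    the bound |D^b H(x)| <= C (1 + |x|)^(-s) with s = alpha + gamma.

    For this bound the Levy measure is split at |y| = 1.  The small jumps
    contribute a smooth factor whose derivatives decay rapidly, because Phi(u)
    dominates |u|^alpha, so its Fourier transform decays rapidly.  The large
    jumps form a finite measure giving mass at most c r^gamma |x|^(-s) to
    B(x,r), and averaging (1 + |x|)^(-s) against translates by such a measure
    costs a constant factor only; expanding in an exponential series the factor
    contributed by the large jumps yields the bound for the product.

    Finally D^b V(x) is a constant times the integral over t of
    t^(-(d+|b|)/alpha) D^b H(t^(-1/alpha) x).  Its size is found by cutting the
    integral at t = |x|^alpha, its increment between x and y by cutting at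
    t = |x - y|^alpha. *)

(** * Integrals over R and R^d *)

Section affine_substitution.
Context {R : realType}.
Local Open Scope ereal_scope.

Lemma ge0_integral_affine (a b : R) (f : R -> \bar R) : (0 < a)%R ->
  measurable_fun setT f -> (forall x, 0 <= f x) ->
  \int[lebesgue_measure]_x f (a * x + b)%R =
  (a^-1)%:E * \int[lebesgue_measure]_x f x.
Proof.
move=> a0 mf f0.
pose phi (x : measurableTypeR R) : measurableTypeR R := (a * x + b)%R.
have mphi : measurable_fun setT phi.
  by apply: measurable_funD => //; exact: measurable_funM.
have <- : \int[pushforward (@lebesgue_measure R) phi]_x f x =
          \int[lebesgue_measure]_x f (a * x + b)%R.
  by rewrite ge0_integral_pushforward.
have ai0 : (0 <= a^-1)%R by rewrite invr_ge0 ltW.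
rewrite -[a^-1%R]/((NngNum ai0)%:num) -ge0_integral_mscale//.
apply: eq_measure_integral => A mA _.
have a0' : (0 <= a)%R by exact: ltW.
rewrite -[LHS]/(lebesgue_measure (phi @^-1` A)).
rewrite -[RHS]/((a^-1)%:E * lebesgue_measure A).
have -> : lebesgue_measure (phi @^-1` A) =
    (a^-1)%:E * (a%:E * lebesgue_measure (phi @^-1` A)).
  by rewrite muleA -EFinM mulVf ?mul1e// gt_eqF.
congr (_ * _).
pose m0 : {measure set (measurableTypeR R) -> \bar R} :=
  measure_function_pushforward__canonical__measure_function_Measure
    (@lebesgue_measure R) mphi.
pose m : {measure set (measurableTypeR R) -> \bar R} := mscale (NngNum a0') m0.
rewrite -[LHS]/(m A); apply/esym; apply: (lebesgue_measure_unique (mu := m)) => // _ [[p q] /= _ <-].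
rewrite -[RHS]/(a%:E * lebesgue_measure (phi @^-1` `]p, q]%classic)).
have -> : phi @^-1` `]p, q]%classic = `]((p - b) / a)%R, ((q - b) / a)%R]%classic.
  apply/seteqP; split => x /=; rewrite !in_itv/= /phi.
    by move=> /andP[h1 h2]; rewrite ltr_pdivrMr// ler_pdivlMr//; apply/andP; split; lra.
  by rewrite ltr_pdivrMr// ler_pdivlMr// => /andP[h1 h2]; apply/andP; split; lra.
rewrite !lebesgue_measure_itv/= !lte_fin ltr_pM2r ?invr_gt0// ltrBlDr subrK.
case: ifPn => // _; last by rewrite mule0.
by rewrite -!EFinB -EFinM; congr EFin; field; rewrite gt_eqF.
Qed.

End affine_substitution.

Section rV_integration.
Context {R : realType}.

Lemma continuous_measurable_rV n (f : 'rV[R]_n -> R) :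
  continuous f -> measurable_fun setT f.
Proof.
move=> cf; apply: (measurability [set A | exists x y : R, A = `]x, y[%classic]).
  exact: RGenOpens.measurableE.
move=> _ [_ [x [y ->]] <-]; rewrite setTI; apply: open_measurable_rV.
by move/continuousP : cf; apply; exact: interval_open.
Qed.

Local Open Scope ereal_scope.

Lemma ge0_integral_lebesgue_rVS n (f : 'rV[R]_n.+1 -> \bar R) :
  measurable_fun setT f -> (forall x, 0 <= f x) ->
  \int[lebesgue_rV n.+1]_x f x =
  \int[lebesgue_measure]_t \int[lebesgue_rV n]_v f (consrV (t, v)).
Proof.
move=> mf f0; rewrite /= (ge0_integral_pushforward (@measurable_consrV R n))//.
rewrite preimage_setT fubini_tonelli1//; last by move=> x; exact: f0.
by apply: measurableT_comp => //; exact: measurable_consrV.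
Qed.

Lemma measurable_consrV2 n (f : 'rV[R]_n.+1 -> \bar R) t :
  measurable_fun setT f -> measurable_fun setT (fun v => f (consrV (t, v))).
Proof.
move=> mf; apply: measurableT_comp => //.
apply: (@measurableT_comp _ _ _ _ _ _ (@consrV R n)) => //.
exact: measurable_consrV.
Qed.

Lemma measurable_integral_consrV n (f : 'rV[R]_n.+1 -> \bar R) :
  measurable_fun setT f -> (forall x, 0 <= f x) ->
  measurable_fun setT
   (fun t : measurableTypeR R => \int[lebesgue_rV n]_v f (consrV (t, v))).
Proof.
move=> mf f0.
apply: (measurable_fun_fubini_tonelli_F (m2 := lebesgue_rV n)
  (fun tv : measurableTypeR R * 'rV[R]_n => f (consrV tv))) => //.
by apply: measurableT_comp => //; exact: measurable_consrV.
Qed.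

Lemma consrV0 n t (v : 'rV[R]_n) : consrV (t, v) ord0 ord0 = t.
Proof.
have -> : ord0 = lshift n (ord0 : 'I_1) by exact/val_inj.
by apply: etrans (row_mxEl _ _ _ _) _; rewrite mxE.
Qed.

Lemma consrVS n t (v : 'rV[R]_n) j : consrV (t, v) ord0 (lift ord0 j) = v ord0 j.
Proof.
have -> : lift ord0 j = rshift 1 j by exact/val_inj.
exact: row_mxEr.
Qed.

Lemma consrV_affine n a (b : 'rV[R]_n.+1) t v :
  (a *: consrV (t, v) + b = consrV ((a * t + b ord0 ord0)%R,
    a *: v + \row_j b ord0 (lift ord0 j)) :> 'rV[R]_n.+1)%R.
Proof.
apply/rowP => i; case: (unliftP ord0 i) => [j ->|->].
  by rewrite consrVS 2![in LHS]mxE consrVS 3![in RHS]mxE.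
by rewrite consrV0 2![in LHS]mxE consrV0.
Qed.

Lemma ge0_integral_rV_affine n (a : R) (b : 'rV[R]_n) (f : 'rV[R]_n -> \bar R) :
  (0 < a)%R -> measurable_fun setT f -> (forall x, 0 <= f x) ->
  \int[lebesgue_rV n]_x f (a *: x + b)%R =
  (a ^- n)%:E * \int[lebesgue_rV n]_x f x.
Proof.
move=> a0; elim: n b f => [|n ih] b f mf f0.
  by rewrite expr0 invr1 mul1e; apply: eq_integral => x _; congr f; apply/rowP => -[].
have maff : measurable_fun setT (fun x : 'rV[R]_n.+1 => (a *: x + b)%R).
  apply: measurable_fun_rV => i; under eq_fun do rewrite !mxE.
  apply: measurable_funD => //; apply: measurable_funM => //.
  exact: measurable_coord.
rewrite ge0_integral_lebesgue_rVS//; last exact: measurableT_comp.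
under eq_integral.
  move=> t _; under eq_integral do rewrite consrV_affine.
  rewrite (ih (\row_j b ord0 (lift ord0 j))%R
    (fun v => f (consrV ((a * t + b ord0 ord0)%R, v))))//; last first.
    exact: measurable_consrV2.
  over.
rewrite ge0_integralZl//; last 3 first.
- pose g (t : measurableTypeR R) := \int[lebesgue_rV n]_x f (consrV (t, x)).
  apply: (@measurableT_comp _ _ _ _ _ _ g) => //.
    exact: measurable_integral_consrV.
  by apply: measurable_funD => //; exact: measurable_funM.
- by move=> t _; exact: integral_ge0.
- by rewrite lee_fin invr_ge0 exprn_ge0// ltW.
rewrite (@ge0_integral_affine R a (b ord0 ord0)
  (fun t => \int[lebesgue_rV n]_x f (consrV (t, x)))) //; last 2 first.
- exact: measurable_integral_consrV.
- by move=> t; exact: integral_ge0.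
rewrite muleA -EFinM -invfM -exprSr ge0_integral_lebesgue_rVS//.
Qed.

End rV_integration.

Section power_integrals.
Context {R : realType}.
Implicit Types a p t : R.

Lemma is_derive_powR_primitive p t : p + 1 != 0 -> 0 < t ->
  is_derive t 1 (fun x => x `^ (p + 1) / (p + 1)) (t `^ p).
Proof.
move=> p1 t0; have h := @is_derive1_powR R (p + 1) t t0.
have -> : t `^ p = (p + 1)^-1 *: ((p + 1) * t `^ (p + 1 - 1)).
  by rewrite addrK /GRing.scale/= mulKf.
rewrite (_ : (fun x => _) = (p + 1)^-1 \*: ((@powR R) ^~ (p + 1))).
  exact: is_deriveZ.
by apply/funext => x; rewrite mulrC.
Qed.

Lemma continuous_powR_gt0 p t : 0 < t -> {for t, continuous ((@powR R) ^~ p)}.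
Proof.
move=> t0; apply: differentiable_continuous; apply/derivable1_diffP.
by apply: derivable_powR; rewrite in_itv/= t0.
Qed.

Lemma integral_powR_infty a p : 0 < a -> p < -1 ->
  (\int[lebesgue_measure]_(t in `]a, +oo[) (t `^ p)%:E =
   (- (a `^ (p + 1) / (p + 1)))%:E)%E.
Proof.
move=> a0 p1; have p1' : p + 1 < 0 by rewrite -ltrBrDr sub0r.
have p1n : p + 1 != 0 by rewrite lt_eqF.
rewrite integral_itv_obnd_cbnd; last first.
  apply/measurable_EFinP; apply: measurable_funTS; exact: measurable_powR.
rewrite (@ge0_continuous_FTC2y R _ (fun x => x `^ (p + 1) / (p + 1)) a 0).
- by rewrite sub0e -EFinN.
- by move=> x _; exact: powR_ge0.
- apply: continuous_in_subspaceT => x; rewrite inE/= in_itv/= andbT => ax.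
  exact/continuous_powR_gt0/(lt_le_trans a0).
- rewrite -[X in _ --> X](mul0r (p + 1)^-1); apply: cvgMl.
  have -> : p + 1 = - (- (p + 1)) by rewrite opprK.
  set q := - (p + 1); have q0 : 0 < q by rewrite /q oppr_gt0.
  apply/cvgrPdist_lt => e e0; near=> x.
  have x0 : (e^-1) `^ q^-1 < x by near: x; exact: nbhs_pinfty_gt.
  rewrite sub0r normrN ger0_norm ?powR_ge0// powRN invf_plt ?posrE ?powR_gt0//.
  have := gt0_ltr_powR q0 _ _ x0; rewrite !nnegrE powR_ge0 ltW// -powRrM mulVf ?gt_eqF//.
  by rewrite powRr1 ?invr_ge0 1?ltW//; exact.
- by move=> x ax; have [] := is_derive_powR_primitive p1n (lt_trans a0 ax).
- have : {for a, continuous (fun x => x `^ (p + 1) / (p + 1))}.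
    apply: differentiable_continuous; apply/derivable1_diffP.
    by have [] := is_derive_powR_primitive p1n a0.
  by move=> /cvg_at_right_filter.
- move=> x; rewrite in_itv/= andbT => ax; rewrite derive1E.
  by have [_ ->] := is_derive_powR_primitive p1n (lt_trans a0 ax).
Unshelve. all: end_near. Qed.

Lemma integral_powR_zero_le a p : 0 < a -> -1 < p ->
  (\int[lebesgue_measure]_(t in `]0%R, a]) (t `^ p)%:E <=
   (a `^ (p + 1) / (p + 1))%:E)%E.
Proof.
move=> a0 p1; have p1' : 0 < p + 1 by rewrite -ltrBlDr sub0r.
have p1n : p + 1 != 0 by rewrite gt_eqF.
pose F (n : nat) : set R := `[a / n.+2%:R, a]%classic.
have aF n : 0 < a / n.+2%:R by rewrite divr_gt0.
have -> : `]0%R, a]%classic = \bigcup_n F n.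
  apply/seteqP; split => [x /=|x [n _] /=].
    rewrite in_itv/= => /andP[x0 xa].
    exists (Num.truncn (a / x)) => //; rewrite /F/= in_itv/= xa andbT.
    rewrite ler_pdivrMr// mulrC -ler_pdivrMr//.
    by rewrite ltW// (lt_trans (truncnS_gt _))// ltr_nat.
  by rewrite /F/= !in_itv/= => /andP[h1 h2]; rewrite h2 andbT (lt_le_trans (aF n)).
have mp : measurable_fun setT (fun t : R => (t `^ p)%:E).
  by apply/measurable_EFinP; exact: measurable_powR.
have h := @ge0_nondecreasing_set_cvg_integral _ (measurableTypeR R) R F (fun t => (t `^ p)%:E)
  (@lebesgue_measure R).
have {}h : (\int[lebesgue_measure]_(x in F n) (x `^ p)%:E @[n --> \oo] -->
    \int[lebesgue_measure]_(x in \bigcup_i F i) (x `^ p)%:E)%E.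
  apply: h.
  - apply/nondecreasing_seqP => m; apply/subsetPset => x; rewrite /F/= !in_itv/=.
    move=> /andP[h1 ->]; rewrite andbT (le_trans _ h1)// ler_pM2l//.
    by rewrite lef_pV2 ?posrE// ler_nat.
  - by move=> n; exact: measurable_itv.
  - by move=> n; exact: measurable_funTS.
  - by move=> *; rewrite lee_fin powR_ge0.
rewrite -(cvg_lim _ h)//; apply: lime_le; first by apply: cvgP; exact: h.
  apply: nearW => n.
have dP x : x \in `]a / n.+2%:R, a[ -> is_derive x 1 (fun x => x `^ (p + 1) / (p + 1)) (x `^ p).
  rewrite in_itv/= => /andP[h1 _]; apply: is_derive_powR_primitive => //.
  exact: lt_trans h1.
have dc x : 0 < x -> {for x, continuous (fun x => x `^ (p + 1) / (p + 1))}.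
  move=> x0; apply: differentiable_continuous; apply/derivable1_diffP.
  by have [] := is_derive_powR_primitive p1n x0.
rewrite (@continuous_FTC2 _ _ (fun x => x `^ (p + 1) / (p + 1))).
+ rewrite -EFinB lee_fin gerBl.
  by rewrite divr_ge0 ?powR_ge0// ltW.
+ by rewrite ltr_pdivrMr// ltr_pMr// ltr1n.
+ apply: continuous_in_subspaceT => x; rewrite inE/= in_itv/= => /andP[ax _].
  exact/continuous_powR_gt0/(lt_le_trans (aF n)).
+ split => [x /dP[]//||].
    exact/cvg_at_right_filter/dc/aF.
  exact/cvg_at_left_filter/dc/a0.
+ by move=> x /dP[_ <-]; rewrite derive1E.
Qed.

End power_integrals.

Section half_lines.
Context {R : realType}.
Local Open Scope ereal_scope.

Lemma ge0_integral_half_lines (f : R -> \bar R) :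
  measurable_fun setT f -> (forall t, 0 <= f t) ->
  \int[lebesgue_measure]_t f t =
  \int[lebesgue_measure]_(t in `]0%R, +oo[) f t +
  \int[lebesgue_measure]_(t in `]0%R, +oo[) f (- t)%R.
Proof.
move=> mf f0.
have mfN : measurable_fun setT (f \o -%R) by exact: measurableT_comp.
rewrite [X in _ + X]integral_itv_obnd_cbnd; last exact: measurable_funTS.
rewrite (ge0_integration_by_substitution0 mfN)//; last by move=> r; exact: f0.
under [X in _ + X]eq_integral do rewrite /= opprK.
rewrite addeC -ge0_integral_setU//=.
- by rewrite -(setUv `]-oo, 0%R]%classic) setCitvl.
- exact: measurable_funTS.
- apply/disj_setPLR => x /=; rewrite !in_itv/= andbT => x0.
  by apply/negP; rewrite -leNgt.
Qed.

End half_lines.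

Section poisson_kernel.
Context {R : realType}.
Implicit Types e z t a : R.

Definition poisson_primitive e z a t : R :=
  expR (- e * t) * ((z * sin (t * z + a) - e * cos (t * z + a)) /
    (e ^+ 2 + z ^+ 2) - e^-1).

Lemma is_derive_poisson_primitive e z a t : 0 < e ->
  is_derive t 1 (poisson_primitive e z a)
    (expR (- e * t) * (1 + cos (t * z + a))).
Proof.
move=> e0; have ez : e ^+ 2 + z ^+ 2 != 0.
  by rewrite gt_eqF// ltr_wpDr ?sqr_ge0// exprn_gt0.
rewrite /poisson_primitive; apply: is_derive_eq.
rewrite /GRing.scale/= !mulr1 !mulr0 !add0r !addr0.
by field; rewrite ez gt_eqF.
Qed.

Lemma poisson_primitive_cvg e z a : 0 < e ->
  poisson_primitive e z a t @[t --> +oo] --> (0 : R).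
Proof.
move=> e0; have ez : 0 < e ^+ 2 + z ^+ 2.
  by rewrite ltr_wpDr ?sqr_ge0// exprn_gt0.
pose M : R := (`|z| + e) / (e ^+ 2 + z ^+ 2) + e^-1.
have hM : M * expR (- e * t) @[t --> +oo] --> M * 0.
  apply: cvgMr; under eq_fun do rewrite mulNr.
  apply: (@cvg_comp _ _ _ (fun t => e * t) (fun x => expR (- x)) _ +oo%R).
    exact: gt0_cvgMry.
  exact: cvgr_expR.
apply: (@squeeze_cvgr _ _ _ _ (fun t => - (M * expR (- e * t)))
    (fun t => M * expR (- e * t))); last 2 first.
- by have := cvgN hM; rewrite mulr0 oppr0; exact.
- by rewrite mulr0 in hM.
apply: nearW => t; rewrite -ler_norml normrM (gtr0_norm (expR_gt0 _)) mulrC.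
rewrite ler_pM2r ?expR_gt0// (le_trans (ler_normB _ _))// /M.
rewrite [X in _ + X <= _]gtr0_norm ?invr_gt0// lerD2r normrM.
rewrite [X in _ * X <= _]gtr0_norm ?invr_gt0// ler_pM2r ?invr_gt0//.
rewrite (le_trans (ler_normB _ _))// !normrM (gtr0_norm e0) lerD//.
  by rewrite ler_piMr// sin_max.
by rewrite ler_piMr ?(ltW e0)// cos_max.
Qed.

Lemma half_poisson_integral e z a : 0 < e ->
  (\int[lebesgue_measure]_(t in `]0%R, +oo[)
     (expR (- e * `|t|) * (1 + cos (t * z + a)))%:E =
   (e^-1 + (e * cos a - z * sin a) / (e ^+ 2 + z ^+ 2))%:E)%E.
Proof.
move=> e0.
have dF t := is_derive_poisson_primitive z a t e0.
have cf : continuous (fun t : R => expR (- e * t) * (1 + cos (t * z + a))).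
  move=> t; apply: differentiable_continuous; apply/derivable1_diffP.
  by apply: ex_derive.
transitivity (\int[lebesgue_measure]_(t in `]0%R, +oo[)
     (expR (- e * t) * (1 + cos (t * z + a)))%:E)%E.
  apply: eq_integral => t; rewrite inE/= in_itv/= andbT => t0.
  by rewrite gtr0_norm.
rewrite integral_itv_obnd_cbnd; last first.
  apply/measurable_EFinP; apply: measurable_funTS.
  exact: continuous_measurable_fun.
rewrite (@ge0_continuous_FTC2y R _ (poisson_primitive e z a) 0 0).
- rewrite sub0e -EFinN /poisson_primitive mulr0 expR0 mul1r mul0r add0r.
  congr EFin; rewrite opprB -[in RHS](opprB (z * _)) mulNr //.
- move=> t _; apply: mulr_ge0; first exact: expR_ge0.
  by rewrite -lerBlDl sub0r cos_geN1.
- exact: continuous_subspaceT.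
- exact: poisson_primitive_cvg.
- by move=> t _; exact: ex_derive.
- apply: cvg_at_right_filter; apply: differentiable_continuous.
  by apply/derivable1_diffP; exact: ex_derive.
- by move=> t _; rewrite derive1E; exact: derive_val.
Qed.

Lemma poisson_integral e z a : 0 < e ->
  (\int[lebesgue_measure]_t (expR (- e * `|t|) * (1 + cos (t * z + a)))%:E =
   (2 / e + cos a * (2 * e / (e ^+ 2 + z ^+ 2)))%:E)%E.
Proof.
move=> e0; rewrite ge0_integral_half_lines; last 2 first.
- apply/measurable_EFinP; apply: continuous_measurable_fun => t.
  apply: cvgM; last first.
    apply: cvgD; first exact: cvg_cst.
    apply: continuous_comp; last exact: continuous_cos.
    by apply: cvgD; [apply: cvgMl; exact: cvg_id|exact: cvg_cst].
  apply: continuous_comp; last exact: continuous_expR.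
  by apply: cvgMr; exact: norm_continuous.
- move=> t; rewrite lee_fin; apply: mulr_ge0; first exact: expR_ge0.
  by rewrite -lerBlDl sub0r cos_geN1.
rewrite half_poisson_integral//.
under eq_integral do rewrite normrN [X in cos (X + _)]mulNr -[X in cos (X + _)]mulrN.
rewrite half_poisson_integral// -EFinD; congr EFin.
have ez : e ^+ 2 + z ^+ 2 != 0.
  by rewrite gt_eqF// ltr_wpDr ?sqr_ge0// exprn_gt0.
by field; rewrite ez gt_eqF// sqrrN.
Qed.

Lemma exp_integral e : 0 < e ->
  (\int[lebesgue_measure]_t (expR (- e * `|t|))%:E = (2 / e)%:E)%E.
Proof.
move=> e0; have := poisson_integral 0 (pi / 2) e0.
rewrite cos_pihalf mul0r addr0 => <-; apply: eq_integral => t _.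
by rewrite mulr0 add0r cos_pihalf addr0 mulr1.
Qed.

Lemma cauchy_integral :
  (\int[lebesgue_measure]_t ((1 + (t : R) ^+ 2)^-1)%:E = pi%:E)%E.
Proof.
have mf : measurable_fun setT (fun t : R => ((1 + t ^+ 2)^-1)%:E).
  apply/measurable_EFinP; apply: continuous_measurable_fun.
  exact: continuous_oneDsqrV.
have half : (\int[lebesgue_measure]_(t in `]0%R, +oo[) ((1 + (t : R) ^+ 2)^-1)%:E =
    (pi / 2)%:E)%E.
  rewrite integral_itv_obnd_cbnd; last exact: measurable_funTS.
  exact: integral0y_oneDsqr.
rewrite ge0_integral_half_lines//; last first.
  by move=> t; rewrite lee_fin invr_ge0 addr_ge0// sqr_ge0.
under [X in (_ + X)%E]eq_integral do rewrite sqrrN.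
by rewrite half -EFinD -splitr.
Qed.

End poisson_kernel.

(** * The Euclidean norm *)

Section continuous_combinations.
Context {R : realType} {T : topologicalType}.
Implicit Types (f g : T -> R) (h : R -> R).

Lemma continuous_mul f g : continuous f -> continuous g ->
  continuous (fun x => f x * g x).
Proof. by move=> cf cg x; apply: cvgM; [exact: cf|exact: cg]. Qed.

Lemma continuous_add f g : continuous f -> continuous g ->
  continuous (fun x => f x + g x).
Proof. by move=> cf cg x; apply: cvgD; [exact: cf|exact: cg]. Qed.

Lemma continuous_opp f : continuous f -> continuous (fun x => - f x).
Proof. by move=> cf x; apply: cvgN; exact: cf. Qed.

Lemma continuous_cst (k : R) : continuous (fun _ : T => k).
Proof. by move=> x; exact: cvg_cst. Qed.

Lemma continuous_of h f : continuous h -> continuous f ->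
  continuous (fun x => h (f x)).
Proof. by move=> ch cf x; apply: continuous_comp; [exact: cf|exact: ch]. Qed.

Lemma continuous_dist f :
  (forall x e, 0 < e -> \forall y \near x, `|f x - f y| < e) <-> continuous f.
Proof.
split=> [hf x|cf x e e0]; first by apply/cvgrPdist_lt => e e0; exact: hf.
by have /cvgrPdist_lt /(_ e e0) := cf x.
Qed.

Lemma continuous_bigsum (I : Type) (s : seq I) (f : I -> T -> R) :
  (forall i, continuous (f i)) -> continuous (fun x => \sum_(i <- s) f i x).
Proof.
move=> cf; elim: s => [|i s ih] x.
  under eq_fun do rewrite big_nil; exact: cvg_cst.
under eq_fun do rewrite big_cons.
by apply: cvgD; [exact: cf|exact: ih].
Qed.

End continuous_combinations.

Section euclidean_norm.
Context {R : realType} {n : nat}.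
Implicit Types (x y u v : 'rV[R]_n) (a : R).

Lemma dotpC u v : dotp u v = dotp v u.
Proof. by apply: eq_bigr => i _; rewrite mulrC. Qed.

Lemma dotpDl u v x : dotp (u + v) x = dotp u x + dotp v x.
Proof. by rewrite -big_split; apply: eq_bigr => i _; rewrite mxE mulrDl. Qed.

Lemma dotpDr u x y : dotp u (x + y) = dotp u x + dotp u y.
Proof. by rewrite dotpC dotpDl !(dotpC u). Qed.

Lemma dotpZl a u x : dotp (a *: u) x = a * dotp u x.
Proof. by rewrite /dotp mulr_sumr; apply: eq_bigr => i _; rewrite mxE mulrA. Qed.

Lemma dotpZr a u x : dotp u (a *: x) = a * dotp u x.
Proof. by rewrite dotpC dotpZl dotpC. Qed.

Lemma dotpNr u x : dotp u (- x) = - dotp u x.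
Proof. by rewrite -scaleN1r dotpZr mulN1r. Qed.

Lemma dotpBr u x y : dotp u (x - y) = dotp u x - dotp u y.
Proof. by rewrite dotpDr dotpNr. Qed.

Lemma dotpBl u v x : dotp (u - v) x = dotp u x - dotp v x.
Proof. by rewrite dotpC dotpBr !(dotpC x). Qed.

Lemma dotp_unit_vec u i : dotp u (unit_vec i) = u ord0 i.
Proof.
rewrite /dotp (bigD1 i)//= big1 ?addr0.
  by rewrite /unit_vec mxE !eqxx mulr1.
by move=> j ji; rewrite /unit_vec mxE (negbTE ji) andbF mulr0.
Qed.

Lemma enorm_unit_vec i : enorm (@unit_vec R n i) = 1.
Proof. by rewrite /enorm dotp_unit_vec /unit_vec mxE !eqxx/= sqrtr1. Qed.

Lemma dotp_ge0 x : 0 <= dotp x x.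
Proof. by apply: sumr_ge0 => i _; rewrite -expr2 sqr_ge0. Qed.

Lemma enorm_ge0 x : 0 <= enorm x. Proof. exact: sqrtr_ge0. Qed.

Lemma sqr_enorm x : enorm x ^+ 2 = dotp x x.
Proof. by rewrite sqr_sqrtr// dotp_ge0. Qed.

Lemma coord_le_enorm x i : `|x ord0 i| <= enorm x.
Proof.
rewrite -sqrtr_sqr ler_wsqrtr// /dotp (bigD1 i)//= -expr2 lerDl.
by apply: sumr_ge0 => j _; rewrite -expr2 sqr_ge0.
Qed.

Lemma enorm_eq0 x : (enorm x == 0) = (x == 0).
Proof.
apply/eqP/eqP => [x0|->]; last first.
  rewrite /enorm /dotp big1 ?sqrtr0// => i _; by rewrite mxE mul0r.
apply/rowP => i; rewrite mxE; apply/eqP; rewrite -normr_le0.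
by rewrite (le_trans (coord_le_enorm _ _))// x0.
Qed.

Lemma enorm_gt0 x : (0 < enorm x) = (x != 0).
Proof. by rewrite lt_neqAle enorm_ge0 andbT eq_sym enorm_eq0. Qed.

Lemma enormZ a x : enorm (a *: x) = `|a| * enorm x.
Proof. by rewrite /enorm dotpZl dotpZr mulrA -expr2 sqrtrM ?sqr_ge0// sqrtr_sqr. Qed.

Lemma enormN x : enorm (- x) = enorm x.
Proof. by rewrite -scaleN1r enormZ normrN1 mul1r. Qed.

Lemma enormB x y : enorm (x - y) = enorm (y - x).
Proof. by rewrite -enormN opprB. Qed.

Lemma cauchy_schwarz u x : `|dotp u x| <= enorm u * enorm x.
Proof.
rewrite -ler_sqr ?nnegrE ?mulr_ge0 ?enorm_ge0// real_normK ?num_real//.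
rewrite exprMn !sqr_enorm; have [->|x0] := eqVneq x 0.
  by rewrite -(scale0r 0) !dotpZr !mul0r mulr0 expr0n/=.
have xx : 0 < dotp x x by rewrite -sqr_enorm exprn_gt0// enorm_gt0.
have := dotp_ge0 (u - (dotp u x / dotp x x) *: x).
rewrite dotpBl !dotpBr !dotpZl !dotpZr (dotpC x u) divfK ?gt_eqF// subrr subr0.
by rewrite subr_ge0 mulrAC ler_pdivrMr// -expr2.
Qed.

Lemma ler_enormD x y : enorm (x + y) <= enorm x + enorm y.
Proof.
rewrite -ler_sqr ?nnegrE ?addr_ge0 ?enorm_ge0// sqr_enorm.
rewrite dotpDl !dotpDr (dotpC y x) sqrrD !sqr_enorm.
have := le_trans (ler_norm _) (cauchy_schwarz x y); lra.
Qed.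

Lemma ler_enorm_subD x y : enorm x <= enorm (x - y) + enorm y.
Proof. by rewrite -{1}(subrK y x) ler_enormD. Qed.

Lemma enorm_le_sum x : enorm x <= \sum_i `|x ord0 i|.
Proof.
rewrite -ler_sqr ?nnegrE ?enorm_ge0 ?sumr_ge0// sqr_enorm expr2 mulr_suml.
apply: ler_sum => i _; rewrite (le_trans (ler_norm _))// normrM ler_wpM2l//.
by rewrite (bigD1 i)//= lerDl sumr_ge0.
Qed.

Lemma dotp_continuous x : continuous (fun u => dotp u x).
Proof.
apply: continuous_bigsum => i; apply: continuous_mul.
  exact: coord_continuous.
exact: continuous_cst.
Qed.

Lemma enorm_continuous : continuous (@enorm R n).
Proof.
apply: continuous_of; first exact: sqrt_continuous.
apply: continuous_bigsum => i; apply: continuous_mul; exact: coord_continuous.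
Qed.

Lemma enorm_lipschitz_continuous (f : 'rV[R]_n -> R) :
  (forall u, exists C, forall v, enorm (v - u) <= 1 ->
    `|f v - f u| <= C * enorm (v - u)) -> continuous f.
Proof.
move=> lf; apply/continuous_dist => u e e0; have [C hC] := lf u.
pose r := Num.min 1 (e / (`|C| + 1)).
have r0 : 0 < r by rewrite lt_min ltr01 divr_gt0.
have h : \forall v \near u, enorm (v - u) < r.
  have /continuous_dist /(_ u r r0) : continuous (fun v => enorm (v - u)).
    apply: continuous_of; first exact: sqrt_continuous.
    under eq_fun do rewrite /dotp.
    apply: continuous_bigsum => i.
    suff h : continuous (fun v : 'rV[R]_n => (v - u) ord0 i).
      by apply: continuous_mul; exact: h.
    under eq_fun do rewrite 2!mxE.
    apply: continuous_add; first exact: coord_continuous.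
    exact: continuous_cst.
  apply: filterS => v.
  have -> : enorm (u - u) = 0 by apply/eqP; rewrite enorm_eq0 subrr.
  by rewrite sub0r normrN ger0_norm// enorm_ge0.
apply: (filterS _ h) => v; rewrite lt_min => /andP[h1 h2].
rewrite distrC (le_lt_trans (hC v (ltW h1)))//.
move: h2; rewrite ltr_pdivlMr// mulrC; apply: le_lt_trans.
by rewrite ler_wpM2r ?enorm_ge0// (le_trans (ler_norm _))// lerDl.
Qed.

End euclidean_norm.

Section product_integrals.
Context {R : realType}.

Definition cauchyw n (u : 'rV[R]_n) : R := \prod_i (1 + u ord0 i ^+ 2)^-1.

Definition expw n (e : R) (u : 'rV[R]_n) : R :=
  \prod_i expR (- e * `|u ord0 i|).

Definition poissonw n (e : R) (z : 'rV[R]_n) : R :=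
  \prod_i (2 * e / (e ^+ 2 + z ord0 i ^+ 2)).

Lemma measurable_coord_prod n (f : R -> R) : measurable_fun setT f ->
  measurable_fun setT (fun u : 'rV[R]_n => \prod_i f (u ord0 i)).
Proof.
move=> mf; apply: measurable_prod => i _.
by apply: measurableT_comp => //; exact: measurable_coord.
Qed.

Lemma ge0_integral_coord_prod n (f : R -> R) (I : R) :
  measurable_fun setT f -> (forall t, 0 <= f t) ->
  (\int[lebesgue_measure]_t (f t)%:E = I%:E)%E ->
  (\int[lebesgue_rV n]_u (\prod_i f (u ord0 i))%:E = (I ^+ n)%:E)%E.
Proof.
move=> mf f0 If; elim: n => [|n ih].
  under eq_integral do rewrite big_ord0.
  by rewrite integral_cst//= diracT mul1e expr0.
rewrite ge0_integral_lebesgue_rVS; last 2 first.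
- by apply/measurable_EFinP; exact: measurable_coord_prod.
- by move=> u; rewrite lee_fin prodr_ge0.
under eq_integral => t _.
  under eq_integral.
    move=> v _; rewrite big_ord_recl consrV0.
    under eq_bigr do rewrite consrVS.
    rewrite EFinM; over.
  rewrite ge0_integralZl//; last 3 first.
  - by apply/measurable_EFinP; exact: measurable_coord_prod.
  - by move=> v _; rewrite lee_fin prodr_ge0.
  - by rewrite lee_fin.
  rewrite ih muleC; over.
have I0 : 0 <= I by rewrite -lee_fin -If; apply: integral_ge0 => t _; rewrite lee_fin.
rewrite ge0_integralZl//; last 3 first.
- exact/measurable_EFinP.
- by move=> v _; rewrite lee_fin.
- by rewrite lee_fin exprn_ge0.
by rewrite If -EFinM exprSr.
Qed.

Lemma measurable_cauchyw n : measurable_fun setT (@cauchyw n).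
Proof.
apply: (@measurable_coord_prod _ (fun t => (1 + t ^+ 2)^-1)).
by apply: continuous_measurable_fun; exact: continuous_oneDsqrV.
Qed.

Lemma cauchyw_gt0 n (u : 'rV[R]_n) : 0 < cauchyw u.
Proof. by apply: prodr_gt0 => i _; rewrite invr_gt0 ltr_pwDl// sqr_ge0. Qed.

Lemma integrable_cauchyw n :
  (lebesgue_rV n).-integrable setT (EFin \o @cauchyw n).
Proof.
apply/integrableP; split.
  by apply/measurable_EFinP; exact: measurable_cauchyw.
under eq_integral do rewrite /= ger0_norm ?(ltW (cauchyw_gt0 _))//.
have mc : measurable_fun setT (fun t : R => (1 + t ^+ 2)^-1).
  by apply: continuous_measurable_fun; exact: continuous_oneDsqrV.
have c0 (t : R) : 0 <= (1 + t ^+ 2)^-1 by rewrite invr_ge0 addr_ge0// sqr_ge0.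
by rewrite (ge0_integral_coord_prod n mc c0 (@cauchy_integral R)) ltry.
Qed.

Lemma expw_gt0 n e (u : 'rV[R]_n) : 0 < expw e u.
Proof. by apply: prodr_gt0 => i _; exact: expR_gt0. Qed.

Lemma expw_le1 n e (u : 'rV[R]_n) : 0 < e -> expw e u <= 1.
Proof.
move=> e0; apply: prodr_ile1 => i _; rewrite expR_ge0/= -expR0 ler_expR mulNr oppr_le0.
by rewrite mulr_ge0// ltW.
Qed.

Let measurable_expN (e : R) : measurable_fun setT (fun t : R => expR (- e * `|t|)).
Proof.
apply: continuous_measurable_fun => t.
apply: continuous_comp; last exact: continuous_expR.
by apply: cvgMr; exact: norm_continuous.
Qed.

Lemma measurable_expw n e : measurable_fun setT (@expw n e).
Proof.
exact: (@measurable_coord_prod _ (fun t => expR (- e * `|t|))).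
Qed.

Lemma integral_expw n e : 0 < e ->
  (\int[lebesgue_rV n]_u (expw e u)%:E = ((2 / e) ^+ n)%:E)%E.
Proof.
move=> e0; apply: (@ge0_integral_coord_prod _ (fun t => expR (- e * `|t|))).
- exact: measurable_expN.
- by move=> t; exact: expR_ge0.
- exact: exp_integral.
Qed.

Lemma dotp_consrV n t (v : 'rV[R]_n) z : dotp (consrV (t, v)) z =
  t * z ord0 ord0 + dotp v (\row_j z ord0 (lift ord0 j)).
Proof.
rewrite /dotp big_ord_recl consrV0; congr (_ + _).
by apply: eq_bigr => i _; rewrite consrVS mxE.
Qed.

Lemma measurable_cos_dotp n (z : 'rV[R]_n) a :
  measurable_fun setT (fun u => cos (dotp u z + a)).
Proof.
apply: continuous_measurable_rV; apply: continuous_of.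
  exact: continuous_cos.
apply: continuous_add; [exact: dotp_continuous|exact: continuous_cst].
Qed.

Lemma onepcos_ge0 (a : R) : 0 <= 1 + cos a.
Proof. by rewrite -lerBlDl sub0r cos_geN1. Qed.

Lemma poissonw_ge0 n e (z : 'rV[R]_n) : 0 < e -> 0 <= poissonw e z.
Proof.
move=> e0; apply: prodr_ge0 => i _.
by rewrite divr_ge0// ?mulr_ge0 ?(ltW e0)// addr_ge0 ?sqr_ge0.
Qed.

Lemma poissonw_le n e (z : 'rV[R]_n) : 0 < e -> poissonw e z <= (2 / e) ^+ n.
Proof.
move=> e0; rewrite -[X in _ ^+ X](card_ord n) -prodr_const.
apply: ler_prod => i _; rewrite divr_ge0// ?mulr_ge0 ?(ltW e0)// ?addr_ge0 ?sqr_ge0//=.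
rewrite ler_pdivrMr; last by rewrite ltr_wpDr ?sqr_ge0// exprn_gt0.
rewrite mulrDr expr2 mulrA divfK ?gt_eqF// lerDl.
by rewrite mulr_ge0 ?sqr_ge0// divr_ge0// ltW.
Qed.

(* The summand 1 keeps the integrand nonnegative, so that Tonelli applies. *)
Lemma integral_expw_cos_ge0 n e (z : 'rV[R]_n) a : 0 < e ->
  (\int[lebesgue_rV n]_u (expw e u * (1 + cos (dotp u z + a)))%:E =
   ((2 / e) ^+ n + cos a * poissonw e z)%:E)%E.
Proof.
move=> e0; elim: n z a => [|n ih] z a.
  under eq_integral do rewrite /expw /dotp !big_ord0 mul1r add0r.
  by rewrite integral_cst//= diracT mule1 expr0 /poissonw big_ord0 mulr1.
rewrite ge0_integral_lebesgue_rVS; last 2 first.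
- apply/measurable_EFinP; apply: measurable_funM; first exact: measurable_expw.
  by apply: measurable_funD => //; exact: measurable_cos_dotp.
- by move=> u; rewrite lee_fin mulr_ge0 ?onepcos_ge0// ltW// expw_gt0.
pose z0 := z ord0 ord0; pose z' := (\row_j z ord0 (lift ord0 j)) : 'rV[R]_n.
have Pz : poissonw e z = 2 * e / (e ^+ 2 + z0 ^+ 2) * poissonw e z'.
  rewrite /poissonw big_ord_recl; congr (_ * _).
  by apply: eq_bigr => i _; rewrite mxE.
have P0 := poissonw_ge0 z' e0; have P1 := poissonw_le z' e0.
under eq_integral => t _.
  under eq_integral => v _.
    rewrite dotp_consrV -/z0 -/z' (addrC (t * z0)) -addrA.
    rewrite /expw big_ord_recl consrV0.
    under eq_bigr do rewrite consrVS.
    rewrite -/(expw e v) -mulrA EFinM; over.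
  rewrite ge0_integralZl//; last 2 first.
  - apply/measurable_EFinP; apply: measurable_funM; first exact: measurable_expw.
    by apply: measurable_funD => //; exact: measurable_cos_dotp.
  - by move=> v _; rewrite lee_fin mulr_ge0 ?onepcos_ge0// ltW// expw_gt0.
  rewrite ih -EFinM.
  have -> : expR (- e * `|t|) * ((2 / e) ^+ n + cos (t * z0 + a) * poissonw e z') =
      ((2 / e) ^+ n - poissonw e z') * expR (- e * `|t|) +
      poissonw e z' * (expR (- e * `|t|) * (1 + cos (t * z0 + a))) by ring.
  rewrite EFinD EFinM [X in (_ + X)%E]EFinM; over.
have mexp := measurable_expN e.
have mcos : measurable_fun setT (fun t : R => 1 + cos (t * z0 + a)).
  apply: continuous_measurable_fun => t; apply: cvgD; first exact: cvg_cst.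
  apply: continuous_comp; last exact: continuous_cos.
  by apply: cvgD; [apply: cvgMl; exact: cvg_id|exact: cvg_cst].
rewrite ge0_integralD//; last 4 first.
- by move=> t _; rewrite mule_ge0// lee_fin ?expR_ge0// subr_ge0.
- by apply: measurable_funeM; exact/measurable_EFinP.
- by move=> t _; apply: mule_ge0; rewrite lee_fin.
- by apply: measurable_funeM; apply/measurable_EFinP; exact: measurable_funM.
rewrite ge0_integralZl//; last 2 first.
- exact/measurable_EFinP.
- by rewrite lee_fin subr_ge0.
rewrite ge0_integralZl//; last by apply/measurable_EFinP; exact: measurable_funM.
rewrite exp_integral// poisson_integral// -!EFinM -EFinD Pz.
by congr EFin; set A := 2 / e; rewrite [A ^+ n.+1]exprSr; ring.
Qed.

Lemma integrable_expw n e : 0 < e ->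
  (lebesgue_rV n).-integrable setT (EFin \o @expw n e).
Proof.
move=> e0; apply/integrableP; split.
  by apply/measurable_EFinP; exact: measurable_expw.
under eq_integral do rewrite /= ger0_norm ?(ltW (expw_gt0 _ _))//.
by rewrite integral_expw// ltry.
Qed.

Lemma integral_expw_cos n e (z : 'rV[R]_n) a : 0 < e ->
  \int[lebesgue_rV n]_u (expw e u * cos (dotp u z + a)) = cos a * poissonw e z.
Proof.
move=> e0.
have i1 := integrable_expw n e0.
have i2 : (lebesgue_rV n).-integrable setT
    (EFin \o (fun u => expw e u * (1 + cos (dotp u z + a)))).
  apply/integrableP; split.
    apply/measurable_EFinP; apply: measurable_funM; first exact: measurable_expw.
    by apply: measurable_funD => //; exact: measurable_cos_dotp.
  under eq_integral.
    move=> u _; rewrite /= ger0_norm; last first.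
      by rewrite mulr_ge0 ?onepcos_ge0// ltW// expw_gt0.
    over.
  by rewrite integral_expw_cos_ge0// ltry.
under eq_Rintegral => u _.
  have -> : expw e u * cos (dotp u z + a) =
    expw e u * (1 + cos (dotp u z + a)) - expw e u by ring.
  over.
rewrite RintegralB// /Rintegral integral_expw_cos_ge0// integral_expw//=.
by ring.
Qed.

End product_integrals.

Section integral_tools.
Local Open Scope ring_scope.

Section Rfubini.
Context d1 d2 (T1 : measurableType d1) (T2 : measurableType d2) (R : realType).
Variables (m1 : {sigma_finite_measure set T1 -> \bar R}).
Variables (m2 : {sigma_finite_measure set T2 -> \bar R}).
Variables (f : T1 -> T2 -> R) (g : T1 -> R) (h : T2 -> R).
Hypothesis mf : measurable_fun setT (fun z : T1 * T2 => f z.1 z.2).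
Hypothesis ig : m1.-integrable setT (EFin \o g).
Hypothesis ih : m2.-integrable setT (EFin \o h).
Hypothesis fgh : forall x y, `|f x y| <= g x * h y.

Let mfx x : measurable_fun setT (f x).
Proof.
exact: (@measurable_fun_pair2 _ _ _ _ _ _ (fun z => f z.1 z.2) x mf).
Qed.

Let mfy y : measurable_fun setT (f ^~ y).
Proof.
exact: (@measurable_fun_pair1 _ _ _ _ _ _ (fun z => f z.1 z.2) y mf).
Qed.

Let ifx x : m2.-integrable setT (EFin \o f x).
Proof.
apply: (le_integrable measurableT _ _ (integrableZl measurableT (g x) ih)).
  exact/measurable_EFinP.
by move=> y _ /=; rewrite lee_fin (le_trans (fgh x y))// ler_norm.
Qed.

Let ify y : m1.-integrable setT (EFin \o f ^~ y).
Proof.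
apply: (le_integrable measurableT _ _ (integrableZl measurableT (h y) ig)).
  exact/measurable_EFinP.
by move=> x _ /=; rewrite lee_fin (le_trans (fgh x y))// mulrC ler_norm.
Qed.

Let If : (m1 \x m2)%E.-integrable setT (fun z => (f z.1 z.2)%:E).
Proof.
apply/integrable12ltyP => /=; first exact/measurable_EFinP.
  apply: (@le_lt_trans _ _ (\int[m1]_x
      (`|g x|%:E * \int[m2]_y `|(h y)%:E|))%E).
    apply: ge0_le_integral => //.
    - by move=> x _; apply: integral_ge0 => y _; rewrite lee_fin.
    - apply: (measurable_fun_fubini_tonelli_F (m2 := m2)
        (fun z : T1 * T2 => `|(f z.1 z.2)%:E|%E)) => //.
      by apply: measurableT_comp => //; exact/measurable_EFinP.
    - by apply: emeasurable_funM => //; do 2 apply: measurableT_comp => //;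
        have /integrableP[/measurable_EFinP] := ig.
    - move=> x _; rewrite -ge0_integralZl//; last first.
        by apply: measurableT_comp => //; have /integrableP[] := ih.
      apply: ge0_le_integral => //.
      + by do 2 apply: measurableT_comp => //.
      + apply: measurable_funeM; apply: measurableT_comp => //.
        by have /integrableP[] := ih.
      + move=> y _; rewrite lee_fin/= (le_trans (fgh x y))//.
        by rewrite (le_trans (ler_norm _))// normrM.
  have /integrableP[mg gy] := ig; have /integrableP[mh hy] := ih.
  rewrite ge0_integralZr//; last 2 first.
  - by apply/measurable_EFinP; apply: measurableT_comp => //; exact/measurable_EFinP.
  - by apply: integral_ge0.
  by rewrite lte_mul_pinfty// ?integral_ge0// ge0_fin_numE// integral_ge0.
Qed.

Lemma measurable_Rintegral2 : measurable_fun setT (fun y => \int[m1]_x f x y).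
Proof. exact: measurableT_comp (measurable_fubini_G If). Qed.

Lemma Rfubini :
  \int[m1]_x (\int[m2]_y f x y) = \int[m2]_y (\int[m1]_x f x y).
Proof.
transitivity (fine (\int[m1]_x \int[m2]_y (f x y)%:E)%E).
  congr fine; apply: eq_integral => x _; rewrite fineK//.
  exact: (integrable_fin_num measurableT (ifx x)).
transitivity (fine (\int[m2]_y \int[m1]_x (f x y)%:E)%E).
  by congr fine; exact: (Fubini If).
congr fine; apply: eq_integral => y _; rewrite fineK//.
exact: (integrable_fin_num measurableT (ify y)).
Qed.

End Rfubini.

Lemma is_derive_Rintegral d (Y : measurableType d) (R : realType)
    (mu : {measure set Y -> \bar R}) (D : set Y) (f f' : R -> Y -> R)
    (G : Y -> R) (r : R) : measurable D -> 0 < r ->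
  (forall s, `|s| < r -> mu.-integrable D (EFin \o f s)) ->
  (forall (s : R) y, `|s| < r -> D y -> is_derive s 1 (f ^~ y) (f' s y)) ->
  mu.-integrable D (EFin \o G) ->
  (forall s y, `|s| < r -> D y -> `|f' s y| <= G y) ->
  is_derive (0 : R) 1 (fun s => \int[mu]_(y in D) f s y) (\int[mu]_(y in D) f' 0 y).
Proof.
move=> mD r0 If df IG fG.
have Ir s : `]-r, r[%classic s -> `|s| < r by rewrite /= in_itv/= ltr_norml.
have I0 : `]-r, r[%classic (0 : R) by rewrite /= in_itv/= oppr_lt0 r0.
have h := @cvg_differentiation_under_integral R _ Y mu f D mD 0 (- r) r I0
  (fun s Is => If s (Ir s Is)).
have h1 s y : `]-r, r[%classic s -> D y -> derivable (f ^~ y) s 1.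
  by move=> /Ir rs Dy; have [] := df s y rs Dy.
have h2 : mu.-integrable D (EFin \o (fun y => `|G y|)) by exact: integrable_norm.
have h3 s y : `]-r, r[%classic s -> D y -> `|partial1of2 f s y| <= `|G y|.
  move=> /Ir rs Dy; rewrite partial1of2E; have [_ ->] := df s y rs Dy.
  by rewrite (le_trans (fG s y rs Dy))// ler_norm.
have {h} := h h1 (fun y => `|G y|) (fun y => normr_ge0 _) h2 h3.
have -> : \int[mu]_(y in D) partial1of2 f 0 y = \int[mu]_(y in D) f' 0 y.
  apply: eq_Rintegral => y /set_mem Dy; rewrite partial1of2E.
  by have [_ ->] := df 0 y (Ir _ I0) Dy.
move=> hc.
have E : (fun h : R => h^-1 *: (\int[mu]_(y in D) f (h + 0) y -
    \int[mu]_(y in D) f 0 y)) = (fun h : R =>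
    h^-1 *: (((fun s => \int[mu]_(y in D) f s y) \o shift 0) (h *: 1) -
    \int[mu]_(y in D) f 0 y)).
  by apply/funext => k; rewrite /= /GRing.scale/= mulr1.
rewrite E in hc.
apply: DeriveDef; first by apply/cvg_ex; eexists; exact: hc.
exact/cvg_lim.
Qed.

Lemma derive_along (R : realType) n (f : 'rV[R]_n -> R) x v (t l : R) :
  is_derive t 1 (fun s => f (s *: v + x)) l <-> is_derive (t *: v + x) v f l.
Proof.
have E : (fun h : R => h^-1 *: ((f \o shift (t *: v + x)) (h *: v) - f (t *: v + x))) =
   (fun h : R => h^-1 *: (((fun s => f (s *: v + x)) \o shift t) (h *: 1) -
     (fun s => f (s *: v + x)) t)).
  apply/funext => h /=; congr (_ *: (f _ - _)).
  have -> : h *: (1 : R) = h by rewrite /GRing.scale/= mulr1.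
  by rewrite scalerDl addrA.
split => -[d1 d2]; apply: DeriveDef.
- by rewrite /derivable E.
- by rewrite /derive E.
- by rewrite /derivable -E.
- by rewrite /derive -E.
Qed.

Lemma derive_along0 (R : realType) n (f : 'rV[R]_n -> R) x v (l : R) :
  is_derive (0 : R) 1 (fun s => f (s *: v + x)) l <-> is_derive x v f l.
Proof. by rewrite derive_along scale0r add0r. Qed.

Lemma Rintegral_affine (R : realType) n (a : R) (b : 'rV[R]_n)
    (f : 'rV[R]_n -> R) : 0 < a ->
  (lebesgue_rV n).-integrable setT (EFin \o f) ->
  \int[lebesgue_rV n]_x f (a *: x + b) = a ^- n * \int[lebesgue_rV n]_x f x.
Proof.
move=> a0 If; have [mf fy] := integrableP _ _ _ If.
rewrite /Rintegral [in LHS]integralE.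
have -> : (\int[lebesgue_rV n]_x ((fun x => (f (a *: x + b))%:E)^\+)%E x =
    (a ^- n)%:E * \int[lebesgue_rV n]_x (EFin \o f)^\+ x)%E.
  rewrite -(@ge0_integral_rV_affine R n a b)//; last exact: measurable_funepos.
  by under eq_integral do rewrite (funepos_comp (EFin \o f) (fun x => a *: x + b)).
have -> : (\int[lebesgue_rV n]_x ((fun x => (f (a *: x + b))%:E)^\-)%E x =
    (a ^- n)%:E * \int[lebesgue_rV n]_x (EFin \o f)^\- x)%E.
  rewrite -(@ge0_integral_rV_affine R n a b)//; last exact: measurable_funeneg.
  by under eq_integral do rewrite (funeneg_comp (EFin \o f) (fun x => a *: x + b)).
rewrite [in RHS]integralE -muleBr//.
  rewrite fineM//= fin_numB integrable_pos_fin_num//.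
  exact: integrable_neg_fin_num.
exact: integrable_add_def.
Qed.

End integral_tools.

(** * Fourier transforms *)

Section cauchy_dominated.
Context {R : realType} {n : nat}.
Implicit Types (E G f : 'rV[R]_n -> R) (x u v : 'rV[R]_n) (a : R).

Definition cdom E : Prop :=
  measurable_fun setT E /\ exists C, forall u, `|E u| <= C * cauchyw u.

Lemma cdom_integrable E : cdom E -> (lebesgue_rV n).-integrable setT (EFin \o E).
Proof.
move=> [mE [C EC]].
apply: (le_integrable measurableT _ _
  (integrableZl measurableT C (@integrable_cauchyw R n))).
  exact/measurable_EFinP.
by move=> u _ /=; rewrite lee_fin (le_trans (EC u))// ler_norm.
Qed.

Lemma cdom_mul_bounded f E M : measurable_fun setT f ->
  (forall u, `|f u| <= M) -> cdom E -> cdom (fun u => f u * E u).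
Proof.
move=> mf fM [mE [C EC]]; split; first exact: measurable_funM.
exists (M * C) => u; rewrite normrM -mulrA ler_pM//.
Qed.

Lemma cdom_add E G : cdom E -> cdom G -> cdom (fun u => E u + G u).
Proof.
move=> [mE [C EC]] [mG [C' GC]]; split; first exact: measurable_funD.
exists (C + C') => u; rewrite mulrDl (le_trans (ler_normD _ _))// lerD//.
Qed.

(* The phase a treats the sine and cosine transforms at once: differentiation in
   x shifts it by pi/2. *)
Definition FT a E x : R :=
  \int[lebesgue_rV n]_u (cos (dotp u x + a) * E u).

Lemma cdom_cos a x E : cdom E -> cdom (fun u => cos (dotp u x + a) * E u).
Proof.
apply: (@cdom_mul_bounded (fun u => cos (dotp u x + a)) E 1).
  exact: measurable_cos_dotp.
by move=> u; exact: cos_max.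
Qed.

Lemma FT_bounded E : cdom E -> exists M, forall a x, `|FT a E x| <= M.
Proof.
move=> cE; exists (\int[lebesgue_rV n]_u `|E u|) => a x.
rewrite (le_trans (le_normr_Rintegral _ _))//.
  exact/cdom_integrable/cdom_cos.
apply: le_Rintegral => //.
- exact/integrable_norm/cdom_integrable/cdom_cos.
- exact/integrable_norm/cdom_integrable.
- by move=> u _; rewrite normrM ler_piMl// cos_max.
Qed.

Lemma is_derive_FT a E x v : cdom E -> cdom (fun u => enorm u * E u) ->
  is_derive x v (FT a E) (FT (a + pi / 2) (fun u => dotp u v * E u) x).
Proof.
move=> cE cE'; apply/derive_along0; rewrite /FT.
have -> : \int[lebesgue_rV n]_u (cos (dotp u x + (a + pi / 2)) * (dotp u v * E u)) =
  \int[lebesgue_rV n]_u (- sin (dotp u (0 *: v + x) + a) * (dotp u v * E u)).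
  by apply: eq_Rintegral => u _; rewrite scale0r add0r addrA cosDpihalf.
apply: (@is_derive_Rintegral _ _ R (lebesgue_rV n) setT
  (fun s u => cos (dotp u (s *: v + x) + a) * E u)
  (fun s u => - sin (dotp u (s *: v + x) + a) * (dotp u v * E u))
  (fun u => enorm v * `|enorm u * E u|) 1) => //.
- by move=> s _; exact/cdom_integrable/cdom_cos.
- move=> s u _ _.
  have h : is_derive s 1 (fun s => cos (s * dotp u v + (dotp u x + a)) * E u)
      (- sin (s * dotp u v + (dotp u x + a)) * (dotp u v * E u)).
    apply: is_derive_eq.
    by rewrite /GRing.scale/= !(mulr0, mulr1, add0r, addr0); ring.
  rewrite [X in is_derive _ _ X _](_ : _ =
    (fun s => cos (s * dotp u v + (dotp u x + a)) * E u)); last first.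
    by apply/funext => t; rewrite dotpDr dotpZr addrA.
  by rewrite dotpDr dotpZr -addrA.
- apply: (@integrableZl _ _ R (lebesgue_rV n) setT measurableT (enorm v)
    (EFin \o (fun u => `|enorm u * E u|))).
  exact/integrable_norm/cdom_integrable.
- move=> s u _ _; rewrite !normrM normrN.
  rewrite (le_trans (ler_piMl _ (sin_max _)))//.
  rewrite (ger0_norm (enorm_ge0 u)) mulrA ler_wpM2r//.
  by rewrite mulrC cauchy_schwarz.
Qed.

Lemma FT_sum (I : Type) (s : seq I) (c : I -> R) (E_ : I -> 'rV[R]_n -> R) a x :
  (forall i, cdom (E_ i)) ->
  FT a (fun u => \sum_(i <- s) c i * E_ i u) x =
  \sum_(i <- s) c i * FT a (E_ i) x.
Proof.
move=> cE.
have cD t : cdom (fun u => \sum_(i <- t) c i * E_ i u).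
  elim: t => [|i t ih].
    under eq_fun do rewrite big_nil.
    by split => //; exists 0 => u; rewrite normr0 mul0r.
  under eq_fun do rewrite big_cons; apply: cdom_add => //.
  by apply: (@cdom_mul_bounded (fun=> c i) (E_ i) `|c i|).
elim: s => [|i s ih].
  rewrite big_nil /FT; under eq_Rintegral do rewrite big_nil mulr0.
  by rewrite Rintegral_cst// mul0r.
rewrite big_cons -ih /FT.
under eq_Rintegral do rewrite big_cons mulrDr mulrCA.
rewrite RintegralD//.
- by rewrite RintegralZl//; exact/cdom_integrable/cdom_cos.
- apply: (@integrableZl _ _ R (lebesgue_rV n) setT measurableT (c i)
    (EFin \o (fun u => cos (dotp u x + a) * E_ i u))).
  exact/cdom_integrable/cdom_cos.
- exact/cdom_integrable/cdom_cos.
Qed.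

Lemma cauchyw_shift (s : R) (i : 'I_n) u : `|s| <= 1 ->
  cauchyw (s *: unit_vec i + u) <= 3 * cauchyw u.
Proof.
move=> s1; rewrite /cauchyw (bigD1 i)//= [in leRHS](bigD1 i)//= mulrA.
have E j : j != i -> (s *: unit_vec i + u) ord0 j = u ord0 j.
  by move=> ji; rewrite !mxE eqxx (negbTE ji)/= mulr0 add0r.
rewrite (eq_bigr (fun j => (1 + u ord0 j ^+ 2)^-1)); last by move=> j /E ->.
rewrite ler_wpM2r//.
  by apply: prodr_ge0 => j _; rewrite invr_ge0 addr_ge0// sqr_ge0.
have -> : (s *: unit_vec i + u) ord0 i = s + u ord0 i.
  by rewrite !mxE !eqxx/= mulr1.
set t := u ord0 i.
have p (y : R) : 0 < 1 + y ^+ 2 by rewrite ltr_pwDl// sqr_ge0.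
rewrite ler_pdivlMr// mulrC ler_pdivrMr//.
have : s ^+ 2 <= 1 by rewrite -real_normK ?num_real// expr_le1.
by have := sqr_ge0 (t + 2 * s); nra.
Qed.

Lemma integral_partial0 E E' i : cdom E -> cdom E' ->
  (forall u, is_derive u (unit_vec i) E (E' u)) ->
  \int[lebesgue_rV n]_u E' u = 0.
Proof.
move=> cE [mE' [C EC]] dE.
have iE := cdom_integrable cE.
have E0 : (fun s : R => \int[lebesgue_rV n]_u E (s *: unit_vec i + u)) =
          (fun=> \int[lebesgue_rV n]_u E u).
  apply/funext => s.
  transitivity (\int[lebesgue_rV n]_u E (1 *: u + s *: unit_vec i)).
    by apply: eq_Rintegral => u _; rewrite scale1r addrC.
  by rewrite Rintegral_affine// expr1n invr1 mul1r.
have mshift (F : 'rV[R]_n -> R) (s : R) : measurable_fun setT F ->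
    measurable_fun setT (fun u => F (s *: unit_vec i + u)).
  move=> mF; apply: measurableT_comp => //.
  apply: measurable_fun_rV => j; under eq_fun do rewrite mxE.
  by apply: measurable_funD => //; exact: measurable_coord.
have shiftb (F : 'rV[R]_n -> R) c s u : `|s| < 1 -> (forall u, `|F u| <= c * cauchyw u) ->
    `|F (s *: unit_vec i + u)| <= (`|c| * 3) * cauchyw u.
  move=> s1 Fc; rewrite (le_trans (Fc _))// -mulrA.
  apply: (@le_trans _ _ (`|c| * cauchyw (s *: unit_vec i + u))).
    by rewrite ler_wpM2r ?ler_norm// ltW// cauchyw_gt0.
  by rewrite ler_wpM2l// cauchyw_shift// ltW.
have [mE [CE EE]] := cE.
have h : is_derive (0 : R) 1 (fun s => \int[lebesgue_rV n]_u E (s *: unit_vec i + u))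
   (\int[lebesgue_rV n]_u E' (0 *: unit_vec i + u)).
  apply: (@is_derive_Rintegral _ _ R (lebesgue_rV n) setT
    (fun s u => E (s *: unit_vec i + u)) (fun s u => E' (s *: unit_vec i + u))
    (fun u => (`|C| * 3) * cauchyw u) 1) => //.
  - move=> s s1; apply: cdom_integrable; split; first exact: mshift.
    by exists (`|CE| * 3) => u; exact: shiftb.
  - by move=> s u _ _; apply/derive_along; exact: dE.
  - apply: (@integrableZl _ _ R (lebesgue_rV n) setT measurableT _
      (EFin \o (@cauchyw R n))); exact: integrable_cauchyw.
  - by move=> s u s1 _; exact: shiftb.
rewrite E0 in h; have [_ h0] := h.
transitivity (\int[lebesgue_rV n]_u E' (0 *: unit_vec i + u)).
  by apply: eq_Rintegral => u _; rewrite scale0r add0r.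
by rewrite -h0 derive_cst.
Qed.

End cauchy_dominated.

Section dominated.
Context d (Y : measurableType d) (R : realType) (mu : {measure set Y -> \bar R}).

Lemma Rdominated_cvg (D : set Y) (f_ : nat -> Y -> R) (f g : Y -> R) :
  measurable D -> (forall k, measurable_fun D (f_ k)) ->
  (forall y, D y -> f_ k y @[k --> \oo] --> f y) ->
  mu.-integrable D (EFin \o g) ->
  (forall k y, D y -> `|f_ k y| <= g y) ->
  \int[mu]_(y in D) f_ k y @[k --> \oo] --> \int[mu]_(y in D) f y.
Proof.
move=> mD mf ff ig fg.
have ff' y : D y -> (f_ k y)%:E @[k --> \oo] --> (f y)%:E.
  by move=> Dy; apply: cvg_EFin; [exact: nearW|exact: ff].
have mlim : measurable_fun D (EFin \o f).
  by apply: emeasurable_fun_cvg ff' => k; exact/measurable_EFinP.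
have [If _ h] := @dominated_convergence _ Y R mu D mD (fun k y => (f_ k y)%:E)
  (EFin \o f) (EFin \o g) (fun k => (measurable_EFinP D (f_ k)).2 (mf k)) mlim
  (aeW _ ff') ig (aeW _ (fun y k Dy => fg k y Dy)).
apply: fine_cvg; rewrite fineK//.
exact: (integrable_fin_num mD If).
Qed.

End dominated.

Section fourier_inversion.
Context {R : realType} {n : nat}.
Implicit Types (f F : 'rV[R]_n -> R) (x u v y : 'rV[R]_n).

Lemma expwE e u : expw e u = expR (- e * \sum_i `|u ord0 i|).
Proof. by rewrite /expw mulr_sumr expR_sum. Qed.

Lemma poissonw_scale e u : 0 < e ->
  poissonw e (- (e *: u)) = e ^- n * (2 ^+ n * cauchyw u).
Proof.
move=> e0; rewrite /poissonw /cauchyw mulrA -exprVn -exprMn.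
rewrite -[X in (e^-1 * 2) ^+ X](card_ord n) -prodr_const -big_split.
apply: eq_bigr => i _; rewrite !mxE sqrrN exprMn.
have p : 1 + u ord0 i ^+ 2 != 0 by rewrite gt_eqF// ltr_pwDl// sqr_ge0.
have e' : e != 0 by rewrite gt_eqF.
have -> : e ^+ 2 + e ^+ 2 * u ord0 i ^+ 2 = e * e * (1 + u ord0 i ^+ 2) by ring.
rewrite -[RHS]/(e^-1 * 2 * (1 + u ord0 i ^+ 2)^-1).
by field; rewrite ?p ?e'.
Qed.

Lemma measurable_dotp2 :
  measurable_fun setT (fun z : 'rV[R]_n * 'rV[R]_n => dotp z.1 z.2).
Proof.
apply: measurable_sum => i; apply: measurable_funM.
  apply: (@measurableT_comp _ _ _ _ _ _ (fun x : 'rV[R]_n => x ord0 i)).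
    exact: measurable_coord.
  exact: measurable_fst.
apply: (@measurableT_comp _ _ _ _ _ _ (fun x : 'rV[R]_n => x ord0 i)).
  exact: measurable_coord.
exact: measurable_snd.
Qed.

Lemma measurable_poissonw e x : 0 < e ->
  measurable_fun setT (fun y => poissonw e (x - y)).
Proof.
move=> e0; apply: measurable_prod => i _.
under eq_fun do rewrite !mxE.
apply: (@measurableT_comp _ _ _ _ _ _
  (fun t : R => 2 * e / (e ^+ 2 + (x ord0 i - t) ^+ 2)) _
  (fun y : 'rV[R]_n => y ord0 i)); last exact: measurable_coord.
apply: continuous_measurable_fun; apply: continuous_mul.
  exact: continuous_cst.
have h : continuous (fun t : R => e ^+ 2 + (x ord0 i - t) ^+ 2).
  apply: continuous_add; first exact: continuous_cst.
  under eq_fun do rewrite expr2.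
  have h : continuous (fun t : R => x ord0 i - t).
    apply: continuous_add; first exact: continuous_cst.
    by apply: continuous_opp => t; exact: cvg_id.
  by apply: continuous_mul; exact: h.
move=> t; apply: cvgV; last exact: h.
by rewrite gt_eqF// ltr_wpDr ?sqr_ge0// exprn_gt0.
Qed.

Variables (f F : 'rV[R]_n -> R) (M : R).
Hypothesis cf : continuous f.
Hypothesis fM : forall y, 0 <= f y <= M.
Hypothesis intf : (lebesgue_rV n).-integrable setT (EFin \o f).
Hypothesis cosf : forall u, \int[lebesgue_rV n]_y (cos (dotp u y) * f y) = F u.
Hypothesis sinf : forall u, \int[lebesgue_rV n]_y (sin (dotp u y) * f y) = 0.
Hypothesis cF : cdom F.

Let mf : measurable_fun setT f. Proof. exact: continuous_measurable_rV. Qed.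

Let int_bounded_f (h : 'rV[R]_n -> R) C : measurable_fun setT h ->
  (forall y, `|h y| <= C) ->
  (lebesgue_rV n).-integrable setT (EFin \o (fun y => h y * f y)).
Proof.
move=> mh hC; apply: (le_integrable measurableT _ _
  (integrableZl measurableT C intf)).
  by apply/measurable_EFinP; exact: measurable_funM.
move=> y _; rewrite /= lee_fin !normrM ler_wpM2r//.
by rewrite (le_trans (hC y))// ler_norm.
Qed.

Let poisson_average e x : 0 < e ->
  \int[lebesgue_rV n]_u (expw e u * (cos (dotp u x + 0) * F u)) =
  \int[lebesgue_rV n]_z (f (e *: z + x) * (2 ^+ n * cauchyw z)).
Proof.
move=> e0.
have mdot u : measurable_fun setT (fun y => dotp u y).
  by under eq_fun do rewrite dotpC; apply: continuous_measurable_rV; exact: dotp_continuous.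
have mcos u : measurable_fun setT (fun y => cos (dotp u y)).
  apply: measurableT_comp; last exact: mdot.
  by apply: continuous_measurable_fun; exact: continuous_cos.
have msin u : measurable_fun setT (fun y => sin (dotp u y)).
  apply: measurableT_comp; last exact: mdot.
  by apply: continuous_measurable_fun; exact: continuous_sin.
transitivity (\int[lebesgue_rV n]_u \int[lebesgue_rV n]_y
    (expw e u * cos (dotp u (x - y) + 0) * f y)).
  apply: eq_Rintegral => u _.
  transitivity (\int[lebesgue_rV n]_y
     (expw e u * cos (dotp u x) * (cos (dotp u y) * f y) +
      expw e u * sin (dotp u x) * (sin (dotp u y) * f y))); last first.
    by apply: eq_Rintegral => y _; rewrite dotpBr addr0 cosB; ring.
  have icos := int_bounded_f (mcos u) (fun y => cos_max _).
  have isin := int_bounded_f (msin u) (fun y => sin_max _).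
  rewrite RintegralD//.
  - by rewrite !RintegralZl// cosf sinf mulr0 !addr0 mulrA.
  - exact: (integrableZl measurableT _ icos).
  - exact: (integrableZl measurableT _ isin).
rewrite (@Rfubini _ _ _ _ R (lebesgue_rV n) (lebesgue_rV n)
  (fun u y => expw e u * cos (dotp u (x - y) + 0) * f y) (expw e) f)//.
- transitivity (\int[lebesgue_rV n]_y (f y * poissonw e (x - y))).
    apply: eq_Rintegral => y _; rewrite RintegralZr//.
      by rewrite integral_expw_cos// cos0 mul1r mulrC.
    apply: (le_integrable measurableT _ _ (integrable_expw n e0)).
      apply/measurable_EFinP; apply: measurable_funM.
        exact: measurable_expw.
      exact: measurable_cos_dotp.
    by move=> u _; rewrite /= lee_fin normrM ler_piMr// cos_max.
  have ig : (lebesgue_rV n).-integrable setT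
      (EFin \o (fun y => f y * poissonw e (x - y))).
    under [EFin \o _]eq_fun do rewrite /= mulrC.
    apply: (@int_bounded_f (fun y => poissonw e (x - y)) ((2 / e) ^+ n)).
      exact: measurable_poissonw.
    by move=> y; rewrite ger0_norm ?poissonw_ge0// poissonw_le.
  have := Rintegral_affine x e0 ig.
  under eq_Rintegral => z _.
    rewrite opprD addrCA subrr addr0 poissonw_scale// mulrCA; over.
  rewrite RintegralZl//.
    by move/mulfI => -> //; rewrite invr_eq0 expf_neq0// gt_eqF.
  apply: (le_integrable measurableT _ _ (integrableZl measurableT (M * 2 ^+ n)
      (@integrable_cauchyw R n))).
    apply/measurable_EFinP; apply: measurable_funM; last first.
      by apply: measurable_funM => //; exact: measurable_cauchyw.
    apply: measurableT_comp => //.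
    apply: measurable_fun_rV => i; under eq_fun do rewrite !mxE.
    apply: measurable_funD => //; apply: measurable_funM => //.
    exact: measurable_coord.
  move=> z _; rewrite /= lee_fin -mulrA !normrM ler_wpM2r ?mulr_ge0//.
  have /andP[f0 f1] := fM (e *: z + x).
  by rewrite ger0_norm// (le_trans f1)// ler_norm.
- apply: measurable_funM; last first.
    by apply: measurableT_comp => //; exact: measurable_snd.
  apply: measurable_funM.
    by apply: (@measurableT_comp _ _ _ _ _ _ (@expw R n e)); [exact: measurable_expw|exact: measurable_fst].
  under eq_fun do rewrite addr0 dotpBr.
  apply: measurableT_comp.
    by apply: continuous_measurable_fun; exact: continuous_cos.
  apply: measurable_funB; last exact: measurable_dotp2.
  apply: (@measurableT_comp _ _ _ _ _ _ (fun u : 'rV[R]_n => dotp u x)).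
    by apply: continuous_measurable_rV; exact: dotp_continuous.
  exact: measurable_fst.
- exact: integrable_expw.
- move=> u y; have /andP[f0 _] := fM y.
  rewrite !normrM (ger0_norm f0) ler_wpM2r//.
  by rewrite (ger0_norm (ltW (expw_gt0 _ _))) ler_piMr ?(ltW (expw_gt0 _ _))// cos_max.
Qed.

Lemma fourier_inversion x :
  FT 0 F x = (\int[lebesgue_rV n]_z (2 ^+ n * cauchyw z)) * f x.
Proof.
have eps k : 0 < harmonic k :> R by rewrite /= invr_gt0.
have [mF [C FC]] := cF.
have lhs : \int[lebesgue_rV n]_u (expw (harmonic k) u * (cos (dotp u x + 0) * F u))
    @[k --> \oo] --> FT 0 F x.
  apply: (@Rdominated_cvg _ _ R (lebesgue_rV n) setT
    (fun k u => expw (harmonic k) u * (cos (dotp u x + 0) * F u))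
    (fun u => cos (dotp u x + 0) * F u) (fun u => `|F u|)) => //.
  - move=> k; apply: measurable_funM; first exact: measurable_expw.
    by apply: measurable_funM => //; exact: measurable_cos_dotp.
  - move=> u _; set S := \sum_i `|u ord0 i|.
    have h0 : - (harmonic k * S) @[k --> \oo] --> (0 : R).
      rewrite -[X in _ --> X]oppr0 -[X in - X](mul0r S).
      by apply: cvgN; apply: cvgMl; exact: cvg_harmonic.
    have h1 : expw (harmonic k) u @[k --> \oo] --> (1 : R).
      rewrite (_ : (fun k => _) = (fun k => expR (- (harmonic k * S)))); last first.
        by apply/funext => k; rewrite expwE mulNr.
      by have := continuous_cvg _ (@continuous_expR R 0) h0; rewrite expR0; exact.
    by rewrite -[X in _ --> X]mul1r; apply: cvgMl.
  - exact/integrable_norm/cdom_integrable.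
  - move=> k u _; rewrite !normrM (ger0_norm (ltW (expw_gt0 _ _))).
    rewrite -[leRHS]mul1r ler_pM ?(ltW (expw_gt0 _ _))// ?expw_le1//.
    by rewrite ler_piMl// cos_max.
have rhs : \int[lebesgue_rV n]_z (f (harmonic k *: z + x) * (2 ^+ n * cauchyw z))
    @[k --> \oo] --> \int[lebesgue_rV n]_z (f x * (2 ^+ n * cauchyw z)).
  apply: (@Rdominated_cvg _ _ R (lebesgue_rV n) setT
    (fun k z => f (harmonic k *: z + x) * (2 ^+ n * cauchyw z))
    (fun z => f x * (2 ^+ n * cauchyw z)) (fun z => (M * 2 ^+ n) * cauchyw z)) => //.
  - move=> k; apply: measurable_funM; last first.
      by apply: measurable_funM => //; exact: measurable_cauchyw.
    apply: measurableT_comp => //.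
    apply: measurable_fun_rV => i; under eq_fun do rewrite !mxE.
    apply: measurable_funD => //; apply: measurable_funM => //.
    exact: measurable_coord.
  - move=> z _; apply: cvgMl.
    have h : harmonic k *: z + x @[k --> \oo] --> (0 : R) *: z + x.
      by apply: cvgD; [apply: cvgZr_tmp; exact: cvg_harmonic|exact: cvg_cst].
    rewrite scale0r add0r in h.
    exact: (cvg_comp _ f h (@cf x)).
  - exact: (integrableZl measurableT _ (@integrable_cauchyw R n)).
  - move=> k z _; have /andP[f0 f1] := fM (harmonic k *: z + x).
    have w0 : 0 <= 2 ^+ n * cauchyw z by rewrite mulr_ge0// ltW// cauchyw_gt0.
    by rewrite normrM (ger0_norm f0) (ger0_norm w0) -mulrA ler_wpM2r.
have E : (fun k => \int[lebesgue_rV n]_u (expw (harmonic k) u * (cos (dotp u x + 0) * F u)))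
   = (fun k => \int[lebesgue_rV n]_z (f (harmonic k *: z + x) * (2 ^+ n * cauchyw z))).
  by apply/funext => k; exact: poisson_average.
rewrite E in lhs.
have -> := cvg_unique (@norm_hausdorff _ _) lhs rhs.
rewrite RintegralZl 1?mulrC//.
exact: (integrableZl measurableT _ (@integrable_cauchyw R n)).
Qed.

End fourier_inversion.

(** * The Levy measure and its exponent *)

Section integral_image_density.
Local Open Scope ereal_scope.
Context d1 d2 (X : measurableType d1) (Z : measurableType d2) (R : realType).
Variables (nu : {measure set X -> \bar R}) (M : {measure set Z -> \bar R}).
Variables (T : Z -> X) (dens : Z -> R).
Hypothesis mT : measurable_fun setT T.
Hypothesis mdens : measurable_fun setT dens.
Hypothesis dens_ge0 : forall z, (0 <= dens z)%R.
Hypothesis nuE : forall A, measurable A ->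
  nu A = \int[M]_z ((\1_A (T z))%:E * (dens z)%:E).

Import HBNNSimple.

Lemma ge0_integral_image_density (f : X -> \bar R) : measurable_fun setT f ->
  (forall y, 0 <= f y) -> \int[nu]_y f y = \int[M]_z (f (T z) * (dens z)%:E).
Proof.
move=> mf f0.
have mdens' : measurable_fun setT (EFin \o dens) by exact/measurable_EFinP.
have dens_ge0' z : 0 <= (dens z)%:E by rewrite lee_fin.
pose f_ := nnsfun_approx measurableT mf.
have ff y : (f_ n y)%:E @[n --> \oo] --> f y.
  exact: (cvg_nnsfun_approx measurableT mf (fun x _ => f0 x)).
transitivity (limn (fun n => \int[nu]_y (f_ n y)%:E)).
  rewrite -monotone_convergence//.
  - by apply: eq_integral => y _; apply/esym/cvg_lim.
  - by move=> n; exact/measurable_EFinP/measurable_funP.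
  - by move=> n y _; rewrite lee_fin.
  - by move=> y _ m n mn; rewrite lee_fin; exact/lefP/nd_nnsfun_approx.
transitivity (limn (fun n => \int[M]_z ((f_ n (T z))%:E * (dens z)%:E))); last first.
  rewrite -monotone_convergence//.
  - apply: eq_integral => z _; apply/cvg_lim => //.
    by apply: cvgeZr => //; exact: ff.
  - move=> n; apply: emeasurable_funM => //; apply/measurable_EFinP.
    apply: measurableT_comp => //; exact: mT.
  - by move=> n z _; rewrite mule_ge0// lee_fin.
  - move=> z _ m n mn; rewrite lee_wpmul2r// lee_fin.
    exact/lefP/nd_nnsfun_approx.
congr (limn _); apply/funext => n.
pose A (k : R) : set X := f_ n @^-1` [set k].
have mA k : measurable (A k) by exact: measurable_sfunP.
have fE y : (f_ n y)%:E = \sum_(k \in range (f_ n)) (k * \1_(A k) y)%:E.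
  by rewrite fimfunE -fsumEFin.
under eq_integral do rewrite fE.
rewrite ge0_integral_fsum//; last 2 first.
- by move=> k; apply/measurable_EFinP; apply: measurable_funM.
- by move=> k y _; rewrite nnfun_muleindic_ge0.
transitivity (\int[M]_z (\sum_(k \in range (f_ n))
   ((k * \1_(A k) (T z))%:E * (dens z)%:E))); last first.
  apply: eq_integral => z _; rewrite fE ge0_mule_fsuml//.
  by move=> k; rewrite nnfun_muleindic_ge0.
have mAz k : measurable_fun setT (fun z : Z =>
    (\1_(A k) (T z) : R)).
  apply: measurableT_comp; first exact: measurable_indic.
  exact: mT.
rewrite ge0_integral_fsum//; last 2 first.
- by move=> k; apply: emeasurable_funM => //; apply/measurable_EFinP/measurable_funM.
- by move=> k z _; rewrite mule_ge0// nnfun_muleindic_ge0.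
apply: eq_fsbigr => k /set_mem [y _ <-].
have k0 : (0 <= f_ n y)%R by [].
under eq_integral do rewrite EFinM.
rewrite ge0_integralZl//; last by apply/measurable_EFinP.
rewrite integral_indic// setIT.
under [RHS]eq_integral do rewrite EFinM -muleA.
rewrite ge0_integralZl//; last 2 first.
- by apply: emeasurable_funM => //; exact/measurable_EFinP.
- by move=> z _; rewrite mule_ge0// lee_fin.
by congr (_ * _); rewrite nuE.
Qed.

End integral_image_density.

Section levy_polar.
Context {R : realType} {d : nat}.
Variables (alpha : R) (mu : {finite_measure set 'rV[R]_d -> \bar R}).
Local Open Scope ereal_scope.
Notation nu := (levy_measure alpha mu).
Notation leb := (@lebesgue_measure R).

Let densR (z : 'rV[R]_d * measurableTypeR R) : R :=
  (\1_(@sphere R d) z.1 * (\1_(`]0%R, +oo[%classic : set R) (z.2 : R) *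
    (z.2 : R) `^ (- 1 - alpha)))%R.

Let dens z : \bar R := (densR z)%:E.

Let dens_ge0 z : 0 <= dens z.
Proof. by rewrite lee_fin !mulr_ge0 ?powR_ge0. Qed.

Lemma measurable_scale :
  measurable_fun setT (fun z : 'rV[R]_d * measurableTypeR R => (z.2 : R) *: z.1).
Proof.
apply: measurable_fun_rV => i; under eq_fun do rewrite mxE.
apply: measurable_funM; first exact: measurable_snd.
apply: (@measurableT_comp _ _ _ _ _ _ (fun x : 'rV[R]_d => x ord0 i)).
  exact: measurable_coord.
exact: measurable_fst.
Qed.

Let mdens : measurable_fun setT dens.
Proof.
apply/measurable_EFinP; apply: measurable_funM.
  apply: (@measurableT_comp _ _ _ _ _ _ (\1_(@sphere R d) : _ -> R)).
    by apply: measurable_indic; exact: measurable_sphere.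
  exact: measurable_fst.
apply: (@measurableT_comp _ _ _ _ _ _ (fun r : measurableTypeR R =>
   (\1_(`]0%R, +oo[%classic : set R) (r : R) * (r : R) `^ (- 1 - alpha))%R)).
  apply: measurable_funM; last exact: measurable_powR.
  by apply: measurable_indic; exact: measurable_itv.
exact: measurable_snd.
Qed.

Let polar_iterated (h : 'rV[R]_d -> \bar R) : measurable_fun setT h ->
  (forall y, 0 <= h y) ->
  \int[mu \x leb]_z (h ((z.2 : R) *: z.1) * dens z) =
  \int[mu]_(xi in sphere) \int[leb]_(r in `]0%R, +oo[)
     (h (r *: xi) * (r `^ (- 1 - alpha))%:E).
Proof.
move=> mh h0.
pose H (z : 'rV[R]_d * measurableTypeR R) := h ((z.2 : R) *: z.1) * dens z.
have mH : measurable_fun setT H.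
  apply: emeasurable_funM; last exact: mdens.
  by apply: measurableT_comp; [exact: mh|exact: measurable_scale].
have H0 z : 0 <= H z by apply: mule_ge0; [exact: h0|exact: dens_ge0].
rewrite (@fubini_tonelli1 _ _ _ _ R mu leb H mH H0).
rewrite [RHS]integral_mkcond; apply: eq_integral => xi _.
rewrite /fubini_F patchE; case: ifPn => xis.
  rewrite [RHS]integral_mkcond; apply: eq_integral => r _.
  rewrite patchE /H /dens /densR/= !indicE xis mul1r; case: ifPn => r0.
    by rewrite mul1r.
  by rewrite mul0r mule0.
rewrite integral0_eq// => r _.
by rewrite /H /dens /densR/= indicE (negbTE xis) mul0r mule0.
Qed.

Lemma ge0_integral_levy (f : 'rV[R]_d -> \bar R) : measurable_fun setT f ->
  (forall y, 0 <= f y) ->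
  \int[nu]_y f y = \int[mu]_(xi in sphere) \int[leb]_(r in `]0%R, +oo[)
     (f (r *: xi) * (r `^ (- 1 - alpha))%:E).
Proof.
move=> mf f0; rewrite -polar_iterated//.
apply: (@ge0_integral_image_density _ _ _ _ R nu (mu \x leb)%E
  (fun z : 'rV[R]_d * measurableTypeR R => (z.2 : R) *: z.1) densR) => //.
- exact: measurable_scale.
- exact/measurable_EFinP.
move=> A mA.
have ind0 v : 0 <= (\1_A v : R)%:E by rewrite lee_fin.
have ind1 : measurable_fun setT (fun v => (\1_A v : R)%:E).
  by apply/measurable_EFinP; exact: measurable_indic.
etransitivity; last exact: (esym (polar_iterated ind1 ind0)).
by apply: eq_integral => xi _; apply: eq_integral => r _; rewrite EFinM.
Qed.

Lemma measurable_polar_inner (f : 'rV[R]_d -> \bar R) :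
  measurable_fun setT f -> (forall y, 0 <= f y) ->
  measurable_fun setT (fun xi : 'rV[R]_d => \int[leb]_(r in `]0%R, +oo[)
    (f (r *: xi) * (r `^ (- 1 - alpha))%:E)).
Proof.
move=> mf f0.
pose S : set ('rV[R]_d * measurableTypeR R) := setT `*` `]0%R, +oo[%classic.
have mS : measurable S by apply: measurableX => //; exact: measurable_itv.
pose G := (fun z : 'rV[R]_d * measurableTypeR R =>
     f ((z.2 : R) *: z.1) * ((z.2 : R) `^ (- 1 - alpha))%:E) \_ S.
rewrite (_ : (fun xi => _) = fubini_F leb G); last first.
  apply/funext => xi; rewrite integral_mkcond; apply: eq_integral => r _.
  rewrite /G !patchE.
  by congr (if _ then _ else _); apply/idP/idP; rewrite !inE// => -[].
apply: measurable_fun_fubini_tonelli_F; last first.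
  by move=> z; apply: erestrict_ge0 => t _; rewrite mule_ge0// lee_fin powR_ge0.
apply/(measurable_restrictT _ mS); apply: measurable_funTS.
apply: emeasurable_funM.
  by apply: measurableT_comp; [exact: mf|exact: measurable_scale].
apply/measurable_EFinP.
apply: (@measurableT_comp _ _ _ _ _ _ (fun r : R => (r `^ (- 1 - alpha))%R)).
  exact: measurable_powR.
exact: measurable_snd.
Qed.

Lemma integral_levy_scale (a : R) (f : 'rV[R]_d -> \bar R) : (0 < a)%R ->
  measurable_fun setT f -> (forall y, 0 <= f y) ->
  \int[nu]_y f (a *: y) = (a `^ alpha)%:E * \int[nu]_y f y.
Proof.
move=> a0 mf f0.
have ma : measurable_fun setT (fun y : 'rV[R]_d => a *: y).
  apply: measurable_fun_rV => i; under eq_fun do rewrite mxE.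
  by apply: measurable_funM => //; exact: measurable_coord.
rewrite !ge0_integral_levy//; last exact: measurableT_comp.
pose G xi (r : R) := ((fun r : R => f (r *: xi) * (r `^ (- 1 - alpha))%:E) \_ `]0%R, +oo[) r.
have mG xi : measurable_fun setT (G xi).
  apply/(measurable_restrictT _ (measurable_itv _)).
  apply: measurable_funTS; apply: emeasurable_funM.
    apply: measurableT_comp => //.
    exact: (measurable_fun_pair2 _ measurable_scale).
  by apply/measurable_EFinP; exact: measurable_powR.
have G0 xi r : 0 <= G xi r.
  by apply: erestrict_ge0 => t _; rewrite mule_ge0// lee_fin powR_ge0.
transitivity (\int[mu]_(xi in sphere) ((a `^ alpha)%:E *
    \int[leb]_(r in `]0%R, +oo[) (f (r *: xi) * (r `^ (- 1 - alpha))%:E))).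
  apply: eq_integral => xi _.
  rewrite [X in _ = _ * X]integral_mkcond -[X in _ = _ * X]/(\int[leb]_r G xi r).
  have -> : \int[leb]_r G xi r = a%:E * \int[leb]_r G xi (a * r + 0)%R.
    by rewrite ge0_integral_affine// muleA -EFinM divff ?mul1e// gt_eqF.
  rewrite muleA -EFinM -ge0_integralZl//; last 2 first.
  - apply: (measurableT_comp (mG xi)).
    by apply: measurable_funD => //; exact: measurable_funM.
  - by rewrite lee_fin mulr_ge0 ?powR_ge0// ltW.
  rewrite [LHS]integral_mkcond; apply: eq_integral => r _.
  rewrite addr0 /G !patchE !mem_setE !in_itv/= !andbT pmulr_rgt0//.
  case: ifPn => r0; last by rewrite mule0.
  have E : (a `^ alpha * a * (a * r) `^ (- 1 - alpha))%R = (r `^ (- 1 - alpha))%R.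
    rewrite powRM ?ltW// mulrA -{2}(powRr1 (ltW a0)) -!powRD ?(gt_eqF a0) ?implybT//.
    by rewrite -addrA (_ : (1 + (-1 - alpha))%R = - alpha)%R ?subrr ?powRr0 ?mul1r//; ring.
  by rewrite [RHS]muleCA -EFinM E scalerA.
rewrite ge0_integralZl//.
- exact: measurable_sphere.
- by apply: measurable_funTS; exact: measurable_polar_inner.
- move=> xi _; apply: integral_ge0 => r _.
  by rewrite mule_ge0// lee_fin powR_ge0.
- by rewrite lee_fin powR_ge0.
Qed.

End levy_polar.

Section trigonometric_bounds.
Context {R : realType}.

Lemma mvt_bound (f f' : R -> R) (M a b : R) : a <= b ->
  (forall t : R, is_derive t 1 f (f' t)) ->
  (forall t, a <= t <= b -> `|f' t| <= M) -> `|f b - f a| <= M * (b - a).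
Proof.
move=> ab df fM.
have [|c] := MVT_segment ab (fun x _ => df x).
  apply: continuous_subspaceT => t; apply: differentiable_continuous.
  by apply/derivable1_diffP; exact: ex_derive.
rewrite in_itv/= => cab ->; rewrite normrM [X in _ * X]ger0_norm ?subr_ge0//.
by rewrite ler_wpM2r ?subr_ge0// fM.
Qed.

Lemma sin_lipschitz (a b : R) : `|sin b - sin a| <= `|b - a|.
Proof.
wlog ab : a b / a <= b => [h|].
  have [/h//|/ltW/h] := leP a b; by rewrite distrC (distrC a).
rewrite [leRHS]ger0_norm ?subr_ge0// -[leRHS]mul1r.
by apply: (mvt_bound (f' := cos)) => // t _; exact: cos_max.
Qed.

Lemma cos_lipschitz (a b : R) : `|cos b - cos a| <= `|b - a|.
Proof.
have := sin_lipschitz (a + pi / 2) (b + pi / 2).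
by rewrite !sinDpihalf (_ : b + pi / 2 - (a + pi / 2) = b - a)//; ring.
Qed.

Lemma abs_sin_le (a : R) : `|sin a| <= `|a|.
Proof. by have := sin_lipschitz 0 a; rewrite sin0 !subr0. Qed.

Lemma cosB_prod (a b : R) :
  cos a - cos b = - 2 * sin ((a + b) / 2) * sin ((a - b) / 2).
Proof.
have ea : a = (a + b) / 2 + (a - b) / 2 by field.
have eb : b = (a + b) / 2 - (a - b) / 2 by field.
have -> : cos a = cos ((a + b) / 2 + (a - b) / 2) by congr cos.
have -> : cos b = cos ((a + b) / 2 - (a - b) / 2) by congr cos.
by rewrite cosD cosB; ring.
Qed.

Lemma cosB_le (a b : R) : `|cos a - cos b| <= `|a + b| * `|a - b|.
Proof.
rewrite cosB_prod !normrM normrN.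
have h1 := abs_sin_le ((a + b) / 2); have h2 := abs_sin_le ((a - b) / 2).
rewrite !normrM [`|2^-1|]ger0_norm// in h1 h2.
rewrite (ger0_norm (ler0n _ 2)).
have := ler_pM (normr_ge0 _) (normr_ge0 _) h1 h2.
have := mulr_ge0 (normr_ge0 (a + b)) (normr_ge0 (a - b)).
set p := `|a + b|; set q := `|a - b|; set s := `|sin _|; set t := `|sin _|.
by nra.
Qed.

Lemma onemcos_ge0 (a : R) : 0 <= 1 - cos a.
Proof. by rewrite subr_ge0 cos_le1. Qed.

Lemma onemcos_le (a : R) : 1 - cos a <= a ^+ 2.
Proof.
have := cosB_le 0 a; rewrite cos0 add0r sub0r normrN ger0_norm ?onemcos_ge0//.
by rewrite -expr2 real_normK ?num_real.
Qed.

Lemma onemcos_lower (a : R) : 1 <= `|a| <= 2 -> 1 - cos 1 <= 1 - cos a.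
Proof.
move=> /andP[a1 a2]; rewrite -(cos_norm a) lerD2l lerN2.
have pi2 := @pi_ge2 R.
have [->//|n1] := eqVneq `|a| 1; apply: ltW.
have := @ltr_cos R => /(_ 1 `|a|); rewrite !in_itv/= => -> //.
- by rewrite lt_neqAle eq_sym n1 a1.
- by rewrite ler01/= (le_trans _ pi2)// ler1n.
- by rewrite normr_ge0/= (le_trans a2).
Qed.

Lemma onemcos1_gt0 : 0 < 1 - cos 1 :> R.
Proof.
rewrite subr_gt0 -[X in _ < X]cos0.
have pi2 := @pi_ge2 R.
have := @ltr_cos R => /(_ 0 1); rewrite !in_itv/= => -> //.
- by rewrite lexx/= (le_trans _ pi2).
- by rewrite ler01/= (le_trans _ pi2)// ler1n.
Qed.

End trigonometric_bounds.

Section levy_estimates.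
Context {R : realType} {d : nat}.
Variables (alpha : R) (mu : {finite_measure set 'rV[R]_d -> \bar R}).
Hypothesis alpha_bounds : 0 < alpha < 2.
Notation nu := (levy_measure alpha mu).
Notation leb := (@lebesgue_measure R).

Let alpha_gt0 : 0 < alpha. Proof. by case/andP: alpha_bounds. Qed.
Let alpha_lt2 : alpha < 2. Proof. by case/andP: alpha_bounds. Qed.

Definition far : set 'rV[R]_d := [set y | 1 <= enorm y].
Definition near0 : set 'rV[R]_d := [set y | enorm y < 1].

Lemma measurable_far : measurable far.
Proof.
have := @measurable_enorm R d measurableT _ (measurable_itv `[1, +oo[).
rewrite setTI (_ : enorm @^-1` _ = far)//.
by apply/seteqP; split => y; rewrite /far/= in_itv/= andbT.
Qed.

Lemma measurable_near0 : measurable near0.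
Proof.
have := @measurable_enorm R d measurableT _ (measurable_itv `]-oo, 1[).
by rewrite setTI (_ : enorm @^-1` _ = near0).
Qed.

Lemma near0C : ~` near0 = far.
Proof.
apply/seteqP; split => y; rewrite /far/near0/=.
  by move/negP; rewrite -leNgt.
by move=> h; apply/negP; rewrite -leNgt.
Qed.

Lemma measurable_eball (x : 'rV[R]_d) r : measurable (eball x r).
Proof.
have m : measurable_fun setT (fun y : 'rV[R]_d => enorm (y - x)).
  apply: measurableT_comp; first exact: measurable_enorm.
  apply: measurable_fun_rV => i; under eq_fun do rewrite !mxE.
  by apply: measurable_funB => //; exact: measurable_coord.
by have := m measurableT _ (measurable_itv `]-oo, r[); rewrite setTI.
Qed.

Lemma levy_radial (phi : R -> \bar R) : measurable_fun setT phi ->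
  (forall r, 0 <= phi r)%E ->
  (\int[nu]_y phi (enorm y) =
   \int[leb]_(r in `]0%R, +oo[) (phi r * (r `^ (- 1 - alpha))%:E) * mu sphere)%E.
Proof.
move=> mphi phi0; rewrite ge0_integral_levy//; last first.
  by apply: measurableT_comp => //; exact: measurable_enorm.
rewrite -integral_cst; last exact: measurable_sphere.
apply: eq_integral => xi /set_mem; rewrite /sphere/= => xi1.
apply: eq_integral => r; rewrite inE/= in_itv/= andbT => r0.
by rewrite enormZ xi1 mulr1 gtr0_norm.
Qed.

Lemma levy_far_lty : (nu far < +oo)%E.
Proof.
have -> : (nu far = \int[nu]_y (\1_far y)%:E)%E.
  by rewrite integral_indic ?setIT//; exact: measurable_far.
pose phi r : \bar R := (\1_(`[1, +oo[%classic : set R) r)%:E.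
have -> : (\int[nu]_y (\1_far y)%:E = \int[nu]_y phi (enorm y))%E.
  apply: eq_integral => y _; rewrite /phi !indicE; congr (_%:R%:E).
  by congr nat_of_bool; apply/idP/idP; rewrite !inE /far/= in_itv/= andbT.
rewrite levy_radial//; last by move=> r; rewrite lee_fin.
  rewrite lte_mul_pinfty ?fin_num_measure//.
  - by apply: integral_ge0 => r _; apply: mule_ge0; rewrite lee_fin ?powR_ge0.
  - rewrite ge0_fin_numE; last first.
      by apply: integral_ge0 => r _; apply: mule_ge0; rewrite lee_fin ?powR_ge0.
    rewrite (_ : (\int[leb]_(r in _) _ = \int[leb]_(r in `]0%R, +oo[ `&` `[1%R, +oo[)
       (r `^ (- 1 - alpha))%:E)%E); last first.
      rewrite integral_mkcondr; apply: eq_integral => r _.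
      by rewrite patchE /phi indicE; case: ifP => _; rewrite ?mul1e ?mul0e.
    rewrite (_ : _ `&` _ = `[1%R, +oo[%classic); last first.
      apply/seteqP; split => r /=; rewrite !in_itv/= !andbT; first by case.
      by move=> r1; split => //; exact: lt_le_trans r1.
    rewrite -integral_itv_obnd_cbnd; last first.
      by apply/measurable_EFinP; apply: measurable_funTS; exact: measurable_powR.
    have h : -1 - alpha < -1 by rewrite gtrBl alpha_gt0.
    by rewrite (integral_powR_infty ltr01 h) ltry.
  - by rewrite -ge0_fin_numE// fin_num_measure//; exact: measurable_sphere.
by apply/measurable_EFinP; apply: measurable_indic; exact: measurable_itv.
Qed.

Lemma levy_near_sqr_lty : (\int[nu]_(y in near0) (enorm y ^+ 2)%:E < +oo)%E.
Proof.
pose phi := (fun r : R => (r ^+ 2)%:E) \_ `]-oo, 1[.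
have -> : (\int[nu]_(y in near0) (enorm y ^+ 2)%:E = \int[nu]_y phi (enorm y))%E.
  rewrite integral_mkcond; apply: eq_integral => y _; rewrite /phi !patchE.
  by congr (if _ then _ else _); apply/idP/idP; rewrite !inE.
rewrite levy_radial; last 2 first.
- apply/(measurable_restrictT _ (measurable_itv _)).
  by apply/measurable_EFinP; apply: measurable_funTS; exact: exprn_measurable.
- by move=> r; apply: erestrict_ge0 => t _; rewrite lee_fin sqr_ge0.
rewrite lte_mul_pinfty ?fin_num_measure//.
- apply: integral_ge0 => r _; rewrite mule_ge0//; last by rewrite lee_fin powR_ge0.
  by apply: erestrict_ge0 => t _; rewrite lee_fin sqr_ge0.
- rewrite ge0_fin_numE; last first.
    apply: integral_ge0 => r _; rewrite mule_ge0//; last by rewrite lee_fin powR_ge0.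
    by apply: erestrict_ge0 => t _; rewrite lee_fin sqr_ge0.
  apply: (@le_lt_trans _ _ (\int[leb]_(r in `]0%R, 1%R]) (r `^ (1 - alpha))%:E)%E); last first.
    have h : -1 < 1 - alpha.
      by rewrite ltrBrDr addrC ltrBlDr; exact: alpha_lt2.
    by rewrite (le_lt_trans (integral_powR_zero_le ltr01 h))// ltry.
  rewrite [leRHS]integral_mkcond [leLHS]integral_mkcond.
  rewrite le_eqVlt; apply/orP; left; apply/eqP.
  rewrite -[LHS]integral_mkcond -[RHS]integral_mkcond.
  rewrite -integral_itv_bndo_bndc; last first.
    by apply/measurable_EFinP; apply: measurable_funTS; exact: measurable_powR.
  rewrite (_ : `]0%R, 1%R[%classic = `]0%R, +oo[ `&` `]-oo, 1[ :> set R); last first.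
    apply/seteqP; split => r /=; rewrite !in_itv/= ?andbT; first by move=> /andP[].
    by move=> [-> ->].
  rewrite integral_mkcondr; apply: eq_integral => r; rewrite inE/= in_itv/= andbT => r0.
  rewrite /phi !patchE; case: ifP => _; last by rewrite mul0e.
  rewrite -EFinM -powR_mulrn ?ltW// -powRD ?(gt_eqF r0) ?implybT//.
  by congr (_ `^ _)%:E; ring.
- by rewrite -ge0_fin_numE// fin_num_measure//; exact: measurable_sphere.
Qed.

Lemma levy_ball_le gamma : gamma_measure_on_sphere nu gamma ->
  exists2 c, 0 <= c & forall x r, 0 < r -> r < enorm x / 2 ->
    (nu (eball x r) <= (c * r `^ gamma * enorm x `^ (- (alpha + gamma)))%:E)%E.
Proof.
move=> [c hc]; exists `|c| => // x r r0 rx.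
have x0 : 0 < enorm x.
  by have := lt_trans r0 rx; rewrite pmulr_lgt0// invr_gt0.
pose a := enorm x; pose xh := a^-1 *: x; pose f y : \bar R := (\1_(eball x r) y)%:E.
have mf : measurable_fun setT f.
  by apply/measurable_EFinP; apply: measurable_indic; exact: measurable_eball.
have f0 y : (0 <= f y)%E by rewrite lee_fin.
have := integral_levy_scale alpha mu x0 mf f0.
rewrite [in X in _ = X -> _]integral_indic ?setIT//; last exact: measurable_eball.
have -> : (\int[nu]_y f (enorm x *: y) = nu (eball xh (r / a)))%E.
  rewrite -[X in _ = nu X]setIT -integral_indic//; last exact: measurable_eball.
  apply: eq_integral => y _; rewrite /f !indicE; congr (_%:R%:E).
  congr nat_of_bool.
  have E : enorm (enorm x *: y - x) = a * enorm (y - xh).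
    rewrite -[a]ger0_norm ?enorm_ge0// -enormZ scalerBr scalerA divff ?gt_eqF//.
    by rewrite scale1r.
  by apply/idP/idP; rewrite !inE /eball/= E ltr_pdivlMr// mulrC.
move=> E; have e1 : enorm xh = 1.
  by rewrite enormZ ger0_norm ?invr_ge0 ?enorm_ge0// mulVf// gt_eqF.
have r1 : 0 < r / a < 1 / 2.
  by rewrite divr_gt0//= ltr_pdivrMr// mul1r mulrC.
have {}hc := hc xh (r / a) e1 r1; rewrite E in hc.
have ap : 0 < a `^ alpha by exact: powR_gt0.
rewrite -lee_pdivlMl// in hc; rewrite (le_trans hc)// -EFinM lee_fin.
have -> : (a `^ alpha)^-1 * (c * (r / a) `^ gamma) =
    c * (r `^ gamma * a `^ (- (alpha + gamma))).
  have -> : a `^ (- (alpha + gamma)) = (a `^ alpha)^-1 * (a `^ gamma)^-1.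
    by rewrite opprD powRD ?(gt_eqF x0) ?implybT// !powRN.
  have -> : (r / a) `^ gamma = r `^ gamma * (a `^ gamma)^-1.
    rewrite powRM ?invr_ge0 ?ltW//; congr (_ * _).
    by rewrite -powR_inv1 ?ltW// -powRrM mulN1r powRN.
  by ring.
rewrite mulrA !ler_wpM2r ?powR_ge0//.
exact: ler_norm.
Qed.

End levy_estimates.

Section levy_exponent_bounds.
Context {R : realType} {d : nat}.
Variables (alpha : R) (mu : {finite_measure set 'rV[R]_d -> \bar R}).
Hypothesis alpha_bounds : 0 < alpha < 2.
Notation nu := (levy_measure alpha mu).
Notation leb := (@lebesgue_measure R).
Implicit Types (u v y : 'rV[R]_d) (k : 'rV[R]_d -> R).

Let alpha_gt0 : 0 < alpha. Proof. by case/andP: alpha_bounds. Qed.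
Let alpha_lt2 : alpha < 2. Proof. by case/andP: alpha_bounds. Qed.

Lemma integrable_enorm_sqr : nu.-integrable near0 (EFin \o (fun y => enorm y ^+ 2)).
Proof.
apply/integrableP; split.
  apply/measurable_EFinP; apply: measurable_funTS.
  by apply: measurable_funX; exact: measurable_enorm.
under eq_integral do rewrite /= ger0_norm ?sqr_ge0//.
exact: levy_near_sqr_lty.
Qed.

Lemma integrable_near k C : measurable_fun setT k ->
  (forall y, near0 y -> `|k y| <= C * enorm y ^+ 2) ->
  nu.-integrable near0 (EFin \o k).
Proof.
move=> mk kC; apply: (le_integrable measurable_near0 _ _
  (integrableZl measurable_near0 C integrable_enorm_sqr)).
  by apply/measurable_EFinP; exact: measurable_funTS.
by move=> y ny; rewrite /= lee_fin (le_trans (kC y ny))// ler_norm.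
Qed.

Lemma integrable_far k M : measurable_fun setT k ->
  (forall y, `|k y| <= M) -> nu.-integrable far (EFin \o k).
Proof.
move=> mk kM; have mf := @measurable_far R d.
have h : nu.-integrable far (EFin \o (fun=> M)).
  apply/integrableP; split; first exact/measurable_EFinP.
  by rewrite /= integral_cst// lte_mul_pinfty//; exact: levy_far_lty.
apply: (le_integrable mf _ _ h).
  by apply/measurable_EFinP; exact: measurable_funTS.
by move=> y ny; rewrite /= lee_fin (le_trans (kM y))// ler_norm.
Qed.

Lemma measurable_dotpr u : measurable_fun setT (fun y : 'rV[R]_d => dotp u y).
Proof.
under eq_fun do rewrite dotpC.
by apply: continuous_measurable_rV; exact: dotp_continuous.
Qed.

Lemma measurable_cos_dotpr u a :
  measurable_fun setT (fun y : 'rV[R]_d => cos (dotp u y + a)).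
Proof. by under eq_fun do rewrite dotpC; exact: measurable_cos_dotp. Qed.

Definition Phi_near u : R := \int[nu]_(y in near0) (1 - cos (dotp u y)).
Definition cos_far u : R := \int[nu]_(y in far) cos (dotp u y).

Lemma measurable_cos_dotpr0 u : measurable_fun setT (fun y : 'rV[R]_d => cos (dotp u y)).
Proof.
have := measurable_cos_dotpr u 0.
by under eq_fun do rewrite addr0.
Qed.

Lemma onemcos_dotp_le u y : `|1 - cos (dotp u y)| <= enorm u ^+ 2 * enorm y ^+ 2.
Proof.
rewrite ger0_norm ?onemcos_ge0// (le_trans (onemcos_le _))// -exprMn.
by rewrite -real_normK ?num_real// lerXn2r ?nnegrE ?mulr_ge0 ?enorm_ge0// cauchy_schwarz.
Qed.

Lemma levy_exponentE u : levy_exponent alpha mu u =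
  (Phi_near u + (fine (nu far) - cos_far u))%:E.
Proof.
have m1 : measurable_fun setT (fun y => 1 - cos (dotp u y)).
  by apply: measurable_funB => //; exact: measurable_cos_dotpr0.
have i1 := integrable_near m1 (fun y _ => onemcos_dotp_le u y).
have i2 : nu.-integrable far (EFin \o (fun y => cos (dotp u y))).
  by apply: (@integrable_far _ 1); [exact: measurable_cos_dotpr0|move=> y; exact: cos_max].
have i3 : nu.-integrable far (EFin \o (fun=> 1)).
  by apply: (@integrable_far _ 1) => // y; rewrite normr1.
rewrite /levy_exponent.
transitivity (\int[nu]_(y in near0) (1 - cos (dotp u y))%:E +
   \int[nu]_(y in far) (1 - cos (dotp u y))%:E)%E.
  rewrite -ge0_integral_setU.
  - by rewrite -(@near0C R d) setUv.
  - exact: measurable_near0.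
  - exact: measurable_far.
  - by apply/measurable_EFinP; exact: measurable_funTS.
  - by move=> y _; rewrite lee_fin onemcos_ge0.
  - by rewrite -(@near0C R d); apply/disj_setPCl.
rewrite EFinD /Phi_near /Rintegral fineK; last first.
  exact: (integrable_fin_num measurable_near0 i1).
congr (_ + _)%E.
have i4 : nu.-integrable far (EFin \o (fun y => 1 - cos (dotp u y))).
  exact: (integrableB (@measurable_far R d) i3 i2).
rewrite -[LHS](fineK (integrable_fin_num (@measurable_far R d) i4)).
congr EFin; rewrite -[LHS]/(\int[nu]_(y in far) (1 - cos (dotp u y))).
rewrite RintegralB//; last exact: measurable_far.
by rewrite Rintegral_cst ?mul1r//; exact: measurable_far.
Qed.

Definition Phi u : R := fine (levy_exponent alpha mu u).

Lemma PhiE u : Phi u = Phi_near u + (fine (nu far) - cos_far u).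
Proof. by rewrite /Phi levy_exponentE. Qed.

Lemma levy_exponent_Phi u : levy_exponent alpha mu u = (Phi u)%:E.
Proof. by rewrite PhiE levy_exponentE. Qed.

Lemma Phi_scale a u : 0 < a -> Phi (a *: u) = a `^ alpha * Phi u.
Proof.
move=> a0; rewrite /Phi [in RHS]levy_exponent_Phi -[RHS]/(fine (_ * _)%:E) EFinM.
rewrite -levy_exponent_Phi /levy_exponent -integral_levy_scale//.
- by congr fine; apply: eq_integral => y _; rewrite dotpZl dotpZr.
- apply/measurable_EFinP; apply: measurable_funB => //.
  exact: measurable_cos_dotpr0.
Qed.

Lemma norm_le_enorm u : `|u| <= enorm u.
Proof.
rewrite -[`|u|]/(mx_norm u) mx_normrE; apply: bigmax_le; first exact: enorm_ge0.
by move=> [i j] _ /=; rewrite (ord1 i); exact: coord_le_enorm.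
Qed.

Lemma compact_sphere : compact (@sphere R d).
Proof.
apply: bounded_closed_compact.
  exists 1; split => // x x1 y; rewrite /sphere/= => y1.
  by rewrite (le_trans (norm_le_enorm y))// y1 ltW.
rewrite (_ : sphere = (@enorm R d) @^-1` [set x | x = 1])//.
by apply: preimage_closed; [move=> x _; exact: enorm_continuous|exact: closed_eq].
Qed.

Let Q u : R := \int[mu]_(xi in sphere) (dotp u xi ^+ 2).

Let dotp_sphere_le u xi : sphere xi -> `|dotp u xi| <= enorm u.
Proof. by move=> x1; rewrite -[leRHS]mulr1 -[X in _ * X]x1 cauchy_schwarz. Qed.

Let int_cst (k : R) : mu.-integrable sphere (EFin \o (fun=> k)).
Proof.
apply/integrableP; split; first exact/measurable_EFinP.
rewrite /= integral_cst; last exact: measurable_sphere.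
rewrite lte_mul_pinfty// -ge0_fin_numE// fin_num_measure//.
exact: measurable_sphere.
Qed.

Let intQ u : mu.-integrable sphere (EFin \o (fun xi => dotp u xi ^+ 2)).
Proof.
apply: (le_integrable measurable_sphere _ _ (int_cst (enorm u ^+ 2))).
  apply/measurable_EFinP; apply: measurable_funTS; apply: measurable_funX.
  exact: measurable_dotpr.
move=> xi x1; rewrite /= lee_fin !normrX lerXn2r ?nnegrE//.
by rewrite [leRHS]ger0_norm ?enorm_ge0//; exact: dotp_sphere_le.
Qed.

Let Q_continuous : continuous Q.
Proof.
apply: enorm_lipschitz_continuous => u.
exists ((2 * enorm u + 1) * fine (mu sphere)) => v v1.
rewrite /Q -(RintegralB measurable_sphere (intQ v) (intQ u)).
have iB : mu.-integrable sphere (EFin \o (fun xi => dotp v xi ^+ 2 - dotp u xi ^+ 2)).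
  exact: (integrableB measurable_sphere (intQ v) (intQ u)).
rewrite (le_trans (le_normr_Rintegral measurable_sphere iB))//.
have -> : (2 * enorm u + 1) * fine (mu sphere) * enorm (v - u) =
    \int[mu]_(xi in sphere) ((2 * enorm u + 1) * enorm (v - u)).
  by rewrite Rintegral_cst; [ring|exact: measurable_sphere].
apply: le_Rintegral.
- exact: measurable_sphere.
- exact: integrable_norm.
- exact: int_cst.
move=> xi x1; rewrite subr_sqr normrM -dotpBl -dotpDl mulrC ler_pM//.
  rewrite (le_trans (dotp_sphere_le (v + u) x1))//.
  rewrite (_ : v + u = (v - u) + (u + u)); last by rewrite addrA subrK.
  rewrite (le_trans (ler_enormD _ _))//.
  by have := ler_enormD u u; move: v1; lra.
exact: dotp_sphere_le.
Qed.

Hypothesis mu_spectral : spectral_measure mu.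

Let Q_gt0 u : u != 0 -> 0 < Q u.
Proof.
move=> u0; have Q0 : 0 <= Q u by apply: Rintegral_ge0 => xi _; rewrite sqr_ge0.
rewrite lt_neqAle Q0 andbT eq_sym; apply/eqP => Qu.
have [mu0 _ /(_ (lker (linfun (mulmxr u^T : 'rV[R]_d -> 'rV[R]_1))))] := mu_spectral.
have kerE x : (x \in lker (linfun (mulmxr u^T : 'rV[R]_d -> 'rV[R]_1))) = (dotp u x == 0).
  rewrite memv_ker lfunE/=; apply/eqP/eqP => [/rowP/(_ ord0)|ux].
    by rewrite !mxE dotpC => <-; apply: eq_bigr => i _; rewrite mxE.
  apply/rowP => i; rewrite (ord1 i) !mxE -[RHS]ux dotpC.
  by apply: eq_bigr => j _; rewrite mxE.
move=> h; have {}h : lker (linfun (mulmxr u^T : 'rV[R]_d -> 'rV[R]_1)) = fullv.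
  apply: h => x sx /=; rewrite kerE; apply/negPn/negP => ux.
  have nu0 : 0 < `|dotp u x| by rewrite normr_gt0.
  have eu0 : 0 < enorm u by rewrite enorm_gt0.
  pose r := `|dotp u x| / 2 / enorm u.
  have r0 : 0 < r by rewrite !divr_gt0.
  pose B := sphere `&` eball x r.
  have mB : measurable B.
    by apply: measurableI; [exact: measurable_sphere|exact: measurable_eball].
  have muB : (0 < mu B)%E.
    have := sx r r0; have -> : mu (eball x r) = mu B; last by [].
    have mE := measurable_eball x r; have mS := @measurable_sphere R d.
    rewrite (measureDI mu mE mS) setIC -/B [X in (X + _)%E](_ : _ = 0%E) ?add0e//.
    apply/eqP; rewrite -measure_le0 -mu0 le_measure// ?inE.
    - by apply: measurableD.
    - exact: measurableC.
  have : (((`|dotp u x| / 2) ^+ 2)%:E * mu B <= 0)%E.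
    have <- : (\int[mu]_(xi in sphere) (dotp u xi ^+ 2)%:E = 0)%E.
      rewrite -(fineK (integrable_fin_num measurable_sphere (intQ u))).
      by rewrite -[X in X%:E]/(Q u) Qu.
    rewrite -integral_cst//.
    apply: (@le_trans _ _ (\int[mu]_(xi in B) (dotp u xi ^+ 2)%:E)%E).
      apply: ge0_le_integral => //.
      - by move=> xi _; rewrite lee_fin sqr_ge0.
      - apply/measurable_EFinP; apply: measurable_funTS; apply: measurable_funX.
        exact: measurable_dotpr.
      move=> xi [_ xir]; rewrite lee_fin -[leRHS]real_normK ?num_real//.
      rewrite lerXn2r ?nnegrE//.
      have : `|dotp u (xi - x)| <= `|dotp u x| / 2.
        rewrite (le_trans (cauchy_schwarz _ _))// mulrC -ler_pdivlMr//.
        exact: ltW.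
      rewrite dotpBr; have := ler_dist_dist (dotp u xi) (dotp u x).
      have := ler_normB (dotp u xi) (dotp u xi - dotp u x).
      rewrite opprB addrC subrK; lra.
    apply: ge0_subset_integral => //.
    - exact: measurable_sphere.
    - apply/measurable_EFinP; apply: measurable_funTS; apply: measurable_funX.
      exact: measurable_dotpr.
    - by move=> xi _; rewrite lee_fin sqr_ge0.
    - by move=> z [].
  by apply/negP; rewrite -ltNge mule_gt0// lte_fin exprn_gt0// divr_gt0.
have := memvf u; rewrite -h kerE -sqr_enorm expf_eq0/= enorm_eq0.
by rewrite (negbTE u0).
Qed.

Let inner_lower u xi : enorm u = 1 -> sphere xi ->
  (((1 - cos 1) * 2 `^ (- 1 - alpha) * dotp u xi ^+ 2)%:E <=
   \int[leb]_(r in `]0%R, +oo[) ((1 - cos (dotp u (r *: xi))) * r `^ (- 1 - alpha))%:E)%E.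
Proof.
move=> u1 x1; have := dotp_sphere_le u x1; rewrite u1.
set b := `|dotp u xi|; rewrite -(real_normK (num_real (dotp u xi))) -/b => b1.
have g0 r : (0 <= ((1 - cos (dotp u (r *: xi))) * r `^ (- 1 - alpha))%:E)%E.
  by rewrite lee_fin mulr_ge0 ?onemcos_ge0 ?powR_ge0.
have [->|bn0] := eqVneq b 0; first by rewrite expr0n/= mulr0 integral_ge0.
have b0 : 0 < b by rewrite lt_neqAle eq_sym bn0 normr_ge0.
have mg (D : set R) : measurable_fun D
    (fun r => ((1 - cos (dotp u (r *: xi))) * r `^ (- 1 - alpha))%:E).
  apply: measurable_funTS; apply/measurable_EFinP; apply: measurable_funM; last exact: measurable_powR.
  apply: continuous_measurable_fun; under eq_fun do rewrite dotpZr.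
  apply: continuous_add; first exact: continuous_cst.
  apply: continuous_opp; apply: continuous_of; first exact: continuous_cos.
  by apply: continuous_mul; [move=> t; exact: cvg_id|exact: continuous_cst].
apply: (@le_trans _ _ (\int[leb]_(r in `[b^-1%R, (2 / b)%R])
   ((1 - cos (dotp u (r *: xi))) * r `^ (- 1 - alpha))%:E)%E); last first.
  apply: ge0_subset_integral => //; first exact: mg.
  move=> r /=; rewrite !in_itv/= andbT => /andP[h _].
  by apply: lt_le_trans h; rewrite invr_gt0.
apply: (@le_trans _ _ (\int[leb]_(r in `[b^-1%R, (2 / b)%R])
   ((1 - cos 1) * (2 / b) `^ (- 1 - alpha))%:E)%E).
  rewrite integral_cst//= lebesgue_measure_itv/= lte_fin.
  have -> : b^-1 < 2 / b by rewrite ltr_pMl ?invr_gt0// ltr1n.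
  rewrite -EFinB -EFinM lee_fin -!mulrA ler_wpM2l ?(ltW onemcos1_gt0)//.
  rewrite powRM ?invr_ge0// ?(ltW b0)// -mulrA ler_wpM2l ?powR_ge0//.
  have -> : 2 / b - b^-1 = b^-1 by field.
  rewrite -(powR_inv1 (ltW b0)) -powRrM -powRD ?bn0 ?implybT//.
  rewrite -powR_mulrn ?(ltW b0)// ger_powR ?b0//.
  by have := alpha_lt2; lra.
apply: ge0_le_integral => //.
- by move=> r _; rewrite lee_fin mulr_ge0 ?powR_ge0// ltW// onemcos1_gt0.
- exact: mg.
- move=> r /=; rewrite in_itv/= => /andP[r1 r2].
  have r0 : 0 < r by apply: lt_le_trans r1; rewrite invr_gt0.
  rewrite lee_fin ler_pM ?powR_ge0 ?(ltW onemcos1_gt0)//.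
    apply: onemcos_lower; rewrite dotpZr normrM -/b (gtr0_norm r0).
    by rewrite -ler_pdivrMr// div1r r1 -ler_pdivlMr.
  have -> : - 1 - alpha = - (1 + alpha) by ring.
  rewrite !powRN lef_pV2 ?posrE ?powR_gt0 ?divr_gt0//.
  by rewrite ge0_ler_powR ?nnegrE ?(ltW r0)// ?divr_ge0 ?(ltW b0)//; have := alpha_gt0; lra.
Qed.

Lemma Phi_lower : (0 < d)%N ->
  exists2 c, 0 < c & forall u, c * enorm u `^ alpha <= Phi u.
Proof.
move=> d0.
have [i0 _] : exists i0 : 'I_d, true by exists (Ordinal d0).
have e1 : sphere (@unit_vec R d i0) by exact: enorm_unit_vec.
have [|u0 /set_mem u01 minQ] := EVT_min_rV (ex_intro _ _ e1) compact_sphere (f := Q).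
  by apply: continuous_subspaceT; exact: Q_continuous.
have u0n : u0 != 0 by rewrite -enorm_gt0 u01.
pose K := (1 - cos 1) * 2 `^ (- 1 - alpha) : R.
have K0 : 0 < K by rewrite mulr_gt0 ?onemcos1_gt0// powR_gt0.
exists (K * Q u0); first by rewrite mulr_gt0// Q_gt0.
move=> u; have [->|un0] := eqVneq u 0.
  rewrite (_ : enorm 0 = 0); last by apply/eqP; rewrite enorm_eq0.
  rewrite powR0 ?gt_eqF// mulr0 -lee_fin -levy_exponent_Phi.
  by apply: integral_ge0 => y _; rewrite lee_fin onemcos_ge0.
have eu0 : 0 < enorm u by rewrite enorm_gt0.
have -> : u = enorm u *: ((enorm u)^-1 *: u) by rewrite scalerA divff ?gt_eqF// scale1r.
set v := _ *: u; have v1 : enorm v = 1.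
  by rewrite enormZ ger0_norm ?invr_ge0 ?enorm_ge0// mulVf// gt_eqF.
rewrite Phi_scale// enormZ v1 mulr1 (ger0_norm (enorm_ge0 _)) mulrC ler_wpM2l ?powR_ge0//.
rewrite (@le_trans _ _ (K * Q v))// ?ler_wpM2l ?(ltW K0)//.
  by apply: minQ; rewrite inE.
rewrite -lee_fin -levy_exponent_Phi /levy_exponent ge0_integral_levy; last 2 first.
- apply/measurable_EFinP; apply: measurable_funB => //.
  exact: measurable_cos_dotpr0.
- by move=> y; rewrite lee_fin onemcos_ge0.
rewrite /Q -RintegralZl//; last exact: measurable_sphere.
rewrite /Rintegral fineK; last first.
  apply: (integrable_fin_num measurable_sphere).
  exact: (integrableZl measurable_sphere K (intQ v)).
under [leRHS]eq_integral do under eq_integral do rewrite -EFinM.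
apply: ge0_le_integral.
- exact: measurable_sphere.
- by move=> xi _; rewrite lee_fin mulr_ge0 ?(ltW K0)// sqr_ge0.
- apply/measurable_EFinP; apply: measurable_funTS; apply: measurable_funM => //.
  by apply: measurable_funX; exact: measurable_dotpr.
- apply: measurable_funTS; have := @measurable_polar_inner R d alpha
    (fun y => (1 - cos (dotp v y))%:E).
  under [X in _ -> _ -> measurable_fun _ X]eq_fun do
    under eq_integral do rewrite -EFinM.
  apply; last by move=> y; rewrite lee_fin onemcos_ge0.
  apply/measurable_EFinP; apply: measurable_funB => //.
  exact: measurable_cos_dotpr0.
- by move=> xi x1; rewrite /K; exact: inner_lower.
Qed.

End levy_exponent_bounds.

(** * Decay of the small-jump factor *)

Section directional_derivatives.
Context {R : realType} {d : nat}.
Implicit Types (u v y : 'rV[R]_d) (F G : 'rV[R]_d -> R).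

Lemma is_derive_dir_mul F G u v (l m : R) :
  is_derive u v F l -> is_derive u v G m ->
  is_derive u v (fun w => F w * G w) (l * G u + F u * m).
Proof.
move=> dF dG; have h := is_deriveM dF dG.
by apply: is_derive_eq h _; rewrite /GRing.scale/= addrC (mulrC l).
Qed.

Lemma is_derive_dir_add F G u v (l m : R) :
  is_derive u v F l -> is_derive u v G m ->
  is_derive u v (fun w => F w + G w) (l + m).
Proof. by move=> dF dG; exact: is_deriveD. Qed.

Lemma is_derive_dir_opp F u v (l : R) :
  is_derive u v F l -> is_derive u v (fun w => - F w) (- l).
Proof. by move=> dF; exact: is_deriveN. Qed.

Lemma is_derive_dir_expR F u v (l : R) :
  is_derive u v F l -> is_derive u v (fun w => expR (F w)) (l * expR (F u)).
Proof.
move=> /derive_along0 dF; apply/derive_along0.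
have := is_derive1_comp (is_derive_expR (F (0 *: v + u))) dF.
by rewrite scale0r add0r mulrC.
Qed.

Lemma is_derive_cos_dotp u v y (a : R) :
  is_derive u v (fun w => cos (dotp w y + a)) (dotp v y * cos (dotp u y + (a + pi / 2))).
Proof.
apply/derive_along0.
have h : is_derive (0 : R) 1 (fun s => cos (s * dotp v y + (dotp u y + a)))
    (dotp v y * cos (dotp u y + (a + pi / 2))).
  apply: is_derive_eq.
  rewrite /GRing.scale/= !(mulr0, mul0r, mulr1, add0r, addr0) [in RHS]addrA cosDpihalf.
  by ring.
rewrite [X in is_derive _ _ X _](_ : _ =
  (fun s => cos (s * dotp v y + (dotp u y + a))))//.
by apply/funext => t; rewrite dotpDl dotpZl addrA.
Qed.

End directional_derivatives.

Section symbols.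
Context {R : realType} {d : nat}.
Implicit Types (F G : 'rV[R]_d -> R).

Definition polyb G : Prop :=
  continuous G /\ exists C k, 0 <= C /\ forall u, `|G u| <= C * (1 + enorm u) ^+ k.

Fixpoint symb n G : Prop := match n with
  | 0 => polyb G
  | n'.+1 => polyb G /\ forall i : 'I_d, exists G' : 'rV[R]_d -> R,
      (forall u, is_derive u (unit_vec i) G (G' u)) /\ symb n' G'
  end.

Lemma symb_polyb n G : symb n G -> polyb G.
Proof. by case: n => [//|n []]. Qed.

Lemma symbW n G : symb n.+1 G -> symb n G.
Proof.
elim: n G => [|n ih] G [pG dG]; first by [].
split => // i; have [G' [dG' sG']] := dG i; exists G'; split => //.
exact: ih.
Qed.

Let onepe u : 1 <= 1 + @enorm R d u. Proof. by rewrite lerDl enorm_ge0. Qed.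

Lemma polyb_add F G : polyb F -> polyb G -> polyb (fun u => F u + G u).
Proof.
move=> [cF [C [k [C0 FC]]]] [cG [C' [k' [C'0 GC]]]].
split; first exact: continuous_add.
exists (C + C'), (k + k')%N; split; first exact: addr_ge0.
move=> u; rewrite (le_trans (ler_normD _ _))// mulrDl lerD//.
  by rewrite (le_trans (FC u))// ler_wpM2l// ler_weXn2l ?onepe// leq_addr.
by rewrite (le_trans (GC u))// ler_wpM2l// ler_weXn2l ?onepe// leq_addl.
Qed.

Lemma polyb_mul F G : polyb F -> polyb G -> polyb (fun u => F u * G u).
Proof.
move=> [cF [C [k [C0 FC]]]] [cG [C' [k' [C'0 GC]]]].
split; first exact: continuous_mul.
exists (C * C'), (k + k')%N; split; first exact: mulr_ge0.
by move=> u; rewrite normrM exprD mulrACA ler_pM.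
Qed.

Lemma symb_add n F G : symb n F -> symb n G -> symb n (fun u => F u + G u).
Proof.
elim: n F G => [|n ih] F G; first exact: polyb_add.
move=> [pF dF] [pG dG]; split; first exact: polyb_add.
move=> i; have [F' [dF' sF]] := dF i; have [G' [dG' sG]] := dG i.
exists (fun u => F' u + G' u); split; last exact: ih.
by move=> u; exact: is_derive_dir_add.
Qed.

Lemma symb_mul n F G : symb n F -> symb n G -> symb n (fun u => F u * G u).
Proof.
elim: n F G => [|n ih] F G; first exact: polyb_mul.
move=> sF sG; have [pF dF] := sF; have [pG dG] := sG.
split; first exact: polyb_mul.
move=> i; have [F' [dF' sF']] := dF i; have [G' [dG' sG']] := dG i.
exists (fun u => F' u * G u + F u * G' u); split.
  by move=> u; exact: is_derive_dir_mul.
by apply: symb_add; apply: ih => //; exact: symbW.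
Qed.

Lemma symb_cst n (c : R) : symb n (fun=> c).
Proof.
have pc e : polyb (fun=> e).
  split; first exact: continuous_cst.
  by exists `|e|, 0%N; split => // u; rewrite expr0 mulr1.
elim: n c => [|n ih] c; first exact: pc.
split; first exact: pc.
move=> i; exists (fun=> 0); split => [u|]; [exact: is_derive_cst|exact: ih].
Qed.

Lemma symb_coord n (j : 'I_d) : symb n (fun u : 'rV[R]_d => u ord0 j).
Proof.
have pc : polyb (fun u : 'rV[R]_d => u ord0 j).
  split; first exact: coord_continuous.
  exists 1, 1%N; split => // u; rewrite mul1r expr1 (le_trans (coord_le_enorm _ _))//.
  by rewrite lerDr.
case: n => [//|n]; split => // i; exists (fun=> (i == j)%:R); split; last exact: symb_cst.
move=> u; apply/derive_along0.
have h : is_derive (0 : R) 1 (fun s => s * (i == j)%:R + u ord0 j) ((i == j)%:R : R).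
  by apply: is_derive_eq; rewrite /GRing.scale/= !(mulr0, mulr1, add0r, addr0).
rewrite [X in is_derive _ _ X _](_ : _ = (fun s => s * (i == j)%:R + u ord0 j))//.
by apply/funext => t; rewrite /unit_vec !mxE eqxx/= eq_sym.
Qed.

Definition monom (b : {ffun 'I_d -> nat}) (u : 'rV[R]_d) : R :=
  \prod_i u ord0 i ^+ b i.

Lemma symb_monom n b : symb n (monom b).
Proof.
rewrite /monom; elim: (index_enum _) => [|i s ih].
  under [X in symb _ X]eq_fun do rewrite big_nil; exact: symb_cst.
under [X in symb _ X]eq_fun do rewrite big_cons.
apply: symb_mul => //; elim: (b i) => [|m ihm].
  under [X in symb _ X]eq_fun do rewrite expr0; exact: symb_cst.
under [X in symb _ X]eq_fun do rewrite exprS.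
by apply: symb_mul => //; exact: symb_coord.
Qed.

Fixpoint sch n (E : 'rV[R]_d -> R) : Prop := match n with
  | 0 => cdom E
  | n'.+1 => cdom E /\ forall i : 'I_d, exists E' : 'rV[R]_d -> R,
      (forall u, is_derive u (unit_vec i) E (E' u)) /\ sch n' E'
  end.

Lemma sch_cdom n E : sch n E -> cdom E.
Proof. by case: n => [//|n []]. Qed.

Lemma sch_decay_coord n E i : sch n E ->
  exists C, forall a (x : 'rV[R]_d), `|x ord0 i| ^+ n * `|FT a E x| <= C.
Proof.
elim: n E => [|n ih] E.
  by move=> /FT_bounded[M EM]; exists M => a x; rewrite expr0 mul1r.
move=> [cE dE]; have [E' [dE' sE']] := dE i.
have [C EC] := ih _ sE'; exists C => a x.
have cE' := sch_cdom sE'.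
have h : x ord0 i * FT a E x = - FT (a - pi / 2) E' x.
  apply/eqP; rewrite -subr_eq0 opprK; apply/eqP.
  rewrite /FT -RintegralZl//; last exact/cdom_integrable/cdom_cos.
  have c1 : cdom (fun u => x ord0 i * (cos (dotp u x + a) * E u)).
    by apply: (@cdom_mul_bounded _ _ (fun=> x ord0 i) _ `|x ord0 i|) => //; exact: cdom_cos.
  rewrite -RintegralD//; [|exact: cdom_integrable|exact/cdom_integrable/cdom_cos].
  apply: (@integral_partial0 _ _ (fun u => cos (dotp u x + (a - pi / 2)) * E u) _ i).
  - exact: cdom_cos.
  - by apply: cdom_add => //; exact: cdom_cos.
  move=> u; have := is_derive_dir_mul (is_derive_cos_dotp u (unit_vec i) x (a - pi / 2)) (dE' u).
  by rewrite subrK dotpC dotp_unit_vec mulrA.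
rewrite exprSr -mulrA -normrM h normrN; exact: EC.
Qed.

Lemma enorm_le_coord (x : 'rV[R]_d) : (0 < d)%N ->
  exists i, enorm x <= d%:R * `|x ord0 i|.
Proof.
move=> d0; apply: contrapT => /forallNP h.
have := enorm_le_sum x; apply/negP; rewrite -ltNge.
have -> : enorm x = \sum_(i < d) (enorm x / d%:R).
  rewrite sumr_const card_ord -[RHS]mulr_natr divfK//.
  by rewrite pnatr_eq0 -lt0n.
apply: ltr_sum => [|i _]; first by apply/hasP; exists (Ordinal d0); rewrite ?mem_index_enum.
have /negP := h i; rewrite -ltNge => hi.
by rewrite ltr_pdivlMr ?ltr0n// mulrC.
Qed.

Lemma sch_decay n E : (0 < d)%N -> (forall m, sch m E) ->
  exists2 C, 0 <= C & forall a (x : 'rV[R]_d), `|FT a E x| <= C * (1 + enorm x) ^- n.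
Proof.
move=> d0 sE; have [M EM] := FT_bounded (sE 0%N).
have /choice[C EC] : forall i : 'I_d, exists C, forall a (x : 'rV[R]_d), `|x ord0 i| ^+ n * `|FT a E x| <= C.
  by move=> i; exact: sch_decay_coord.
have M0 : 0 <= M by rewrite (le_trans _ (EM 0 0)).
have C0 i : 0 <= C i by rewrite (le_trans _ (EC i 0 0))// mulr_ge0// exprn_ge0.
exists (2 ^+ n * (M + \sum_i d%:R ^+ n * C i)).
  rewrite mulr_ge0// addr_ge0// sumr_ge0// => i _.
  by rewrite mulr_ge0// exprn_ge0.
move=> a x; have p : 0 < 1 + enorm x by rewrite ltr_pwDl// enorm_ge0.
rewrite ler_pdivlMr ?exprn_gt0// mulrC.
have s0 : 0 <= \sum_i d%:R ^+ n * C i.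
  by rewrite sumr_ge0// => i _; rewrite mulr_ge0// exprn_ge0.
have [x1|x1] := leP (enorm x) 1.
  apply: (@le_trans _ _ (2 ^+ n * M)).
    apply: ler_pM => //; first by rewrite exprn_ge0// ltW.
    by rewrite lerXn2r ?nnegrE ?(ltW p)//; lra.
  by rewrite ler_wpM2l ?exprn_ge0// lerDl.
have [i xi] := enorm_le_coord x d0.
apply: (@le_trans _ _ (2 ^+ n * (d%:R ^+ n * C i))); last first.
  rewrite ler_wpM2l ?exprn_ge0// (bigD1 i)//= addrCA lerDl addr_ge0//.
  by rewrite sumr_ge0// => j _; rewrite mulr_ge0// exprn_ge0.
apply: (@le_trans _ _ ((2 * (d%:R * `|x ord0 i|)) ^+ n * `|FT a E x|)).
  rewrite ler_wpM2r// lerXn2r ?nnegrE ?(ltW p) ?mulr_ge0//; lra.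
by rewrite !exprMn -!mulrA !ler_wpM2l ?exprn_ge0//.
Qed.

End symbols.

Section exponential_damping.
Context {R : realType}.

Lemma powR_expR_bounded (c alpha : R) (m : nat) : 0 < c -> 0 < alpha ->
  exists C, forall t, 0 <= t -> (1 + t) ^+ m * expR (- (c * t `^ alpha)) <= C.
Proof.
move=> c0 a0; pose N := (Num.truncn (m%:R / alpha)).+1.
have Nm : m%:R <= alpha * N%:R.
  by rewrite mulrC -ler_pdivrMr// ltW// truncnS_gt.
exists (2 ^+ m + 2 ^+ m * (N`!%:R / c ^+ N)) => t t0.
have e1 : expR (- (c * t `^ alpha)) <= 1.
  by rewrite -expR0 ler_expR oppr_le0 mulr_ge0 ?powR_ge0// ltW.
have q0 : 0 <= N`!%:R / c ^+ N by rewrite divr_ge0// exprn_ge0// ltW.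
have [t1|t1] := leP t 1.
  apply: (@le_trans _ _ (2 ^+ m * 1)); last by rewrite mulr1 lerDl mulr_ge0 ?exprn_ge0.
  apply: ler_pM => //; rewrite ?expR_ge0 ?exprn_ge0 ?addr_ge0//.
  by rewrite lerXn2r ?nnegrE ?addr_ge0//; lra.
apply: (@le_trans _ _ (2 ^+ m * (N`!%:R / c ^+ N))); last by rewrite lerDr exprn_ge0.
apply: (@le_trans _ _ ((2 * t) ^+ m * expR (- (c * t `^ alpha)))).
  by rewrite ler_wpM2r ?expR_ge0// lerXn2r ?nnegrE ?addr_ge0 ?mulr_ge0//; lra.
rewrite exprMn -mulrA ler_wpM2l ?exprn_ge0//.
rewrite expRN ler_pdivrMr ?expR_gt0//.
have ct : 0 <= c * t `^ alpha by rewrite mulr_ge0 ?powR_ge0// ltW.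
have := expR_ge1Dxn (Num.truncn (m%:R / alpha)) ct; rewrite -/N => h.
apply: (@le_trans _ _ (N`!%:R / c ^+ N * ((c * t `^ alpha) ^+ N / N`!%:R))); last first.
  by rewrite ler_wpM2l// (le_trans _ h)// lerDr.
rewrite exprMn.
have -> : N`!%:R / c ^+ N * (c ^+ N * (t `^ alpha) ^+ N / N`!%:R) = (t `^ alpha) ^+ N.
  by field; rewrite expf_neq0 ?(gt_eqF c0)// pnatr_eq0 -lt0n fact_gt0.
rewrite -powR_mulrn ?powR_ge0// -powRrM -powR_mulrn//.
by apply: ler_powR => //; exact: ltW.
Qed.

End exponential_damping.

Section polynomial_growth.
Context {R : realType} {d : nat}.

Lemma polyb_exp_cdom (G E : 'rV[R]_d -> R) (alpha A c : R) :
  0 < alpha -> 0 < c -> 0 <= A -> polyb G -> measurable_fun setT E ->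
  (forall u, `|E u| <= A * expR (- (c * enorm u `^ alpha))) ->
  cdom (fun u => G u * E u).
Proof.
move=> alpha_gt0 c0 A0 [cG [C [k [C0 GC]]]] mE EA.
have [M hM] := powR_expR_bounded (k + 2 * d) c0 alpha_gt0.
split.
  by apply: measurable_funM => //; exact: continuous_measurable_rV.
exists (C * A * M) => u; rewrite normrM.
apply: (@le_trans _ _ (C * A * ((1 + enorm u) ^+ k * expR (- (c * enorm u `^ alpha))))).
  by rewrite mulrACA; apply: ler_pM.
rewrite -(mulrA (C * A) M) ler_wpM2l ?mulr_ge0//.
have p : 0 < 1 + enorm u by rewrite ltr_pwDl// enorm_ge0.
have w : (1 + enorm u) ^- (2 * d) <= cauchyw u.
  rewrite /cauchyw -[X in (2 * X)%N](card_ord d) exprM -exprVn -prodr_const.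
  apply: ler_prod => i _; rewrite invr_ge0 exprn_ge0 ?(ltW p)//=.
  rewrite lef_pV2 ?posrE ?exprn_gt0//; last by rewrite ltr_pwDl// sqr_ge0.
  have := coord_le_enorm u i; rewrite -(real_normK (num_real (u ord0 i))).
  by have := normr_ge0 (u ord0 i); have := enorm_ge0 u; nra.
apply: (@le_trans _ _ (M * (1 + enorm u) ^- (2 * d))); last first.
  by rewrite ler_wpM2l// (le_trans _ (hM 0 _))// mulr_ge0 ?exprn_ge0 ?expR_ge0.
rewrite ler_pdivlMr ?exprn_gt0// mulrAC -exprD.
by apply: hM; exact: enorm_ge0.
Qed.

End polynomial_growth.

Section small_jumps.
Context {R : realType} {d : nat}.
Variables (alpha : R) (mu : {finite_measure set 'rV[R]_d -> \bar R}).
Hypothesis alpha_bounds : 0 < alpha < 2.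
Notation nu := (levy_measure alpha mu).
Implicit Types (u v y : 'rV[R]_d) (k : 'rV[R]_d -> R).

Lemma near_derive (f f' : 'rV[R]_d -> 'rV[R]_d -> R) u v B :
  (forall w, measurable_fun setT (f w)) ->
  (forall w, exists C, forall y, near0 y -> `|f w y| <= C * enorm y ^+ 2) ->
  (forall w y, is_derive w v (f ^~ y) (f' w y)) ->
  (forall s y, `|s| < 1 -> near0 y -> `|f' (s *: v + u) y| <= B * enorm y ^+ 2) ->
  is_derive u v (fun w => \int[nu]_(y in near0) f w y) (\int[nu]_(y in near0) f' u y).
Proof.
move=> mf fC df f'B; apply/derive_along0.
have -> : \int[nu]_(y in near0) f' u y = \int[nu]_(y in near0) f' (0 *: v + u) y.
  by rewrite scale0r add0r.
apply: (@is_derive_Rintegral _ _ R nu near0 (fun s y => f (s *: v + u) y)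
  (fun s y => f' (s *: v + u) y) (fun y => B * enorm y ^+ 2) 1) => //.
- exact: measurable_near0.
- move=> s _; have [C hC] := fC (s *: v + u).
  exact: (integrable_near mu alpha_bounds (mf _) hC).
- by move=> s y _ _; apply/derive_along; exact: df.
- exact: (integrableZl (@measurable_near0 R d) B (integrable_enorm_sqr mu alpha_bounds)).
Qed.

Let K : R := \int[nu]_(y in near0) enorm y ^+ 2.

Let K0 : 0 <= K.
Proof. by apply: Rintegral_ge0 => y _; rewrite sqr_ge0. Qed.

Lemma near_integral_le k C : measurable_fun setT k ->
  (forall y, near0 y -> `|k y| <= C * enorm y ^+ 2) ->
  `|\int[nu]_(y in near0) k y| <= C * K.
Proof.
move=> mk kC; have ik := integrable_near mu alpha_bounds mk kC.
have iK := integrable_enorm_sqr mu alpha_bounds.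
rewrite (le_trans (le_normr_Rintegral (@measurable_near0 R d) ik))//.
rewrite /K -RintegralZl//; last exact: measurable_near0.
apply: le_Rintegral => //.
- exact: measurable_near0.
- exact: integrable_norm.
- exact: (integrableZl (@measurable_near0 R d) C iK).
Qed.

Lemma near_continuous (f : 'rV[R]_d -> 'rV[R]_d -> R) :
  (forall w, measurable_fun setT (f w)) ->
  (forall w, exists C, forall y, near0 y -> `|f w y| <= C * enorm y ^+ 2) ->
  (forall u, exists L, forall v y, enorm (v - u) <= 1 -> near0 y ->
     `|f v y - f u y| <= L * enorm (v - u) * enorm y ^+ 2) ->
  continuous (fun w => \int[nu]_(y in near0) f w y).
Proof.
move=> mf fC fL; apply: enorm_lipschitz_continuous => u.
have [L hL] := fL u; exists (L * K) => v v1.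
have [Cu hu] := fC u; have [Cv hv] := fC v.
rewrite -RintegralB; last 3 first.
- exact: measurable_near0.
- exact: (integrable_near mu alpha_bounds (mf _) hv).
- exact: (integrable_near mu alpha_bounds (mf _) hu).
rewrite mulrAC; apply: near_integral_le; first exact: measurable_funB.
by move=> y ny; exact: hL.
Qed.

(* The phase makes this family stable under differentiation in u. *)
Definition cint k (a : R) u : R :=
  \int[nu]_(y in near0) (k y * cos (dotp u y + a)).

Lemma symb_cint n k a C : measurable_fun setT k ->
  (forall y, near0 y -> `|k y| <= C * enorm y ^+ 2) -> symb n (cint k a).
Proof.
move=> mk kC.
have H k' a' C' : measurable_fun setT k' ->
    (forall y, near0 y -> `|k' y| <= C' * enorm y ^+ 2) -> polyb (cint k' a').
  move=> mk' kC'.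
  have mf w : measurable_fun setT (fun y : 'rV[R]_d => k' y * cos (dotp w y + a')).
    by apply: measurable_funM => //; exact: measurable_cos_dotpr.
  have fC w y : near0 y -> `|k' y * cos (dotp w y + a')| <= C' * enorm y ^+ 2.
    move=> ny; rewrite normrM (le_trans _ (kC' y ny))// ler_piMr//.
    exact: cos_max.
  split.
    apply: near_continuous => // [w|u]; first by exists C'; exact: fC.
    exists `|C'| => v y _ ny; rewrite -mulrBr normrM mulrAC.
    have y1 : enorm y <= 1 by apply: ltW.
    apply: ler_pM => //.
      rewrite (le_trans (kC' y ny))// ler_wpM2r ?sqr_ge0//.
      exact: ler_norm.
    rewrite (le_trans (cos_lipschitz _ _))//.
    rewrite (_ : dotp v y + a' - (dotp u y + a') = dotp (v - u) y); last first.
      by rewrite dotpBl; ring.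
    by rewrite (le_trans (cauchy_schwarz _ _))// ler_piMr// enorm_ge0.
  exists (`|C'| * K), 0%N; split; first exact: mulr_ge0.
  move=> u; rewrite expr0 mulr1; apply: near_integral_le => // y ny.
  by rewrite (le_trans (fC u y ny))// ler_wpM2r ?sqr_ge0// ler_norm.
elim: n k a C mk kC => [|n ih] k a C mk kC; first exact: H kC.
split; first exact: H kC.
move=> i; exists (cint (fun y => y ord0 i * k y) (a + pi / 2)).
have mi : measurable_fun setT (fun y : 'rV[R]_d => y ord0 i * k y).
  by apply: measurable_funM => //; exact: measurable_coord.
have iC y : near0 y -> `|y ord0 i * k y| <= C * enorm y ^+ 2.
  move=> ny; rewrite normrM (le_trans _ (kC y ny))// ler_piMl//.
  by rewrite (le_trans (coord_le_enorm y i))// ltW.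
split; last exact: ih iC.
move=> u; rewrite /cint.
have -> : \int[nu]_(y in near0) (y ord0 i * k y * cos (dotp u y + (a + pi / 2))) =
  \int[nu]_(y in near0) (k y * (y ord0 i * cos (dotp u y + (a + pi / 2)))).
  by apply: eq_Rintegral => y _; ring.
apply: (@near_derive (fun w y => k y * cos (dotp w y + a))
  (fun w y => k y * (y ord0 i * cos (dotp w y + (a + pi / 2)))) u _ C).
- by move=> w; apply: measurable_funM => //; exact: measurable_cos_dotpr.
- move=> w; exists C => y ny; rewrite normrM (le_trans _ (kC y ny))// ler_piMr//.
  exact: cos_max.
- move=> w y; have dk : is_derive w (unit_vec i) (fun=> k y) 0 by exact: is_derive_cst.
  have := is_derive_dir_mul dk (is_derive_cos_dotp w (unit_vec i) y a).
  by rewrite mul0r add0r (dotpC _ y) dotp_unit_vec.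
- move=> s y _ ny; rewrite mulrA (mulrC (k y)) normrM (le_trans _ (iC y ny))//.
  by rewrite ler_piMr// cos_max.
Qed.

Definition dPhi_near (i : 'I_d) u : R :=
  \int[nu]_(y in near0) (y ord0 i * sin (dotp u y)).

Let coord_sin_le i u y : `|y ord0 i * sin (dotp u y)| <= enorm u * enorm y ^+ 2.
Proof.
rewrite normrM expr2 mulrCA ler_pM ?coord_le_enorm//.
by rewrite (le_trans (abs_sin_le _))// cauchy_schwarz.
Qed.

Let measurable_coord_sin i u : measurable_fun setT (fun y : 'rV[R]_d => y ord0 i * sin (dotp u y)).
Proof.
apply: measurable_funM; first exact: measurable_coord.
apply: measurableT_comp; last exact: measurable_dotpr.
by apply: continuous_measurable_fun; exact: continuous_sin.
Qed.

Lemma is_derive_Phi_near i u :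
  is_derive u (unit_vec i) (Phi_near alpha mu) (dPhi_near i u).
Proof.
apply: (@near_derive (fun w y => 1 - cos (dotp w y))
  (fun w y => y ord0 i * sin (dotp w y)) u _ (enorm u + 1)).
- by move=> w; apply: measurable_funB => //; exact: measurable_cos_dotpr0.
- by move=> w; exists (enorm w ^+ 2) => y _; exact: onemcos_dotp_le.
- move=> w y; have d1 : is_derive w (unit_vec i) (fun=> 1 : R) 0 by exact: is_derive_cst.
  have := is_derive_dir_add d1 (is_derive_dir_opp (is_derive_cos_dotp w (unit_vec i) y 0)).
  rewrite !add0r cosDpihalf mulrN opprK (dotpC _ y) dotp_unit_vec.
  rewrite [X in is_derive _ _ X _ -> _](_ : _ = (fun w => 1 - cos (dotp w y)))//.
  by apply/funext => w'; rewrite addr0.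
- move=> s y s1 ny; rewrite (le_trans (coord_sin_le _ _ _))// ler_wpM2r ?sqr_ge0//.
  rewrite (le_trans (ler_enormD _ _))// addrC lerD2l enormZ.
  by rewrite enorm_unit_vec mulr1 ltW.
Qed.

Lemma symb_dPhi_near n i : symb n (dPhi_near i).
Proof.
have p : polyb (dPhi_near i).
  split.
    apply: near_continuous => // [w|u]; first by exists (enorm w) => y _; exact: coord_sin_le.
    exists 1 => v y _ ny; rewrite -mulrBr normrM mul1r expr2 mulrCA.
    rewrite ler_pM ?coord_le_enorm// (le_trans (sin_lipschitz _ _))//.
    by rewrite -dotpBl cauchy_schwarz.
  exists K, 1%N; split => // u; rewrite expr1.
  have h := @near_integral_le (fun y => y ord0 i * sin (dotp u y)) (enorm u)
    (measurable_coord_sin i u) (fun y _ => coord_sin_le i u y).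
  by rewrite (le_trans h)// mulrC ler_wpM2l// lerDr.
case: n => [//|n]; split => // j.
exists (cint (fun y => y ord0 j * y ord0 i) 0).
have mji : measurable_fun setT (fun y : 'rV[R]_d => y ord0 j * y ord0 i).
  by apply: measurable_funM; exact: measurable_coord.
have jiC y : near0 y -> `|y ord0 j * y ord0 i| <= 1 * enorm y ^+ 2.
  by move=> _; rewrite mul1r expr2 normrM ler_pM// coord_le_enorm.
split; last exact: symb_cint jiC.
move=> u; rewrite /dPhi_near /cint.
apply: (@near_derive (fun w y => y ord0 i * sin (dotp w y))
  (fun w y => y ord0 j * y ord0 i * cos (dotp w y + 0)) u _ 1) => //.
- by move=> w; exists (enorm w) => y _; exact: coord_sin_le.
- move=> w y; have dk : is_derive w (unit_vec j) (fun=> y ord0 i) 0 by exact: is_derive_cst.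
  have := is_derive_dir_mul dk (is_derive_cos_dotp w (unit_vec j) y (- (pi / 2))).
  rewrite addNr mul0r add0r (dotpC _ y) dotp_unit_vec mulrA (mulrC (y ord0 i)).
  rewrite [X in is_derive _ _ X _ -> _](_ : _ = (fun w => y ord0 i * sin (dotp w y)))//.
  by apply/funext => w'; rewrite cosBpihalf.
- move=> s y _ ny; rewrite normrM (le_trans _ (jiC y ny))// ler_piMr//.
  exact: cos_max.
Qed.

Lemma continuous_Phi_near : continuous (Phi_near alpha mu).
Proof.
apply: near_continuous.
- by move=> w; apply: measurable_funB => //; exact: measurable_cos_dotpr0.
- by move=> w; exists (enorm w ^+ 2) => y _; exact: onemcos_dotp_le.
move=> u; exists (2 * enorm u + 1) => v y v1 ny.
rewrite opprD addrACA subrr add0r opprK addrC (le_trans (cosB_le _ _))//.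
rewrite -dotpDl -dotpBl.
have h1 : `|dotp (u + v) y| <= (2 * enorm u + 1) * enorm y.
  rewrite (le_trans (cauchy_schwarz _ _))// ler_wpM2r ?enorm_ge0//.
  rewrite (_ : u + v = (v - u) + (u + u)); last by rewrite addrA subrK addrC.
  rewrite (le_trans (ler_enormD _ _))//.
  by have := ler_enormD u u; move: v1; lra.
have h2 : `|dotp (u - v) y| <= enorm (v - u) * enorm y.
  by rewrite (le_trans (cauchy_schwarz _ _))// enormB.
by rewrite (le_trans (ler_pM _ _ h1 h2))// expr2 mulrACA.
Qed.

Hypothesis mu_spectral : spectral_measure mu.
Hypothesis d_gt0 : (0 < d)%N.

Definition damp u : R := expR (- Phi_near alpha mu u).

Lemma cos_far_le u : `|cos_far alpha mu u| <= fine (nu far).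
Proof.
have ic : nu.-integrable far (EFin \o (fun y => cos (dotp u y))).
  apply: (@integrable_far _ _ _ _ alpha_bounds _ 1); first exact: measurable_cos_dotpr0.
  by move=> y; exact: cos_max.
have i1 : nu.-integrable far (EFin \o (fun=> 1)).
  by apply: (@integrable_far _ _ _ _ alpha_bounds _ 1) => // y; rewrite normr1.
rewrite (le_trans (le_normr_Rintegral (@measurable_far R d) ic))//.
rewrite -[leRHS]mul1r -Rintegral_cst; last exact: measurable_far.
apply: le_Rintegral => //; [exact: measurable_far|exact: integrable_norm|].
by move=> y _; exact: cos_max.
Qed.

Lemma exp_Phi_cdom (t : R) (G : 'rV[R]_d -> R) : 0 < t -> polyb G ->
  measurable_fun setT (Phi alpha mu) ->
  cdom (fun u => G u * expR (- (t * Phi alpha mu u))).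
Proof.
move=> t0 pG mPhi.
have [c c0 Phic] := Phi_lower alpha_bounds mu_spectral d_gt0.
apply: (@polyb_exp_cdom _ _ _ _ alpha 1 (t * c)) => //.
- by case/andP : alpha_bounds.
- exact: mulr_gt0.
- apply: measurableT_comp; first exact: measurable_expR.
  by apply: measurableT_comp => //; exact: measurable_funM.
move=> u; rewrite mul1r ger0_norm ?expR_ge0// ler_expR lerN2 -mulrA.
by rewrite ler_wpM2l// ltW.
Qed.

Lemma polyb_damp_cdom G : polyb G -> cdom (fun u => G u * damp u).
Proof.
move=> pG; pose L := fine (nu far).
have [c c0 Phic] := Phi_lower alpha_bounds mu_spectral d_gt0.
apply: (@polyb_exp_cdom _ _ _ _ alpha (expR (2 * L)) c) => //.
- by case/andP : alpha_bounds.
- apply: measurableT_comp; first exact: measurable_expR.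
  apply: measurableT_comp => //.
  by apply: continuous_measurable_rV; exact: continuous_Phi_near.
move=> u; rewrite ger0_norm ?expR_ge0// -expRD ler_expR.
have := Phic u; have := cos_far_le u.
by rewrite (PhiE mu alpha_bounds) -/L ler_norml => /andP[]; lra.
Qed.

Lemma symb_damp_sch n G : symb n G -> sch n (fun u => G u * damp u).
Proof.
elim: n G => [|n ih] G; first exact: polyb_damp_cdom.
move=> sG; have [pG dG] := sG; split; first exact: polyb_damp_cdom.
move=> i; have [G' [dG' sG']] := dG i.
exists (fun u => (G' u + - G u * dPhi_near i u) * damp u); split.
  move=> u; have dD := is_derive_dir_expR (is_derive_dir_opp (is_derive_Phi_near i u)).
  have := is_derive_dir_mul (dG' u) dD.
  by rewrite /damp (_ : _ + _ = (G' u + - G u * dPhi_near i u) * expR (- Phi_near alpha mu u))//; ring.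
apply: ih; apply: symb_add => //; apply: symb_mul; last exact: symb_dPhi_near.
have -> : (fun u => - G u) = (fun u => -1 * G u) by apply/funext => u; rewrite mulN1r.
by apply: symb_mul; [exact: symb_cst|exact: symbW].
Qed.

Lemma damp_decay n b : exists2 C, 0 <= C & forall a (x : 'rV[R]_d),
  `|FT a (fun u => monom b u * damp u) x| <= C * (1 + enorm x) ^- n.
Proof.
by apply: sch_decay => // m; apply: symb_damp_sch; exact: symb_monom.
Qed.

End small_jumps.

(** * Large jumps *)

Lemma integrable_finite_bounded d (T : measurableType d) (R : realType)
    (m : {finite_measure set T -> \bar R}) (f : T -> R) M :
  measurable_fun setT f -> (forall y, `|f y| <= M) ->
  m.-integrable setT (EFin \o f).
Proof.
move=> mf fM.
have h : m.-integrable setT (EFin \o (fun=> M)).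
  apply/integrableP; split; first exact/measurable_EFinP.
  by rewrite /= integral_cst// lte_mul_pinfty// -ge0_fin_numE// fin_num_measure.
apply: (le_integrable measurableT _ _ h); first exact/measurable_EFinP.
by move=> y _; rewrite /= lee_fin (le_trans (fM y))// ler_norm.
Qed.

Lemma powR_exprAC (R : realType) (x a : R) k : 0 <= x ->
  (x `^ a) ^+ k = (x ^+ k) `^ a.
Proof.
by move=> x0; rewrite -[LHS]powR_mulrn ?powR_ge0// -powRrM mulrC powRrM powR_mulrn.
Qed.

Section large_jumps.
Context {R : realType} {d : nat}.
Implicit Types (u v x y : 'rV[R]_d) (G : 'rV[R]_d -> R).

Definition decayh (s : R) x : R := (1 + enorm x) `^ (- s).

Let p x : 0 < 1 + enorm x. Proof. by rewrite ltr_pwDl// enorm_ge0. Qed.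

Lemma decayh_gt0 s x : 0 < decayh s x. Proof. exact: powR_gt0. Qed.

Lemma decayh_le1 s x : 0 <= s -> decayh s x <= 1.
Proof.
move=> s0; rewrite /decayh powRN invf_le1 ?powR_gt0//.
have := @ler_powR R (1 + enorm x) _ 0 s s0; rewrite powRr0; apply.
by rewrite lerDl enorm_ge0.
Qed.

Lemma decayh_anti s c x y : 0 <= s -> 0 < c -> c * (1 + enorm x) <= 1 + enorm y ->
  decayh s y <= c `^ (- s) * decayh s x.
Proof.
move=> s0 c0 xy; rewrite /decayh -powRM ?(ltW c0) ?(ltW (p x))//.
rewrite !powRN lef_pV2 ?posrE ?powR_gt0 ?mulr_gt0//.
by rewrite ge0_ler_powR ?nnegrE ?mulr_ge0 ?(ltW c0) ?(ltW (p _)).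
Qed.

Lemma measurable_decayh s x : measurable_fun setT (fun y => decayh s (y - x)).
Proof.
apply: (@measurableT_comp _ _ _ _ _ _ (fun t : R => (1 + t) `^ (- s))).
  apply: (@measurableT_comp _ _ _ _ _ _ (fun t : R => t `^ (- s))).
    exact: measurable_powR.
  exact: measurable_funD.
apply: measurableT_comp; first exact: measurable_enorm.
apply: measurable_fun_rV => i; under eq_fun do rewrite !mxE.
by apply: measurable_funB => //; exact: measurable_coord.
Qed.

Variables (m : {finite_measure set 'rV[R]_d -> \bar R}) (alpha gamma c : R).
Hypothesis alpha_gt0 : 0 < alpha.
Hypothesis s_gt0 : 0 < alpha + gamma.
Hypothesis c_ge0 : 0 <= c.
Hypothesis m_ball : forall x r, 0 < r -> r < enorm x / 2 ->
  (m (eball x r) <= (c * r `^ gamma * enorm x `^ (- (alpha + gamma)))%:E)%E.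
Local Notation s := (alpha + gamma).

Lemma pow2_below (t : R) : 0 < t -> exists K : nat,
  t <= 2 ^+ K /\ forall k, (k < K)%N -> 2 ^+ k < t.
Proof.
move=> t0; have ex : exists K : nat, t <= 2 ^+ K.
  exists (Num.truncn t).+1; rewrite (le_trans (ltW (truncnS_gt t)))//.
  by rewrite -natrX ler_nat ltnW// ltn_expl.
exists (ex_minn ex); case: ex_minnP => K tK Kmin; split => // k kK.
by rewrite ltNge; apply/negP => /Kmin; rewrite leqNgt kK.
Qed.

(* The left-hand side has the size of the first term of the bound unless y is
   much closer to x than the origin is; then the smallest dyadic ball around x
   containing y has a radius below |x| / 2, as the ball estimate m_ball requires. *)
Lemma decayh_dyadic x y K : 8 < enorm x -> enorm x / 2 <= 2 ^+ K ->
  decayh s (y - x) <= 16 `^ s * decayh s x +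
   2 `^ s * \sum_(k < K) (2 ^+ k) `^ (- s) * \1_(eball x (2 ^+ k)) y.
Proof.
move=> x2 xK.
have S0 : 0 <= \sum_(k < K) (2 ^+ k) `^ (- s) * \1_(eball x (2 ^+ k)) y :> R.
  by rewrite sumr_ge0// => k _; rewrite mulr_ge0 ?powR_ge0.
have [xy|xy] := leP (enorm x / 8) (enorm (y - x)).
  rewrite (@le_trans _ _ (16 `^ s * decayh s x))//; last first.
    by rewrite lerDl mulr_ge0// powR_ge0.
  have := @decayh_anti s 16^-1 x (y - x) (ltW s_gt0).
  rewrite -[16^-1](@powR_inv1 R 16)// -powRrM mulrN mulN1r opprK; apply.
    by rewrite powR_gt0.
  rewrite powR_inv1//; have := enorm_ge0 x; lra.
have [K' [yK' K'min]] := pow2_below (p (y - x)).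
have K'K : (K' <= K)%N.
  rewrite leqNgt; apply/negP => /K'min; apply/negP; rewrite -leNgt.
  apply: le_trans xK; move: xy x2; lra.
have := K'K; rewrite leq_eqVlt => /predU1P[EK|ltK].
  have := xK; rewrite -EK.
  case: K' {K'K EK} yK' K'min => [|k] yK' K'min.
    by rewrite expr0 => ?; exfalso; move: x2; lra.
  have := K'min k (ltnSn k); rewrite exprS; move: xy x2; lra.
rewrite (@le_trans _ _ (2 `^ s * \sum_(k < K) (2 ^+ k) `^ (- s) * \1_(eball x (2 ^+ k)) y))//; last first.
  by rewrite lerDr mulr_ge0// powR_ge0.
rewrite (bigD1 (Ordinal ltK))//= indicE mem_set; last first.
  rewrite /eball/=; apply: lt_le_trans yK'; rewrite ltrDr//.
rewrite mulr1 mulrDr (@le_trans _ _ (2 `^ s * (2 ^+ K') `^ (- s)))//; last first.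
  by rewrite lerDl mulr_ge0 ?powR_ge0// sumr_ge0// => k _; rewrite mulr_ge0 ?powR_ge0.
have E : 2 `^ s = (2^-1) `^ (- s) :> R.
  by rewrite -[2^-1](@powR_inv1 R 2)// -powRrM mulrNN mul1r.
rewrite E -powRM ?exprn_ge0// /decayh !powRN.
rewrite lef_pV2 ?posrE ?powR_gt0 ?mulr_gt0 ?exprn_gt0//.
rewrite ge0_ler_powR ?nnegrE ?mulr_ge0 ?exprn_ge0 ?(ltW (p _)) ?(ltW s_gt0)//.
case: K' {K'K ltK} yK' K'min => [|k] yK' K'min.
  by rewrite expr0 mulr1; have := enorm_ge0 (y - x); lra.
by have := K'min k (ltnSn k); rewrite exprS; lra.
Qed.

Lemma integral_decayh_le : exists2 C, 0 <= C & forall x,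
  \int[m]_y decayh s (y - x) <= C * decayh s x.
Proof.
pose lam := fine (m setT).
have lam0 : 0 <= lam by rewrite fine_ge0.
have q1 : 0 < (2 : R) `^ (- alpha) < 1.
  rewrite powR_gt0//= powRN invf_lt1 ?powR_gt0//.
  have := @gt0_ltr_powR R _ alpha_gt0 1 2; rewrite powR1 !nnegrE; apply => //.
  by rewrite ltr1n.
pose q : R := 2 `^ (- alpha).
have /andP[q0 qlt1] := q1; rewrite -/q in q0 qlt1.
pose B := 2 `^ s * (c * (1 - q)^-1) * 2 `^ s.
have B0 : 0 <= B.
  by rewrite !mulr_ge0 ?powR_ge0// invr_ge0 subr_ge0 ltW.
exists (16 `^ s * lam + B).
  by rewrite addr_ge0// mulr_ge0 ?powR_ge0.
move=> x; have hx := decayh_gt0 s x.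
have ih : m.-integrable setT (EFin \o (fun y => decayh s (y - x))).
  apply: (@integrable_finite_bounded _ _ _ _ _ 1); first exact: measurable_decayh.
  by move=> y; rewrite ger0_norm ?(ltW (decayh_gt0 _ _))// decayh_le1// ltW.
have icst (M : R) : m.-integrable setT (EFin \o (fun=> M)).
  by apply: (@integrable_finite_bounded _ _ _ _ _ `|M|).
have [x2|x2] := leP (enorm x) 8.
  apply: (@le_trans _ _ (\int[m]_y (16 `^ s * decayh s x))).
    apply: le_Rintegral => // y _.
    apply: (@le_trans _ _ 1); first by rewrite decayh_le1// ltW.
    rewrite /decayh -ler_pdivrMr ?powR_gt0// div1r -powRN opprK.
    rewrite ge0_ler_powR ?nnegrE ?(ltW (p _)) ?(ltW s_gt0)//; lra.
  rewrite Rintegral_cst// -/lam mulrAC ler_wpM2r ?(ltW hx)// lerDl//.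
have x0 : 0 < enorm x by apply: lt_trans x2.
have [K [xK Kmin]] := pow2_below (divr_gt0 x0 (ltr0n R 2)).
pose f (k : 'I_K) y : R := (2 ^+ k) `^ (- s) * \1_(eball x (2 ^+ k)) y.
have fi k : m.-integrable setT (EFin \o f k).
  apply: (@integrable_finite_bounded _ _ _ _ _ ((2 ^+ k) `^ (- s))).
    by apply: measurable_funM => //; apply: measurable_indic; exact: measurable_eball.
  by move=> y; rewrite ger0_norm ?mulr_ge0 ?powR_ge0// ler_piMr ?powR_ge0.
have fsum (r : seq 'I_K) : m.-integrable setT (EFin \o (fun y => \sum_(k <- r) f k y)) /\
    \int[m]_y (\sum_(k <- r) f k y) = \sum_(k <- r) \int[m]_y f k y.
  elim: r => [|k r [ihi ihe]].
    have E : (fun y => \sum_(k <- [::]) f k y) = fun=> 0 by apply/funext => y; rewrite big_nil.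
    by rewrite E big_nil; split => //; rewrite Rintegral_cst// mul0r.
  have E : (fun y => \sum_(k <- k :: r) f k y) = fun y => f k y + \sum_(k <- r) f k y.
    by apply/funext => y; rewrite big_cons.
  rewrite E big_cons -ihe; split; last by rewrite RintegralD.
  exact: (integrableD measurableT (fi k) ihi).
have [isum esum] := fsum (index_enum 'I_K).
have isum2 : m.-integrable setT (EFin \o (fun y => 2 `^ s * \sum_k f k y)).
  exact: (integrableZl measurableT _ isum).
have fk k : \int[m]_y f k y <= c * q ^+ k * enorm x `^ (- s).
  rewrite RintegralZl//; last first.
    apply: (@integrable_finite_bounded _ _ _ _ _ 1).
      by apply: measurable_indic; exact: measurable_eball.
    by move=> y; rewrite ger0_norm// indicE; case: (_ \in _).
  have -> : \int[m]_y \1_(eball x (2 ^+ k)) y = fine (m (eball x (2 ^+ k))).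
    by rewrite /Rintegral integral_indic ?setIT//; exact: measurable_eball.
  have h := m_ball (exprn_gt0 k (ltr0n R 2)) (Kmin k (ltn_ord k)).
  have h' : fine (m (eball x (2 ^+ k))) <= c * (2 ^+ k) `^ gamma * enorm x `^ (- s).
    rewrite -lee_fin fineK ?fin_num_measure//; exact: measurable_eball.
  apply: (le_trans (ler_wpM2l (powR_ge0 _ _) h')).
  have -> : q ^+ k = (2 ^+ k) `^ (- s) * (2 ^+ k) `^ gamma.
    rewrite -powRD; last by rewrite expf_neq0 ?implybT.
    have -> : - s + gamma = - alpha by ring.
    exact: powR_exprAC.
  by rewrite le_eqVlt; apply/orP; left; apply/eqP; ring.
apply: (@le_trans _ _ (\int[m]_y (16 `^ s * decayh s x + 2 `^ s * \sum_k f k y))).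
  apply: le_Rintegral => //.
    exact: (integrableD measurableT (icst _) isum2).
  by move=> y _; exact: decayh_dyadic.
rewrite RintegralD// Rintegral_cst// -/lam RintegralZl// esum mulrDl.
rewrite mulrAC lerD2l.
have xh : enorm x `^ (- s) <= 2 `^ s * decayh s x.
  have E : 2 `^ s = (2^-1) `^ (- s) :> R.
    by rewrite -[2^-1](@powR_inv1 R 2)// -powRrM mulrNN mul1r.
  rewrite E /decayh -powRM ?(ltW (p _))// !powRN.
  rewrite lef_pV2 ?posrE ?powR_gt0 ?mulr_gt0//.
  rewrite ge0_ler_powR ?nnegrE ?mulr_ge0 ?(ltW (p _)) ?(ltW x0) ?(ltW s_gt0)//; lra.
rewrite /B -!mulrA ler_wpM2l ?powR_ge0//.
apply: (@le_trans _ _ (\sum_(k < K) c * q ^+ k * enorm x `^ (- s))).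
  by apply: ler_sum => k _; exact: fk.
rewrite -mulr_suml -mulr_sumr -mulrA ler_wpM2l//.
rewrite ler_pM ?powR_ge0 ?sumr_ge0//; first by move=> k _; rewrite exprn_ge0// ltW.
have q1' : 0 < 1 - q by rewrite subr_gt0.
rewrite -[(1 - q)^-1]mul1r ler_pdivlMr//.
have := subrX1 q K; rewrite -[X in _ = _ * X](big_mkord xpredT (fun k => q ^+ k)) big_mkord.
have := exprn_ge0 K (ltW q0); set S := \sum_(k < K) q ^+ k; nra.
Qed.

End large_jumps.

Section far_convolution.
Context {R : realType} {d : nat}.
Variable m : {finite_measure set 'rV[R]_d -> \bar R}.
Implicit Types (G : 'rV[R]_d -> R) (x y u : 'rV[R]_d).

Definition charf u : R := \int[m]_y cos (dotp u y).

Lemma charf_le u : `|charf u| <= fine (m setT).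
Proof.
have ic : m.-integrable setT (EFin \o (fun y => cos (dotp u y))).
  apply: (@integrable_finite_bounded _ _ _ _ _ 1); last by move=> y; exact: cos_max.
  exact: measurable_cos_dotpr0.
rewrite (le_trans (le_normr_Rintegral measurableT ic))//.
rewrite -[leRHS]mul1r -Rintegral_cst//; apply: le_Rintegral => //.
- exact: integrable_norm.
- by apply: (@integrable_finite_bounded _ _ _ _ _ 1) => // y; rewrite normr1.
- by move=> y _; exact: cos_max.
Qed.

Variables (G : 'rV[R]_d -> R) (a : R) (x : 'rV[R]_d).
Hypothesis cG : cdom G.

Let f u y : R := cos (dotp u x + a) * cos (dotp u y) * G u.

Let mf : measurable_fun setT (fun z : 'rV[R]_d * 'rV[R]_d => f z.1 z.2).
Proof.
apply: measurable_funM; last first.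
  by apply: measurableT_comp; [case: cG|exact: measurable_fst].
apply: measurable_funM.
  apply: (@measurableT_comp _ _ _ _ _ _ (fun u : 'rV[R]_d => cos (dotp u x + a))).
    exact: measurable_cos_dotp.
  exact: measurable_fst.
apply: measurableT_comp; last exact: measurable_dotp2.
by apply: continuous_measurable_fun; exact: continuous_cos.
Qed.

Let iG : (lebesgue_rV d).-integrable setT (EFin \o (fun u => `|G u|)).
Proof. exact/integrable_norm/cdom_integrable. Qed.

Let i1 : m.-integrable setT (EFin \o (fun=> 1)).
Proof. by apply: (@integrable_finite_bounded _ _ _ _ _ 1) => // y; rewrite normr1. Qed.

Let fle u y : `|f u y| <= `|G u| * 1.
Proof.
rewrite !normrM mulr1 ler_piMl// -[leRHS]mulr1.
by apply: ler_pM; rewrite ?cos_max.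
Qed.

Let inner y : \int[lebesgue_rV d]_u f u y = (FT a G (x - y) + FT a G (x + y)) / 2.
Proof.
have c z := cdom_integrable (cdom_cos a z cG).
rewrite -RintegralD//.
rewrite mulrC -RintegralZl//; last exact: (integrableD measurableT (c (x - y)) (c (x + y))).
apply: eq_Rintegral => u _; rewrite /f dotpBr dotpDr.
have -> : dotp u x - dotp u y + a = (dotp u x + a) - dotp u y by ring.
have -> : dotp u x + dotp u y + a = (dotp u x + a) + dotp u y by ring.
by set w := dotp u x + a; set v := dotp u y; rewrite cosB cosD; field.
Qed.

Lemma FT_charf_mul : FT a (fun u => charf u * G u) x =
  \int[m]_y ((FT a G (x - y) + FT a G (x + y)) / 2).
Proof.
transitivity (\int[lebesgue_rV d]_u \int[m]_y f u y).
  apply: eq_Rintegral => u _; rewrite mulrCA /charf -RintegralZr//.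
    by apply: eq_Rintegral => y _; rewrite /f; ring.
  apply: (@integrable_finite_bounded _ _ _ _ _ 1); last by move=> y; exact: cos_max.
  exact: measurable_cos_dotpr0.
rewrite (Rfubini mf iG i1 fle).
by apply: eq_Rintegral => y _; rewrite inner.
Qed.

Let measurable_average : measurable_fun setT
  (fun y => (FT a G (x - y) + FT a G (x + y)) / 2).
Proof.
have := measurable_Rintegral2 mf iG i1 fle.
by under eq_fun do rewrite inner.
Qed.

Lemma FT_charf_mul_le (h : 'rV[R]_d -> R) (A C M : R) : 0 <= A ->
  measurable_fun setT (fun y : 'rV[R]_d => h (y - x)) ->
  measurable_fun setT (fun y : 'rV[R]_d => h (y + x)) ->
  (forall y, 0 <= h y <= M) -> (forall y, h (- y) = h y) ->
  (forall z, \int[m]_y h (y - z) <= C * h z) ->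
  (forall z, `|FT a G z| <= A * h z) ->
  `|FT a (fun u => charf u * G u) x| <= A * C * h x.
Proof.
move=> A0 mh1 mh2 hM hN hC GA; rewrite FT_charf_mul.
have ih1 : m.-integrable setT (EFin \o (fun y => h (y - x))).
  apply: (@integrable_finite_bounded _ _ _ _ _ M) => // y.
  by have /andP[h0 h1] := hM (y - x); rewrite ger0_norm.
have ih2 : m.-integrable setT (EFin \o (fun y => h (y + x))).
  apply: (@integrable_finite_bounded _ _ _ _ _ M) => // y.
  by have /andP[h0 h1] := hM (y + x); rewrite ger0_norm.
have GM z : `|FT a G z| <= A * M.
  by have /andP[_ h1] := hM z; rewrite (le_trans (GA z))// ler_wpM2l.
have iF : m.-integrable setT (EFin \o (fun y => (FT a G (x - y) + FT a G (x + y)) / 2)).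
  apply: (@integrable_finite_bounded _ _ _ _ _ (A * M)) => // y.
  rewrite normrM [`|2^-1|]ger0_norm// ler_pdivrMr// (le_trans (ler_normD _ _))//.
  by have := GM (x - y); have := GM (x + y); lra.
have ihA : m.-integrable setT (EFin \o (fun y => A / 2 * (h (y - x) + h (y + x)))).
  exact: (integrableZl measurableT _ (integrableD measurableT ih1 ih2)).
rewrite (le_trans (le_normr_Rintegral measurableT iF))//.
apply: (@le_trans _ _ (\int[m]_y (A / 2 * (h (y - x) + h (y + x))))).
  apply: le_Rintegral => //; first exact: integrable_norm.
  move=> y _; rewrite normrM [`|2^-1|]ger0_norm//.
  rewrite mulrAC ler_wpM2r// (le_trans (ler_normD _ _))// mulrDr lerD//.
    by rewrite -[in leRHS]hN opprB.
  by rewrite [y + x]addrC.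
rewrite RintegralZl//; last exact: (integrableD measurableT ih1 ih2).
rewrite RintegralD//.
have c1 := hC x; have := hC (- x); rewrite hN opprK => c2.
rewrite -!mulrA ler_wpM2l//.
by move: c1 c2; set p := \int[m]_y _; set q := \int[m]_y _; set r := C * h x; lra.
Qed.

End far_convolution.

Section exponential_series.
Context {R : realType} {d : nat}.
Variable m : {finite_measure set 'rV[R]_d -> \bar R}.
Implicit Types (G : 'rV[R]_d -> R).

Lemma exp_partial_le (t : R) N : 0 <= t -> \sum_(k < N) (k`!%:R)^-1 * t ^+ k <= expR t.
Proof.
move=> t0; have nd : nondecreasing_seq (series (exp_coeff t)).
  apply/nondecreasing_seqP => k; rewrite /series/= big_nat_recr//= lerDl.
  by rewrite divr_ge0// exprn_ge0.
have := nondecreasing_cvgn_le nd (@is_cvg_series_exp_coeff R t) N.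
rewrite /series/= big_mkord; apply: le_trans.
by rewrite le_eqVlt; apply/orP; left; apply/eqP; apply: eq_bigr => k _; rewrite mulrC.
Qed.

(* Multiplication by charf m averages FT over translates, so the k-th term of the
   exponential series costs C ^ k / k!. *)
Lemma FT_exp_charf_le G (h : 'rV[R]_d -> R) (A C M : R) : cdom G ->
  measurable_fun setT (charf m) -> 0 <= A -> 0 <= C ->
  (forall x, measurable_fun setT (fun y : 'rV[R]_d => h (y - x))) ->
  (forall y, 0 <= h y <= M) -> (forall y, h (- y) = h y) ->
  (forall z, \int[m]_y h (y - z) <= C * h z) ->
  (forall a z, `|FT a G z| <= A * h z) ->
  forall a x, `|FT a (fun u => expR (charf m u) * G u) x| <= A * expR C * h x.
Proof.
move=> cG mc A0 C0 mh hM hN hC GA a x.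
pose L := fine (m setT).
have cL u : `|charf m u| <= L by exact: charf_le.
have L0 : 0 <= L by rewrite (le_trans _ (cL 0)).
have ck k : cdom (fun u => charf m u ^+ k * G u).
  apply: (@cdom_mul_bounded _ _ _ _ (L ^+ k)) => //; first exact: measurable_funX.
  by move=> u; rewrite normrX lerXn2r// nnegrE.
have it k b z : `|FT b (fun u => charf m u ^+ k * G u) z| <= A * C ^+ k * h z.
  elim: k b z => [|k ih] b z.
    rewrite expr0 mulr1 (_ : (fun u => charf m u ^+ 0 * G u) = G)//.
    by apply/funext => u; rewrite expr0 mul1r.
  rewrite (_ : (fun u => _) = (fun u => charf m u * (charf m u ^+ k * G u))); last first.
    by apply/funext => u; rewrite exprS mulrA.
  rewrite exprSr mulrA; apply: (@FT_charf_mul_le _ _ m _ b z (ck k) h _ C M) => //.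
  - by rewrite mulr_ge0// exprn_ge0.
  - by have := mh (- z); under eq_fun do rewrite opprK.
pose S N u : R := \sum_(k < N) (k`!%:R)^-1 * charf m u ^+ k.
have SL N u : `|S N u| <= expR L.
  rewrite (le_trans _ (exp_partial_le N L0))// (le_trans (ler_norm_sum _ _ _))//.
  apply: ler_sum => k _; rewrite normrM normrX ger0_norm ?invr_ge0//.
  by rewrite ler_wpM2l ?invr_ge0// lerXn2r// nnegrE.
have mS N : measurable_fun setT (S N).
  by apply: measurable_sum => k; apply: measurable_funM => //; exact: measurable_funX.
have FS N : `|FT a (fun u => S N u * G u) x| <= A * expR C * h x.
  rewrite (_ : (fun u => _) = (fun u => \sum_(k < N) (k`!%:R)^-1 * (charf m u ^+ k * G u))); last first.
    by apply/funext => u; rewrite /S mulr_suml; apply: eq_bigr => k _; rewrite mulrA.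
  rewrite (FT_sum (index_enum 'I_N) (fun k : 'I_N => (k`!%:R)^-1) a x (fun k : 'I_N => ck k)).
  have /andP[h0 _] := hM x.
  apply: (@le_trans _ _ (A * h x * \sum_(k < N) (k`!%:R)^-1 * C ^+ k)); last first.
    by rewrite -[leRHS]mulrA (mulrC (expR C)) mulrA ler_wpM2l ?mulr_ge0// exp_partial_le.
  rewrite (le_trans (ler_norm_sum _ _ _))// mulr_sumr; apply: ler_sum => k _.
  rewrite normrM ger0_norm ?invr_ge0// mulrCA ler_wpM2l ?invr_ge0//.
  by rewrite mulrAC.
have lim : FT a (fun u => S N u * G u) x @[N --> \oo] -->
    FT a (fun u => expR (charf m u) * G u) x.
  apply: (@Rdominated_cvg _ _ R (lebesgue_rV d) setT
    (fun N u => cos (dotp u x + a) * (S N u * G u))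
    (fun u => cos (dotp u x + a) * (expR (charf m u) * G u))
    (fun u => expR L * `|G u|)) => //.
  - move=> N; apply: measurable_funM; first exact: measurable_cos_dotp.
    by apply: measurable_funM => //; case: cG.
  - move=> u _; apply: cvgMr; apply: cvgMl.
    have := @is_cvg_series_exp_coeff R (charf m u).
    rewrite -[X in _ -> _ --> X]/(limn (series (exp_coeff (charf m u)))) => /cvgP.
    rewrite (_ : (fun N => S N u) = series (exp_coeff (charf m u))) //.
    apply/funext => N; rewrite /series/= big_mkord /S.
    by apply: eq_bigr => k _; rewrite mulrC.
  - exact: (integrableZl measurableT _ (integrable_norm (cdom_integrable cG))).
  - move=> N u _; rewrite normrM (le_trans (ler_piMl _ (cos_max _)))//.
    by rewrite normrM ler_wpM2r.
rewrite -(cvg_lim (@norm_hausdorff _ _) (cvg_norm lim)).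
by apply: limr_le; [exact: cvgP (cvg_norm lim)|exact: nearW].
Qed.

End exponential_series.

(** * Stable densities *)

Lemma integral_concentrated d (T : measurableType d) (R : realType)
    (m nu : {measure set T -> \bar R}) (F : set T) (f : T -> \bar R) :
  measurable F -> (forall A, measurable A -> m A = nu (A `&` F)) ->
  m.-integrable setT f -> (\int[m]_y f y = \int[nu]_(y in F) f y)%E.
Proof.
move=> mF mE mf; rewrite (negligible_integral (measurableC mF))//; last first.
  by rewrite mE ?setICl ?measure0//; exact: measurableC.
rewrite setTD setCK; apply: eq_measure_integral => A mA AF.
by rewrite mE// setIidl.
Qed.

Section probability_density.
Context {R : realType} {d : nat}.
Variables (Q : {measure set 'rV[R]_d -> \bar R}) (q : 'rV[R]_d -> R).
Hypothesis mq : measurable_fun setT q.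
Hypothesis q0 : forall y, 0 <= q y.
Hypothesis QE : forall A, measurable A ->
  Q A = (\int[lebesgue_rV d]_(y in A) (q y)%:E)%E.
Hypothesis Q1 : Q setT = 1%E.

Lemma ge0_integral_density (f : 'rV[R]_d -> \bar R) : measurable_fun setT f ->
  (forall y, 0 <= f y)%E ->
  (\int[Q]_y f y = \int[lebesgue_rV d]_y (f y * (q y)%:E))%E.
Proof.
apply: (@ge0_integral_image_density _ _ _ _ R Q (lebesgue_rV d) idfun q) => //.
  exact: measurable_id.
move=> A mA.
rewrite QE// [LHS]integral_mkcond; apply: eq_integral => y _.
by rewrite patchE indicE; case: ifP => _; rewrite ?mul1e ?mul0e.
Qed.

Lemma integrable_density : (lebesgue_rV d).-integrable setT (EFin \o q).
Proof.
apply/integrableP; split; first exact/measurable_EFinP.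
under eq_integral do rewrite /= ger0_norm//.
by rewrite -QE// Q1 ltry.
Qed.

Lemma Rintegral_density (g : 'rV[R]_d -> R) : measurable_fun setT g ->
  (forall y, `|g y| <= 1) ->
  \int[Q]_y g y = \int[lebesgue_rV d]_y (g y * q y).
Proof.
move=> mg g1.
have i1Q : Q.-integrable setT (EFin \o (fun=> 1)).
  apply/integrableP; split; first exact/measurable_EFinP.
  by rewrite /= integral_cst// [X in (_ * X)%E]Q1 mule1 ltry.
have igQ : Q.-integrable setT (EFin \o g).
  apply: (le_integrable measurableT _ _ i1Q); first exact/measurable_EFinP.
  by move=> y _; rewrite /= lee_fin normr1.
have igq : (lebesgue_rV d).-integrable setT (EFin \o (fun y => g y * q y)).
  apply: (le_integrable measurableT _ _ integrable_density).
    by apply/measurable_EFinP; exact: measurable_funM.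
  by move=> y _; rewrite /= lee_fin normrM ler_piMl.
have h0 y : 0 <= 1 + g y by have := g1 y; rewrite ler_norml => /andP[]; lra.
have := @ge0_integral_density (fun y => (1 + g y)%:E) _ _.
have -> : (\int[Q]_y (1 + g y)%:E = (1 + \int[Q]_y g y)%:E)%E.
  rewrite -[LHS](fineK (integrable_fin_num measurableT (integrableD measurableT i1Q igQ))).
  congr EFin; rewrite -[LHS]/(\int[Q]_y (1 + g y)) RintegralD//.
  by rewrite Rintegral_cst// Q1 mulr1.
have -> : (\int[lebesgue_rV d]_y ((1 + g y)%:E * (q y)%:E) =
   (1 + \int[lebesgue_rV d]_y (g y * q y))%:E)%E.
  under eq_integral do rewrite -EFinM mulrDl mul1r.
  rewrite -[LHS](fineK (integrable_fin_num measurableT (integrableD measurableT integrable_density igq))).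
  congr EFin; rewrite -[LHS]/(\int[lebesgue_rV d]_y (q y + g y * q y)) RintegralD//; last exact: integrable_density.
  by congr (_ + _); rewrite /Rintegral -QE// Q1.
move=> h; have : (1 + \int[Q]_y g y)%:E = (1 + \int[lebesgue_rV d]_y (g y * q y))%:E.
  by apply: h; [apply/measurable_EFinP; exact: measurable_funD|move=> y; rewrite lee_fin].
by case => /addrI.
Qed.

End probability_density.

Section stable_densities.
Context {R : realType} {d : nat}.
Variables (alpha gamma : R) (mu : {finite_measure set 'rV[R]_d -> \bar R}).
Variables (P : R -> probability 'rV[R]_d R) (p : R -> 'rV[R]_d -> R).
Hypothesis alpha_bounds : 0 < alpha < 2.
Hypothesis d_gt0 : (0 < d)%N.
Hypothesis s_gt0 : 0 < alpha + gamma.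
Hypothesis mu_spectral : spectral_measure mu.
Hypothesis nu_gamma : gamma_measure_on_sphere (levy_measure alpha mu) gamma.
Hypothesis P_stable : stable_semigroup alpha mu P.
Hypothesis p_density : forall t : R, 0 < t -> smooth_bounded_density (P t) (p t).
Notation nu := (levy_measure alpha mu).
Local Notation s := (alpha + gamma).
Implicit Types (x y z u : 'rV[R]_d) (b : {ffun 'I_d -> nat}).

Let alpha_gt0 : 0 < alpha. Proof. by case/andP: alpha_bounds. Qed.

Let m : {finite_measure set 'rV[R]_d -> \bar R} :=
  mfrestr (@measurable_far R d) (levy_far_lty mu alpha_bounds).

Let mE A : m A = nu (A `&` far). Proof. by []. Qed.

Lemma cos_far_charf u : cos_far alpha mu u = charf m u.
Proof.
have mf := @measurable_far R d.
have ic : m.-integrable setT (EFin \o (fun y => cos (dotp u y))).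
  apply: (@integrable_finite_bounded _ _ _ m _ 1); last by move=> y; exact: cos_max.
  exact: measurable_cos_dotpr0.
have E : (\int[m]_y (cos (dotp u y))%:E = \int[nu]_(y in far) (cos (dotp u y))%:E)%E.
  exact: (integral_concentrated mf (fun A _ => mE A) ic).
by rewrite /cos_far /charf /Rintegral E.
Qed.

Lemma measurable_charf : measurable_fun setT (charf m).
Proof.
have i1 : m.-integrable setT (EFin \o (fun=> 1)).
  by apply: (@integrable_finite_bounded _ _ _ m _ 1) => // y; rewrite normr1.
have mf : measurable_fun setT (fun z : 'rV[R]_d * 'rV[R]_d =>
    cos (dotp z.2 z.1) * cauchyw z.2).
  apply: measurable_funM; last first.
    by apply: measurableT_comp; [exact: measurable_cauchyw|exact: measurable_snd].
  apply: measurableT_comp.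
    by apply: continuous_measurable_fun; exact: continuous_cos.
  by under eq_fun do rewrite dotpC; exact: measurable_dotp2.
have fle y u : `|cos (dotp u y) * cauchyw u| <= 1 * cauchyw u.
  by rewrite normrM (ger0_norm (ltW (cauchyw_gt0 u))) ler_wpM2r ?(ltW (cauchyw_gt0 u))// cos_max.
have h := measurable_Rintegral2 (f := fun y u => cos (dotp u y) * cauchyw u) mf i1 (@integrable_cauchyw R d) fle.
rewrite (_ : charf m = fun u => (\int[m]_y (cos (dotp u y) * cauchyw u)) * (cauchyw u)^-1).
  apply: measurable_funM => //.
  rewrite (_ : (fun u => (cauchyw u)^-1) = (fun u : 'rV[R]_d => \prod_i (1 + u ord0 i ^+ 2))).
    apply: (@measurable_coord_prod _ _ (fun t => 1 + t ^+ 2)).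
    by apply: measurable_funD => //; exact: measurable_funX.
  by apply/funext => u; rewrite /cauchyw prodfV invrK.
apply/funext => u; rewrite RintegralZr//.
  by rewrite mulfK// gt_eqF// cauchyw_gt0.
apply: (@integrable_finite_bounded _ _ _ m _ 1); last by move=> y; exact: cos_max.
exact: measurable_cos_dotpr0.
Qed.

Lemma measurable_Phi : measurable_fun setT (Phi alpha mu).
Proof.
have -> : Phi alpha mu = fun u => Phi_near alpha mu u + (fine (nu far) - charf m u).
  by apply/funext => u; rewrite (PhiE mu alpha_bounds) cos_far_charf.
apply: measurable_funD; last first.
  by apply: measurable_funB => //; exact: measurable_charf.
by apply: continuous_measurable_rV; exact: continuous_Phi_near.
Qed.

Let polyb_monom b : polyb (@monom R d b). Proof. exact: (symb_polyb (symb_monom 0 b)). Qed.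

Lemma cdom_monom_exp t b : 0 < t ->
  cdom (fun u => monom b u * expR (- (t * Phi alpha mu u))).
Proof.
move=> t0; apply: (exp_Phi_cdom alpha_bounds mu_spectral d_gt0) => //.
exact: measurable_Phi.
Qed.

Definition dmult b (a : R) x : R :=
  FT a (fun u => monom b u * expR (- Phi alpha mu u)) x.

Let cdom_monom b : cdom (fun u => monom b u * expR (- Phi alpha mu u)).
Proof.
have := cdom_monom_exp b ltr01.
by under [X in cdom X -> _]eq_fun do rewrite mul1r.
Qed.

Lemma dmult_decay b : exists2 C, 0 <= C & forall a x, `|dmult b a x| <= C * decayh s x.
Proof.
have [c c0 ball] := levy_ball_le nu_gamma.
have m_ball x r : 0 < r -> r < enorm x / 2 ->
    (m (eball x r) <= (c * r `^ gamma * enorm x `^ (- (alpha + gamma)))%:E)%E.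
  move=> r0 rx; apply: le_trans (ball x r r0 rx); rewrite mE.
  apply: le_measure; rewrite ?inE//.
  - by apply: measurableI; [exact: measurable_eball|exact: measurable_far].
  - exact: measurable_eball.
have [C C0 hC] := integral_decayh_le alpha_gt0 s_gt0 c0 m_ball.
pose N := (Num.truncn s).+1.
have [A A0 hA] := damp_decay alpha_bounds mu_spectral d_gt0 N b.
pose G u := monom b u * damp alpha mu u.
have GA a z : `|FT a G z| <= A * decayh s z.
  apply: (le_trans (hA a z)); rewrite ler_wpM2l// /decayh powRN lef_pV2 ?posrE.
  - rewrite -powR_mulrn ?addr_ge0 ?enorm_ge0//; apply: ler_powR.
      by rewrite lerDl enorm_ge0.
    by rewrite ltW// truncnS_gt.
  - by rewrite exprn_gt0// ltr_pwDl// enorm_ge0.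
  - by rewrite powR_gt0// ltr_pwDl// enorm_ge0.
have cG : cdom G.
  by apply: (polyb_damp_cdom alpha_bounds mu_spectral d_gt0); exact: polyb_monom.
have h1 y : 0 <= @decayh R d s y <= 1 by rewrite ltW ?decayh_gt0// decayh_le1// ltW.
have hN y : decayh s (- y) = decayh s y by rewrite /decayh enormN.
have h := FT_exp_charf_le cG measurable_charf A0 C0 (measurable_decayh s) h1 hN hC GA.
pose L := fine (nu far).
exists (expR (- L) * (A * expR C)); first by rewrite !mulr_ge0 ?expR_ge0.
move=> a x; have -> : dmult b a x = expR (- L) * FT a (fun u => expR (charf m u) * G u) x.
  rewrite /dmult /FT -RintegralZl//; last first.
    apply: cdom_integrable; apply: cdom_cos.
    apply: (@cdom_mul_bounded _ _ _ _ (expR (fine (m setT)))) => //.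
      by apply: measurableT_comp; [exact: measurable_expR|exact: measurable_charf].
    move=> u; rewrite ger0_norm ?expR_ge0// ler_expR (le_trans (ler_norm _))//.
    exact: charf_le.
  apply: eq_Rintegral => u _; rewrite /G /damp (PhiE mu alpha_bounds) cos_far_charf -/L.
  have -> : - (Phi_near alpha mu u + (L - charf m u)) = - L + (charf m u + - Phi_near alpha mu u).
    by ring.
  by rewrite !expRD; ring.
rewrite normrM ger0_norm ?expR_ge0// -mulrA ler_wpM2l ?expR_ge0//; exact: h.
Qed.

Definition badd b (i : 'I_d) : {ffun 'I_d -> nat} := [ffun j => (b j + (j == i))%N].

Lemma monom_badd b i u : monom (badd b i) u = u ord0 i * monom b u.
Proof.
rewrite /monom (bigD1 i)//= [in RHS](bigD1 i)//= mulrA; congr (_ * _).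
  by rewrite ffunE eqxx addn1 exprS.
by apply: eq_bigr => j /negbTE ji; rewrite ffunE ji addn0.
Qed.

Lemma mi_size_badd b i : mi_size (badd b i) = (mi_size b).+1.
Proof.
rewrite /mi_size; under eq_bigr do rewrite ffunE.
rewrite big_split/= (bigD1 (P := predT) (F := fun j => nat_of_bool (j == i)) i)//= eqxx.
by rewrite [X in (_ + (_ + X))%N]big1 ?addn0 ?addn1// => j /negbTE ->.
Qed.

Let cdom_enorm b : cdom (fun u => enorm u * (monom b u * expR (- Phi alpha mu u))).
Proof.
have pe : polyb (fun u => enorm u * @monom R d b u).
  apply: polyb_mul => //; split; first exact: enorm_continuous.
  exists 1, 1%N; split => // u; rewrite mul1r expr1 ger0_norm ?enorm_ge0//.
  by rewrite lerDr.
have := exp_Phi_cdom alpha_bounds mu_spectral d_gt0 ltr01 pe measurable_Phi.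
by under [X in cdom X -> _]eq_fun do rewrite mul1r -mulrA.
Qed.

Lemma is_derive_dmult b a x z : is_derive x z (dmult b a)
  (\sum_(i < d) z ord0 i * dmult (badd b i) (a + pi / 2) x).
Proof.
have := is_derive_FT a x z (cdom_monom b) (cdom_enorm b).
rewrite (_ : FT _ _ _ = \sum_(i < d) z ord0 i * dmult (badd b i) (a + pi / 2) x)//.
rewrite /dmult -(FT_sum (index_enum 'I_d) (fun i => z ord0 i) (a + pi / 2) x
  (fun i => cdom_monom (badd b i))).
apply: eq_Rintegral => u _; congr (_ * _).
rewrite /dotp mulr_suml; apply: eq_bigr => i _; rewrite monom_badd; ring.
Qed.

(* This is (2 pi)^d, but only its positivity matters. *)
Definition kappaF : R := \int[lebesgue_rV d]_z (2 ^+ d * cauchyw z).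

Lemma monom0 : @monom R d [ffun=> 0%N] = fun=> 1.
Proof. by apply/funext => u; rewrite /monom big1// => i _; rewrite ffunE expr0. Qed.

Lemma continuous_density t : 0 < t -> continuous (p t).
Proof.
move=> t0; have [sm _ _] := p_density t0.
have [] := sm [ffun=> 0%N]; rewrite /mderiv (_ : foldr _ _ _ = p t)//.
by elim: (enum 'I_d) => [//|i l ih] /=; rewrite ffunE/= ih.
Qed.

Lemma density_FT t x : 0 < t ->
  FT 0 (fun u => expR (- (t * Phi alpha mu u))) x = kappaF * p t x.
Proof.
move=> t0; have [sm [M pM] PE] := p_density t0.
have cp := continuous_density t0; have mp := continuous_measurable_rV cp.
have p0 y : 0 <= p t y by have /andP[] := pM y.
have P1 : P t setT = 1%E by exact: probability_setT.
have [_ /(_ t _ t0) st] := P_stable.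
have RD := Rintegral_density mp p0 PE P1.
apply: (@fourier_inversion _ _ (p t) _ M) => //.
- exact: (integrable_density mp p0 PE P1).
- move=> u; rewrite -RD; last 2 first.
  + exact: measurable_cos_dotpr0.
  + by move=> y; exact: cos_max.
  rewrite /Rintegral (st u).1 (levy_exponent_Phi mu alpha_bounds).
  by rewrite -EFinM -EFinN.
- move=> u; rewrite -RD; last 2 first.
  + apply: measurableT_comp; last exact: measurable_dotpr.
    by apply: continuous_measurable_fun; exact: continuous_sin.
  + by move=> y; exact: sin_max.
  by rewrite /Rintegral (st u).2.
- have := cdom_monom_exp [ffun=> 0%N] t0.
  by rewrite monom0; under [X in cdom X -> _]eq_fun do rewrite mul1r.
Qed.

Lemma kappaF_gt0 : 0 < kappaF.
Proof.
have i : (lebesgue_rV d).-integrable setT (EFin \o (fun z => 2 ^+ d * @cauchyw R d z)).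
  exact: (integrableZl measurableT _ (@integrable_cauchyw R d)).
have k0 : 0 <= kappaF.
  by apply: Rintegral_ge0 => z _; rewrite mulr_ge0// ltW// cauchyw_gt0.
rewrite lt_neqAle k0 andbT eq_sym; apply/eqP => kE.
have mf := measurable_int _ i.
pose g z : R := 2 ^+ d * @cauchyw R d z.
have : (\int[lebesgue_rV d]_z `|(EFin \o g) z| = 0)%E.
  under eq_integral do rewrite /= ger0_norm ?mulr_ge0 ?(ltW (cauchyw_gt0 _))//.
  rewrite -[LHS]fineK; last exact: (integrable_fin_num measurableT i).
  by rewrite -[fine _]/kappaF kE.
move=> /(ae_eq_integral_abs _ measurableT mf)[N [mN N0 NT]].
have NE : N = setT.
  apply/seteqP; split => // z _; apply: NT => /= /(_ I) [] /eqP.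
  by rewrite mulf_eq0 expf_eq0 pnatr_eq0 andbF/= gt_eqF// cauchyw_gt0.
have [_ [M pM] PE] := p_density ltr01.
have := PE _ measurableT; rewrite -NE null_set_integral//.
  by rewrite NE probability_setT => -[] /eqP; rewrite oner_eq0.
apply: measurable_funTS; apply/measurable_EFinP; apply: continuous_measurable_rV; exact: continuous_density.
Qed.

Lemma density_dmult t x : 0 < t ->
  p t x = kappaF^-1 * (t `^ (- alpha^-1) ^+ d *
    dmult [ffun=> 0%N] 0 (t `^ (- alpha^-1) *: x)).
Proof.
move=> t0; have q0 : 0 < t `^ alpha^-1 by exact: powR_gt0.
set q := t `^ alpha^-1 in q0; have -> : t `^ (- alpha^-1) = q^-1 by rewrite powRN.
have qa : q `^ alpha = t by rewrite /q -powRrM mulVf ?powRr1// ?ltW// gt_eqF.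
suff E : FT 0 (fun u => expR (- (t * Phi alpha mu u))) x =
    q^-1 ^+ d * dmult [ffun=> 0%N] 0 (q^-1 *: x).
  by rewrite -E density_FT// mulrA mulVf ?mul1r// gt_eqF// kappaF_gt0.
rewrite exprVn /dmult /FT -(@Rintegral_affine _ _ q 0)//; last first.
  by apply: cdom_integrable; exact: cdom_cos.
apply: eq_Rintegral => u _; rewrite !addr0 monom0 mul1r dotpZl dotpZr mulrA.
rewrite mulfV ?mul1r ?gt_eqF//; congr (_ * expR (- _)).
by rewrite (Phi_scale mu alpha_bounds)// qa.
Qed.

End stable_densities.

(** * The potential kernel *)

Section split_power_integrals.
Context {R : realType}.
Notation leb := (@lebesgue_measure R).

Lemma integral_power_split (f : R -> R) (A B p q tau : R) :
  measurable_fun setT f -> 0 <= A -> 0 <= B -> 0 < tau ->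
  0 < p + 1 -> q + 1 < 0 ->
  (forall t, 0 < t -> t <= tau -> `|f t| <= A * t `^ p) ->
  (forall t, tau < t -> `|f t| <= B * t `^ q) ->
  leb.-integrable `]0%R, +oo[ (EFin \o f) /\
  `|\int[leb]_(t in `]0%R, +oo[) f t| <=
    A * (tau `^ (p + 1) / (p + 1)) + B * (tau `^ (q + 1) / (- (q + 1))).
Proof.
move=> mf A0 B0 tau0; rewrite -ltrBlDr sub0r -ltrBrDr sub0r => p1 q1 fA fB.
have mD := @measurable_itv R `]0%R, +oo[.
have mfn (D : set R) : measurable_fun D (fun t => `|f t|%:E).
  by apply: measurable_funTS; apply/measurable_EFinP; exact: measurableT_comp.
have DE : `]0%R, +oo[%classic = `]0%R, tau] `|` `]tau, +oo[ :> set R.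
  apply/seteqP; split => t /=; rewrite !in_itv/= ?andbT.
    by move=> t0; case: (leP t tau) => h; [left; rewrite t0|right].
  by case=> [/andP[]//|]; exact: lt_trans.
have mD1 := @measurable_itv R `]0%R, tau].
have mD2 := @measurable_itv R `]tau, +oo[.
have mpow (D : set R) (k e : R) : measurable_fun D (fun t : R => (k * t `^ e)%:E).
  apply/measurable_EFinP/measurable_funM => //; apply: measurable_funTS.
  exact: measurable_powR.
have le : (\int[leb]_(t in `]0%R, +oo[) `|f t|%:E <=
    (A * (tau `^ (p + 1) / (p + 1)) + B * (tau `^ (q + 1) / (- (q + 1))))%:E)%E.
  have dis : [disjoint (`]0%R, tau]%classic : set R) & `]tau, +oo[%classic].
    apply/disj_setPS => t [] /=; rewrite !in_itv/= andbT => /andP[_ h1] h2.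
    by have := le_lt_trans h1 h2; rewrite ltxx.
  rewrite DE (@ge0_integral_setU _ _ _ leb _ _ mD1 mD2 (fun t => `|f t|%:E) (mfn _) _ dis)//.
  rewrite EFinD; apply: leeD.
    apply: (@le_trans _ _ (\int[leb]_(t in `]0%R, tau]) (A * t `^ p)%:E)%E).
      apply: ge0_le_integral; [exact: mD1|by []|exact: mfn|exact: mpow|].
      by move=> t /=; rewrite in_itv/= => /andP[t0 tt]; rewrite lee_fin fA.
    under eq_integral do rewrite EFinM.
    rewrite ge0_integralZl//; last 2 first.
      + by apply: measurable_funTS; apply/measurable_EFinP; exact: measurable_powR.
      + by move=> t _; rewrite lee_fin powR_ge0.
    by rewrite EFinM lee_wpmul2l// integral_powR_zero_le.
  apply: (@le_trans _ _ (\int[leb]_(t in `]tau, +oo[) (B * t `^ q)%:E)%E).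
    apply: ge0_le_integral; [exact: mD2|by []|exact: mfn|exact: mpow|].
    by move=> t /=; rewrite in_itv/= andbT => tt; rewrite lee_fin fB.
  under eq_integral do rewrite EFinM.
  rewrite ge0_integralZl//; last 2 first.
    + by apply: measurable_funTS; apply/measurable_EFinP; exact: measurable_powR.
    + by move=> t _; rewrite lee_fin powR_ge0.
  by rewrite EFinM lee_wpmul2l// integral_powR_infty// invrN mulrN.
have If : leb.-integrable `]0%R, +oo[ (EFin \o f).
  apply/integrableP; split; first by apply/measurable_EFinP; exact: measurable_funTS.
  exact: le_lt_trans le (ltry _).
split => //; rewrite (le_trans (@le_normr_Rintegral _ _ R leb _ f mD If))//.
rewrite -lee_fin (le_trans _ le)// /Rintegral fineK// ge0_fin_numE ?integral_ge0//.
by rewrite (le_lt_trans le)// ltry.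
Qed.

End split_power_integrals.

Section homogeneous_potential.
Context {R : realType} {d : nat}.
Variables (alpha s : R) (H : {ffun 'I_d -> nat} -> R -> 'rV[R]_d -> R).
Hypothesis alpha_gt0 : 0 < alpha.
Hypothesis alpha_lt_d : alpha < d%:R.
Hypothesis s_gt0 : 0 < s.
Hypothesis H_decay : forall b, exists2 C, 0 <= C & forall a x, `|H b a x| <= C * decayh s x.
Hypothesis is_derive_H : forall b a (x z : 'rV[R]_d), is_derive x z (H b a)
  (\sum_(i < d) z ord0 i * H (badd b i) (a + pi / 2) x).
Notation leb := (@lebesgue_measure R).
Local Notation ia := (alpha^-1).
Implicit Types (b : {ffun 'I_d -> nat}) (x y z : 'rV[R]_d).

Let ia_gt0 : 0 < ia. Proof. by rewrite invr_gt0. Qed.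

Lemma decayh_le_powR (s' rho : R) x : 0 <= s' -> s' <= s -> 0 < rho -> rho <= enorm x ->
  decayh s x <= rho `^ (- s').
Proof.
move=> s0 ss r0 rx; have x1 : 0 < 1 + enorm x by rewrite ltr_pwDl// enorm_ge0.
rewrite /decayh !powRN lef_pV2 ?posrE ?powR_gt0//.
apply: (@le_trans _ _ ((1 + enorm x) `^ s')).
  rewrite ge0_ler_powR// ?nnegrE ?(ltW r0) ?(ltW x1)//.
  by rewrite (le_trans rx)// lerDr.
by rewrite ler_powR// lerDl enorm_ge0.
Qed.

Lemma H_bound b : exists2 C, 0 <= C & forall a x (s' rho : R), 0 <= s' -> s' <= s ->
  0 < rho -> rho <= enorm x -> `|H b a x| <= C * rho `^ (- s').
Proof.
have [C C0 hC] := H_decay b; exists C => // a x s' rho s0 ss r0 rx.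
by rewrite (le_trans (hC a x))// ler_wpM2l// decayh_le_powR.
Qed.

Lemma H_lipschitz b : exists2 C, 0 <= C & forall a x z (s' rho : R), 0 <= s' -> s' <= s ->
  0 < rho -> (forall t, 0 <= t <= 1 -> rho <= enorm (t *: z + x)) ->
  `|H b a (z + x) - H b a x| <= C * enorm z * rho `^ (- s').
Proof.
have /choice[C hC] : forall i, exists C, 0 <= C /\ forall a x (s' rho : R), 0 <= s' ->
    s' <= s -> 0 < rho -> rho <= enorm x -> `|H (badd b i) a x| <= C * rho `^ (- s').
  by move=> i; have [C C0 h] := H_bound (badd b i); exists C.
exists (\sum_i C i); first by apply: sumr_ge0 => i _; case: (hC i).
move=> a x z s' rho s0 ss r0 seg.
have := @mvt_bound R (fun t => H b a (t *: z + x))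
  (fun t => \sum_(i < d) z ord0 i * H (badd b i) (a + pi / 2) (t *: z + x))
  ((\sum_i C i) * enorm z * rho `^ (- s')) 0 1 ler01.
rewrite scale1r scale0r add0r subr0 mulr1; apply.
  by move=> t; apply/derive_along; exact: is_derive_H.
move=> t t01; rewrite (le_trans (ler_norm_sum _ _ _))//.
rewrite mulr_suml mulr_suml; apply: ler_sum => i _.
rewrite normrM -mulrA mulrCA ler_pM// ?coord_le_enorm//.
by have [_] := hC i; apply => //; exact: seg.
Qed.

Let powR_sub1 (u c : R) : 0 < u -> u `^ (c - 1) = u `^ c / u.
Proof.
by move=> u0; rewrite powRD ?(gt_eqF u0) ?implybT// powR_inv1// ltW.
Qed.

Definition potential_integrand b a x (t : R) : R :=
  t `^ (- ((d + mi_size b)%:R * ia)) * H b a (t `^ (- ia) *: x).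

Local Notation w := potential_integrand.

Lemma measurable_potential_integrand b a x : measurable_fun setT (w b a x).
Proof.
apply: measurable_funM; first exact: measurable_powR.
apply: (@measurableT_comp _ _ _ _ _ _ (fun r : R => H b a (r *: x))); last first.
  exact: measurable_powR.
apply: continuous_measurable_fun => r.
apply: differentiable_continuous; apply/derivable1_diffP.
have h : is_derive r 1 (fun r : R => H b a (r *: x + 0))
    (\sum_(i < d) x ord0 i * H (badd b i) (a + pi / 2) (r *: x + 0)).
  by apply/derive_along; exact: is_derive_H.
rewrite (_ : (fun r => _) = (fun r : R => H b a (r *: x + 0))); first exact: ex_derive.
by apply/funext => r'; rewrite addr0.
Qed.

Lemma potential_integrand_le b : exists2 C, 0 <= C & forall a x (s' rho t : R),
  0 <= s' -> s' <= s -> 0 < rho -> rho <= enorm x -> 0 < t ->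
  `|w b a x t| <= C * rho `^ (- s') * t `^ ((s' - (d + mi_size b)%:R) * ia).
Proof.
have [C C0 hC] := H_bound b; exists C => // a x s' rho t s0 ss r0 rx t0.
have p0 : 0 < t `^ (- ia) by exact: powR_gt0.
rewrite normrM ger0_norm ?powR_ge0//.
have := hC a (t `^ (- ia) *: x) s' (t `^ (- ia) * rho) s0 ss (mulr_gt0 p0 r0).
rewrite enormZ (ger0_norm (ltW p0)) ler_pM2l// => /(_ rx) h.
rewrite (le_trans (ler_wpM2l (powR_ge0 _ _) h))//.
rewrite powRM ?(ltW p0) ?(ltW r0)// -powRrM mulrBl [s' * _ - _]addrC powRD ?(gt_eqF t0) ?implybT//.
by rewrite mulrNN (mulrC ia) le_eqVlt; apply/orP; left; apply/eqP; ring.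
Qed.

Lemma potential_integrand_lip b : exists2 C, 0 <= C & forall a x z (s' rho t : R),
  0 <= s' -> s' <= s -> 0 < rho -> (forall t, 0 <= t <= 1 -> rho <= enorm (t *: z + x)) ->
  0 < t -> `|w b a (z + x) t - w b a x t| <=
    C * enorm z * rho `^ (- s') * t `^ ((s' - 1 - (d + mi_size b)%:R) * ia).
Proof.
have [C C0 hC] := H_lipschitz b; exists C => // a x z s' rho t s0 ss r0 seg t0.
have p0 : 0 < t `^ (- ia) by exact: powR_gt0.
rewrite -mulrBr normrM ger0_norm ?powR_ge0//.
have := hC a (t `^ (- ia) *: x) (t `^ (- ia) *: z) s' (t `^ (- ia) * rho) s0 ss (mulr_gt0 p0 r0).
have seg' u : 0 <= u <= 1 ->
    t `^ (- ia) * rho <= enorm (u *: (t `^ (- ia) *: z) + t `^ (- ia) *: x).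
  move=> u01; rewrite scalerA (mulrC u) -scalerA -scalerDr enormZ (ger0_norm (ltW p0)).
  by rewrite ler_pM2l// seg.
move=> /(_ seg'); rewrite -scalerDr enormZ (ger0_norm (ltW p0)) => h; rewrite (le_trans (ler_wpM2l (powR_ge0 _ _) h))//.
rewrite powRM ?(ltW p0) ?(ltW r0)// -powRrM mulrNN.
have -> : (s' - 1 - (d + mi_size b)%:R) * ia =
    - ((d + mi_size b)%:R * ia) + (- ia + ia * s') by ring.
rewrite !powRD ?(gt_eqF t0) ?implybT//.
by rewrite le_eqVlt; apply/orP; left; apply/eqP; ring.
Qed.

Definition potential_integral b a x : R := \int[leb]_(t in `]0%R, +oo[) w b a x t.
Local Notation W := potential_integral.
Local Notation kappa := (s + alpha - d%:R).

Let exponent_near0 n : n%:R < kappa -> 0 < (s - (d + n)%:R) * ia + 1.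
Proof.
move=> nk; rewrite -(pmulr_rgt0 _ alpha_gt0) mulrDr mulrCA mulfV ?gt_eqF// !mulr1 natrD.
by rewrite -subr_gt0 in nk; apply: lt_le_trans nk _; lra.
Qed.

Let exponent_near_infty n : (0 - (d + n)%:R) * ia + 1 < 0.
Proof.
rewrite -(pmulr_rlt0 _ alpha_gt0) mulrDr mulrCA mulfV ?gt_eqF// !mulr1 natrD.
by have : 0 <= n%:R :> R by []; move: alpha_lt_d; lra.
Qed.

Lemma potential_integral_le b : (mi_size b)%:R < kappa -> exists2 C, 0 <= C &
  forall a x, x != 0 ->
    leb.-integrable `]0%R, +oo[ (EFin \o w b a x) /\
    `|W b a x| <= C * enorm x `^ (alpha - d%:R - (mi_size b)%:R).
Proof.
move=> bk; have [C C0 hC] := potential_integrand_le b.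
pose p := (s - (d + mi_size b)%:R) * ia; pose q := (0 - (d + mi_size b)%:R) * ia.
have p1 : 0 < p + 1 by exact: exponent_near0.
have q1 : q + 1 < 0 by exact: exponent_near_infty.
exists (C * (p + 1)^-1 + C * (- (q + 1))^-1).
  by rewrite addr_ge0// mulr_ge0// invr_ge0 ltW// oppr_gt0.
move=> a x x0; have e0 : 0 < enorm x by rewrite enorm_gt0.
have t0 : 0 < enorm x `^ alpha by exact: powR_gt0.
have A0 : 0 <= C * enorm x `^ (- s) by rewrite mulr_ge0// powR_ge0.
have [t tp tt|t tt|I le] := integral_power_split (measurable_potential_integrand b a x)
  A0 C0 t0 p1 q1.
- by have := hC a x s (enorm x) t (ltW s_gt0) (lexx _) e0 (lexx _) tp.
- have := hC a x 0 (enorm x) t (lexx _) (ltW s_gt0) e0 (lexx _) (lt_trans t0 tt).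
  by rewrite oppr0 powRr0 mulr1.
split => //; apply: le_trans le _.
have ap : alpha * (p + 1) = s + (alpha - d%:R - (mi_size b)%:R).
  by rewrite mulrDr mulrCA mulfV ?gt_eqF// !mulr1 natrD; ring.
have aq : alpha * (q + 1) = alpha - d%:R - (mi_size b)%:R.
  by rewrite mulrDr mulrCA mulfV ?gt_eqF// !mulr1 natrD; ring.
rewrite -!powRrM ap aq powRD ?(gt_eqF e0) ?implybT//.
rewrite powRN; set e := enorm x `^ (alpha - _ - _); set f := enorm x `^ s.
have f0 : f != 0 by rewrite gt_eqF// powR_gt0.
rewrite le_eqVlt; apply/orP; left; apply/eqP.
have -> : C * f^-1 * (f * e / (p + 1)) = (f^-1 * f) * (C * e / (p + 1)) by ring.
by rewrite mulVf//; ring.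
Qed.

Lemma is_derive_potential_integral b i a x : (mi_size b).+1%:R < kappa -> x != 0 ->
  is_derive x (unit_vec i) (W b a) (W (badd b i) (a + pi / 2) x).
Proof.
move=> bk x0; apply/derive_along0.
have e0 : 0 < enorm x by rewrite enorm_gt0.
pose rho := enorm x / 2; have r0 : 0 < rho by rewrite divr_gt0.
have ball u : `|u| < rho -> rho <= enorm (u *: unit_vec i + x).
  move=> ur; have := ler_enorm_subD x (- (u *: unit_vec i)).
  rewrite opprK enormN enormZ enorm_unit_vec mulr1 (addrC x).
  have : enorm x = rho + rho by rewrite -splitr.
  by move: ur; lra.
have bk' : (mi_size b)%:R < kappa by apply: lt_trans bk; rewrite ltr_nat.
have [C C0 hC] := potential_integrand_le (badd b i).
have [C1 _ hC1] := potential_integral_le bk'.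
have nz u : `|u| < rho -> u *: unit_vec i + x != 0.
  by move=> /ball ur; rewrite -enorm_gt0; exact: lt_le_trans ur.
pose p := (s - (d + (mi_size b).+1)%:R) * ia; pose q := (0 - (d + (mi_size b).+1)%:R) * ia.
have p1 : 0 < p + 1 by exact: exponent_near0.
have q1 : q + 1 < 0 by exact: exponent_near_infty.
pose G t : R := if t <= 1 then C * rho `^ (- s) * t `^ p else C * t `^ q.
have mG : measurable_fun setT G.
  apply: measurable_fun_ifT.
  - exact: measurable_fun_ler.
  - by apply: measurable_funM => //; exact: measurable_powR.
  - by apply: measurable_funM => //; exact: measurable_powR.
have G0 t : 0 <= G t by rewrite /G; case: ifP => _; rewrite !mulr_ge0// powR_ge0.
have A0 : 0 <= C * rho `^ (- s) by rewrite mulr_ge0// powR_ge0.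
have [t tp tt|t tt|IG _] := integral_power_split mG A0 C0 ltr01 p1 q1.
- by rewrite ger0_norm// /G tt.
- by rewrite ger0_norm// /G ifF//; apply/negbTE; rewrite -ltNge.
have -> : W (badd b i) (a + pi / 2) x = \int[leb]_(t in `]0%R, +oo[)
   w (badd b i) (a + pi / 2) (0 *: unit_vec i + x) t by rewrite scale0r add0r.
have mD := @measurable_itv R `]0%R, +oo[.
apply: (@is_derive_Rintegral _ _ R leb _
  (fun u t => w b a (u *: unit_vec i + x) t)
  (fun u t => w (badd b i) (a + pi / 2) (u *: unit_vec i + x) t) G rho mD r0) => //.
- by move=> u /nz /(hC1 a)[].
- move=> u t ur; rewrite /= in_itv/= andbT => t0.
  rewrite /potential_integrand mi_size_badd.
  have -> : - ((d + (mi_size b).+1)%:R * ia) = - ((d + mi_size b)%:R * ia) + - ia.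
    by rewrite addnS -natr1; ring.
  rewrite powRD ?(gt_eqF t0) ?implybT// -mulrA.
  apply: is_deriveZ.
  have -> : t `^ (- ia) * H (badd b i) (a + pi / 2) (t `^ (- ia) *: (u *: unit_vec i + x)) =
    \sum_(j < d) (t `^ (- ia) *: unit_vec i) ord0 j * H (badd b j) (a + pi / 2)
       (u *: (t `^ (- ia) *: unit_vec i) + t `^ (- ia) *: x).
    rewrite (bigD1 i)//= big1 ?addr0 => [|j ji]; last first.
      by rewrite !mxE eqxx/= (negbTE ji) mulr0 mul0r.
    by rewrite !mxE !eqxx mulr1 scalerDr !scalerA (mulrC u).
  under eq_fun do rewrite scalerDr scalerA mulrC -scalerA.
  by apply/derive_along; exact: is_derive_H.
- move=> u t ur; rewrite /= in_itv/= andbT => t0; rewrite /G.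
  case: ifPn => t1.
    have := hC (a + pi / 2) _ s rho t (ltW s_gt0) (lexx _) r0 (ball _ ur) t0.
    by rewrite mi_size_badd.
  have := hC (a + pi / 2) _ 0 rho t (lexx _) (ltW s_gt0) r0 (ball _ ur) t0.
  by rewrite mi_size_badd oppr0 powRr0 mulr1.
Qed.

Lemma potential_integral_hoelder b (sigma rho : R) : 0 < sigma -> sigma < 1 ->
  (mi_size b)%:R + sigma <= kappa -> 0 < rho -> exists2 C, 0 <= C &
  forall a x y, rho <= enorm x -> rho <= enorm y ->
    `|W b a y - W b a x| <= C * enorm (y - x) `^ sigma.
Proof.
move=> s0 s1 bk r0; set n := mi_size b in bk.
have bk' : n%:R < kappa by apply: lt_le_trans bk; rewrite ltrDl.
have [C1 C10 hC1] := potential_integral_le bk'.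
have [C2 C20 hC2] := potential_integrand_le b.
have [C3 C30 hC3] := potential_integrand_lip b.
(* With the exponent s' the two powers of t below are sigma / alpha - 1 and
   (sigma - 1) / alpha - 1, integrable at 0 and at infinity respectively. *)
pose s' := n%:R + sigma + d%:R - alpha; pose r := rho / 2.
have n0 : 0 <= n%:R :> R by [].
have s'0 : 0 <= s' by rewrite /s'; move: alpha_lt_d s0; lra.
have s's : s' <= s by rewrite /s'; move: bk; lra.
have rp : 0 < r by rewrite divr_gt0.
have e0 : alpha - d%:R - n%:R <= 0 by move: alpha_lt_d; lra.
pose p := (s' - (d + n)%:R) * ia; pose q := (s' - 1 - (d + n)%:R) * ia.
have pE : p + 1 = sigma * ia.
  by rewrite -[X in _ + X](mulfV (lt0r_neq0 alpha_gt0)) /p -mulrDl natrD; congr (_ * _); rewrite /s'; ring.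
have qE : q + 1 = (sigma - 1) * ia.
  by rewrite -[X in _ + X](mulfV (lt0r_neq0 alpha_gt0)) /q -mulrDl natrD; congr (_ * _); rewrite /s'; ring.
have p1 : 0 < p + 1 by rewrite pE mulr_gt0.
have q1 : q + 1 < 0 by rewrite qE pmulr_llt0// subr_lt0.
pose A := 2 * C2 * r `^ (- s'); pose B := C3 * r `^ (- s').
have A0 : 0 <= A by rewrite !mulr_ge0// powR_ge0.
have B0 : 0 <= B by rewrite !mulr_ge0// powR_ge0.
pose K := A / (p + 1) + B / (- (q + 1)).
pose L := 2 * (C1 * rho `^ (alpha - d%:R - n%:R)) * r `^ (- sigma).
have K0 : 0 <= K by rewrite addr_ge0// mulr_ge0// invr_ge0 ltW// oppr_gt0.
have L0 : 0 <= L by rewrite !mulr_ge0// powR_ge0.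
exists (K + L); first exact: addr_ge0.
move=> a x y xr yr.
have nzx : x != 0 by rewrite -enorm_gt0; exact: lt_le_trans xr.
have nzy : y != 0 by rewrite -enorm_gt0; exact: lt_le_trans yr.
have [Ix Wx] := hC1 a x nzx; have [Iy Wy] := hC1 a y nzy.
have [far|near] := ltP r (enorm (y - x)).
  apply: (@le_trans _ _ (L * enorm (y - x) `^ sigma)); last first.
    by rewrite ler_wpM2r ?powR_ge0// lerDr.
  have anti z : rho <= enorm z -> enorm z `^ (alpha - d%:R - n%:R) <= rho `^ (alpha - d%:R - n%:R).
    move=> zr; rewrite -[alpha - _ - _]opprK !(powRN _ (- _)) lef_pV2 ?posrE ?powR_gt0//; last first.
      exact: lt_le_trans zr.
    by rewrite ge0_ler_powR// ?oppr_ge0 ?nnegrE ?enorm_ge0// ltW.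
  apply: (@le_trans _ _ (2 * (C1 * rho `^ (alpha - d%:R - n%:R)))).
    rewrite (le_trans (ler_normB _ _))// mulr2n mulrDl mul1r lerD//.
      by rewrite (le_trans Wy)// ler_wpM2l// anti.
    by rewrite (le_trans Wx)// ler_wpM2l// anti.
  rewrite /L -[leRHS]mulrA ler_peMr//; first by rewrite !mulr_ge0// powR_ge0.
  rewrite powRN mulrC ler_pdivlMr ?powR_gt0// mul1r.
  by rewrite ge0_ler_powR// ?nnegrE ?enorm_ge0 ?(ltW rp) ?(ltW far) ?(ltW s0).
apply: (@le_trans _ _ (K * enorm (y - x) `^ sigma)); last first.
  by rewrite ler_wpM2r ?powR_ge0// lerDl.
have [->|xy] := eqVneq y x; first by rewrite !subrr normr0 mulr_ge0// powR_ge0.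
pose z := y - x; have zE : y = z + x by rewrite subrK.
have z0 : 0 < enorm z by rewrite enorm_gt0 subr_eq0.
have seg t : 0 <= t <= 1 -> r <= enorm (t *: z + x).
  move=> /andP[t0 t1]; have := ler_enorm_subD x (- (t *: z)).
  rewrite opprK enormN enormZ (ger0_norm t0) (addrC x).
  have : t * enorm z <= r by rewrite (le_trans _ near)// ler_piMl// enorm_ge0.
  have : rho = r + r by rewrite -splitr.
  by move: xr; lra.
have -> : W b a y - W b a x = \int[leb]_(t in `]0%R, +oo[) (w b a y t - w b a x t).
  by rewrite RintegralB.
have t0 : 0 < enorm z `^ alpha by exact: powR_gt0.
have mw : measurable_fun setT (fun t => w b a y t - w b a x t).
  by apply: measurable_funB; exact: measurable_potential_integrand.
have Bz : 0 <= B * enorm z by rewrite mulr_ge0// enorm_ge0.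
have [t tp tt|t tt|_ le] := integral_power_split mw A0 Bz t0 p1 q1.
- rewrite (le_trans (ler_normB _ _))// /A -!mulrA mulr2n mulrDl mul1r !mulrA.
  have rr : r <= rho by rewrite /r ler_pdivrMr// mulr_natr mulr2n lerDl ltW.
  by rewrite lerD//; apply: hC2 => //; apply: le_trans rr _.
- rewrite zE (le_trans (hC3 a x z s' r t s'0 s's rp seg (lt_trans t0 tt)))//.
  by rewrite /B (mulrAC C3).
apply: le_trans le _; rewrite -!powRrM -/z pE qE.
have -> : alpha * (sigma * ia) = sigma by rewrite mulrCA mulfV ?mulr1// gt_eqF.
have -> : alpha * ((sigma - 1) * ia) = sigma - 1 by rewrite mulrCA mulfV ?mulr1// gt_eqF.
rewrite powR_sub1//.
rewrite le_eqVlt; apply/orP; left; apply/eqP.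
rewrite /K pE qE; set e := enorm z `^ sigma; set f := enorm z.
have f0 : f != 0 by rewrite gt_eqF.
have -> : B * f * (e / f / (- ((sigma - 1) * ia))) = (f / f) * (B * e / (- ((sigma - 1) * ia))) by ring.
by rewrite mulfV//; ring.
Qed.

End homogeneous_potential.

Section iterated_derivatives.
Context {R : realType} {d : nat}.
Implicit Types (b : {ffun 'I_d -> nat}) (x : 'rV[R]_d).

Lemma iter_badd k i b j : iter k (badd^~ i) b j = (b j + k * (j == i))%N.
Proof.
elim: k => [|k ih] /=; first by rewrite mul0n addn0.
by rewrite ffunE ih mulSn -addnA [(k * _ + _)%N]addnC.
Qed.

Lemma mi_size_iter_badd k i b : mi_size (iter k (badd^~ i) b) = (mi_size b + k)%N.
Proof. by elim: k => [|k ih] /=; rewrite ?addn0// mi_size_badd ih addnS. Qed.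

Lemma foldr_badd b :
  foldr (fun i b' => iter (b i) (badd^~ i) b') [ffun=> 0%N] (enum 'I_d) = b.
Proof.
apply/ffunP => j.
have -> l : foldr (fun i b' => iter (b i) (badd^~ i) b') [ffun=> 0%N] l j =
    (\sum_(i <- l) b i * (j == i))%N.
  elim: l => [|i l ih] /=; first by rewrite big_nil ffunE.
  by rewrite iter_badd big_cons ih addnC.
rewrite big_enum/= (bigD1 j)//= eqxx muln1 big1 ?addn0// => i /negbTE.
by rewrite eq_sym => ->; rewrite muln0.
Qed.

Variables (F : {ffun 'I_d -> nat} -> R -> 'rV[R]_d -> R) (kappa c : R).
Variable f : 'rV[R]_d -> R.
Hypothesis fE : forall x, x != 0 -> f x = c * F [ffun=> 0%N] 0 x.
Hypothesis dF : forall b i a x, (mi_size b).+1%:R < kappa -> x != 0 ->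
  is_derive x (unit_vec i) (F b a) (F (badd b i) (a + pi / 2) x).

Let phase b : R := (mi_size b)%:R * (pi / 2).

Definition derivative_form (g : 'rV[R]_d -> R) b : Prop :=
  forall x, x != 0 -> g x = c * F b (phase b) x.

Let near_nz x : x != 0 -> nbhs x [set y : 'rV[R]_d | y != 0].
Proof.
move=> x0; have o : open (~` [set (0 : 'rV[R]_d)]).
  by rewrite openC; apply: accessible_closed_set1; apply: hausdorff_accessible; exact: norm_hausdorff.
have : nbhs x (~` [set (0 : 'rV[R]_d)]) by apply: open_nbhs_nbhs; split => //; exact/eqP.
by apply: filterS => y /eqP.
Qed.

Lemma derivative_form_is_derive g b i x : derivative_form g b ->
  (mi_size b).+1%:R < kappa -> x != 0 ->
  is_derive x (unit_vec i) g (c * F (badd b i) (phase (badd b i)) x).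
Proof.
move=> gb bk x0.
apply: (@near_eq_is_derive _ _ _ (fun y => c *: F b (phase b) y)).
  by apply: filterS (near_nz x0) => y y0; rewrite gb.
have -> : phase (badd b i) = phase b + pi / 2.
  by rewrite /phase mi_size_badd -natr1 mulrDl mul1r.
apply: is_deriveZ; exact: dF.
Qed.

Lemma derivative_form_pderiv g b i : derivative_form g b ->
  (mi_size b).+1%:R < kappa -> derivative_form (pderiv i g) (badd b i).
Proof.
move=> gb bk x x0; rewrite /pderiv.
by have h := derivative_form_is_derive i gb bk x0; rewrite derive_val.
Qed.

Lemma derivative_form_mderiv b : (mi_size b)%:R < kappa ->
  derivative_form (mderiv b f) b.
Proof.
have it k i g b' : derivative_form g b' -> (mi_size b' + k)%:R < kappa ->
    derivative_form (iter k (pderiv i) g) (iter k (badd^~ i) b').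
  move=> gb'; elim: k => [//|k ih]; rewrite addnS => bk /=.
  apply: derivative_form_pderiv; last by rewrite mi_size_iter_badd.
  by apply: ih; apply: lt_trans bk; rewrite ltr_nat.
pose B l := foldr (fun i b' => iter (b i) (badd^~ i) b') [ffun=> 0%N] l.
suff h l : (mi_size (B l))%:R < kappa ->
    derivative_form (foldr (fun i g => iter (b i) (pderiv i) g) f l) (B l).
  by move=> bk; have := h (enum 'I_d); rewrite /B foldr_badd; exact.
elim: l => [_ x x0|i l ih] /=.
  by rewrite fE// /phase /mi_size big1 ?mul0r// => j _; rewrite ffunE.
rewrite mi_size_iter_badd => lk; apply: it => //; apply: ih.
by apply: le_lt_trans lk; rewrite ler_nat leq_addr.
Qed.

End iterated_derivatives.

Section hoelder_spaces.
Context {R : realType} {d : nat}.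
Implicit Types (b : {ffun 'I_d -> nat}) (U : set 'rV[R]_d) (g : 'rV[R]_d -> R).

Lemma finite_mi_size n : finite_set [set b : {ffun 'I_d -> nat} | (mi_size b <= n)%N].
Proof.
pose g (h : {ffun 'I_d -> 'I_n.+1}) : {ffun 'I_d -> nat} := [ffun i => h i : nat].
apply: (@sub_finite_set _ _ (g @` setT)); last exact/finite_image/finite_finset.
move=> b /= bn; exists [ffun i => inord (b i)] => //; apply/ffunP => i.
rewrite !ffunE inordK// ltnS (leq_trans _ bn)//.
by rewrite /mi_size (bigD1 i)//= leq_addr.
Qed.

Lemma esum_lty (T : choiceType) (D : set T) (a : T -> \bar R) : finite_set D ->
  (forall i, D i -> 0 <= a i < +oo)%E -> (\esum_(i in D) a i < +oo)%E.
Proof.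
move=> fD h; rewrite esum_fset// => [|i /set_mem/h/andP[]//].
rewrite fsbig_finite//= big_seq; apply: lte_sum_pinfty => i.
by rewrite in_fset_set// => /set_mem/h/andP[].
Qed.

Lemma sup_norm_lty U g M : 0 <= M -> (forall x, U x -> `|g x| <= M) ->
  (0 <= sup_norm U g < +oo)%E.
Proof.
move=> M0 gM; apply/andP; split; first by apply: ereal_sup_ubound; left.
apply: (@le_lt_trans _ _ M%:E); last exact: ltry.
apply: ge_ereal_sup => _ [->|[x Ux <-]]; first by rewrite lee_fin.
by rewrite lee_fin gM.
Qed.

Lemma hoelder_seminorm_lty (sigma C : R) U g : 0 <= C ->
  (forall x y, U x -> U y -> `|g y - g x| <= C * enorm (y - x) `^ sigma) ->
  (0 <= hoelder_seminorm sigma U g < +oo)%E.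
Proof.
move=> C0 gC; apply/andP; split; first by apply: ereal_sup_ubound; left.
apply: (@le_lt_trans _ _ C%:E); last exact: ltry.
apply: ge_ereal_sup => _ [->|[x [y [Ux Uy xy ->]]]]; first by rewrite lee_fin.
rewrite lee_fin ler_pdivrMr ?gC// powR_gt0// enorm_gt0 subr_eq0.
by rewrite eq_sym.
Qed.

Lemma C0_space_hoelder U g (sigma C M : R) : 0 < sigma -> 0 <= C ->
  (forall x, U x -> `|g x| <= M) ->
  (forall x y, U x -> U y -> `|g y - g x| <= C * enorm (y - x) `^ sigma) ->
  C0_space U g.
Proof.
move=> s0 C0 gM gC; split; first by exists M.
move=> e e0; have C1 : 0 < C + 1 by rewrite ltr_wpDl.
exists ((e / (C + 1)) `^ sigma^-1); first by rewrite powR_gt0// divr_gt0.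
move=> x y Ux Uy xy; apply: le_lt_trans (gC x y Ux Uy) _.
have h : enorm (y - x) `^ sigma < e / (C + 1).
  have -> : e / (C + 1) = ((e / (C + 1)) `^ sigma^-1) `^ sigma.
    by rewrite -powRrM mulVf ?lt0r_neq0// powRr1// divr_ge0// ltW.
  rewrite gt0_ltr_powR// ?nnegrE ?enorm_ge0//.
  exact: powR_ge0.
rewrite ltr_pdivlMr// in h; apply: le_lt_trans h; rewrite mulrC ler_wpM2l ?powR_ge0//.
by rewrite lerDl.
Qed.

Lemma closure_away_from0 U : closure U `<=` [set~ 0] ->
  exists2 rho : R, 0 < rho & forall x, U x -> rho <= enorm x.
Proof.
move=> U0; apply: contrapT => h; have : closure U 0; last by move=> /U0; apply.
move=> B /nbhs_ballP[e /= e0 eB].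
have [x [Ux xe]] : exists x, U x /\ enorm x < e.
  apply: contrapT => h'; apply: h; exists e => // x Ux.
  by rewrite leNgt; apply/negP => xe; apply: h'; exists x.
exists x; split => //; apply: eB; split => [//|i j].
rewrite (ord1 i) mxE /ball/= sub0r normrN.
exact: le_lt_trans (coord_le_enorm _ _) xe.
Qed.

Variables (f : 'rV[R]_d -> R) (kappa : R).
Hypothesis df : forall b i x, (mi_size b).+1%:R < kappa -> x != 0 ->
  derivable (mderiv b f) x (unit_vec i).
Hypothesis f_bounded : forall b rho, (mi_size b)%:R < kappa -> 0 < rho ->
  exists2 M, 0 <= M & forall x, rho <= enorm x -> `|mderiv b f x| <= M.
Hypothesis f_hoelder : forall b (sigma rho : R), 0 < sigma -> sigma < 1 ->
  (mi_size b)%:R + sigma <= kappa -> 0 < rho -> exists2 C, 0 <= C &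
  forall x y, rho <= enorm x -> rho <= enorm y ->
    `|mderiv b f y - mderiv b f x| <= C * enorm (y - x) `^ sigma.

Lemma C_space_away_from0 s U : 0 <= s -> s <= kappa -> (Num.truncn s)%:R < kappa ->
  closure U `<=` [set~ 0] -> C_space s U f.
Proof.
move=> s0 sk nk /closure_away_from0[rho r0 Ur]; set n := Num.truncn s in nk *.
have bk b : (mi_size b <= n)%N -> (mi_size b)%:R < kappa.
  by move=> bn; apply: le_lt_trans nk; rewrite ler_nat.
have Cn : Cn_space n U f.
  split => [b i x bn Ux|b bn].
    apply: df; first by apply: le_lt_trans nk; rewrite ler_nat.
    by rewrite -enorm_gt0; exact: lt_le_trans (Ur x Ux).
  have [M _ fM] := f_bounded (bk b bn) r0.
  pose sigma := Num.min (1 / 2) (kappa - (mi_size b)%:R).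
  have sg0 : 0 < sigma by rewrite lt_min divr_gt0//= subr_gt0 bk.
  have sg1 : sigma < 1.
    by rewrite gt_min; apply/orP; left; rewrite ltr_pdivrMr// mul1r ltr1n.
  have bs : (mi_size b)%:R + sigma <= kappa.
    by rewrite -lerBrDl ge_min lexx orbT.
  have [C C0 fC] := f_hoelder sg0 sg1 bs r0.
  apply: (C0_space_hoelder sg0 C0 (M := M)) => [x Ux|x y Ux Uy].
    by apply: fM; exact: Ur.
  by apply: fC; exact: Ur.
rewrite /C_space -/n; case: ifPn => // snat; split => //.
have sn : n%:R < s by rewrite lt_neqAle truncn_le s0 andbT -natrE.
have sn1 : s < n.+1%:R by exact: truncnS_gt.
rewrite /hoelder_norm -/n; apply: lte_add_pinfty; rewrite ?/Cn_norm.
  apply: esum_lty; first exact: finite_mi_size.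
  move=> b /= bn; have [M M0 fM] := f_bounded (bk b bn) r0.
  by apply: (sup_norm_lty M0) => x Ux; apply: fM; exact: Ur.
apply: esum_lty.
  by apply: sub_finite_set (finite_mi_size n) => b /= ->.
move=> b /= bn.
have [||||C C0 fC] := @f_hoelder b (s - n%:R) rho.
- by rewrite subr_gt0.
- by rewrite ltrBlDl natr1.
- by rewrite bn subrKC.
- by [].
apply: (hoelder_seminorm_lty C0) => x y Ux Uy.
by apply: fC; exact: Ur.
Qed.

End hoelder_spaces.

Theorem theorem1 (R : realType) (d : nat) (alpha gamma : R)
    (mu : {finite_measure set 'rV[R]_d -> \bar R})
    (P : R -> probability 'rV[R]_d R) (p : R -> 'rV[R]_d -> R)
    (d_ge2 : (2 <= d)%N) (alpha_bounds : 0 < alpha < 2)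
    (mu_spectral : spectral_measure mu)
    (nu_gamma : gamma_measure_on_sphere (levy_measure alpha mu) gamma)
    (P_stable : stable_semigroup alpha mu P)
    (p_density : forall t : R, 0 < t -> smooth_bounded_density (P t) (p t)) :
  let kappa0 := gamma - (d%:R - 2 * alpha) in
  let V := fun x => fine (potential_kernel p x) in
  0 < kappa0 ->
  [/\ forall x : 'rV[R]_d, x != 0 -> potential_kernel p x \is a fin_num,
      kappa0 \isn't a Num.nat -> locally_in (C_space kappa0) [set~ 0] V,
      kappa0 \is a Num.nat -> locally_in (C_minus_space kappa0) [set~ 0] V &
      forall b : {ffun 'I_d -> nat}, (mi_size b)%:R < kappa0 ->
        exists c : R, forall x : 'rV[R]_d, x != 0 ->
          `|mderiv b V x| <= c * enorm x `^ (alpha - d%:R - (mi_size b)%:R)].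
Proof.
move=> kappa0 V k0; have /andP[alpha_gt0 alpha_lt2] := alpha_bounds.
have d_gt0 : (0 < d)%N by exact: leq_trans d_ge2.
have alpha_lt_d : alpha < d%:R by apply: lt_le_trans alpha_lt2 _; rewrite ler_nat.
have s_gt0 : 0 < alpha + gamma by move: k0 alpha_lt_d; rewrite /kappa0; lra.
have kE : alpha + gamma + alpha - d%:R = kappa0 by rewrite /kappa0; ring.
pose H := dmult alpha mu; pose W := potential_integral alpha H.
have H_decay : forall b, exists2 C, 0 <= C & forall a x,
    `|H b a x| <= C * decayh (alpha + gamma) x.
  exact: dmult_decay.
have dH : forall b a (x z : 'rV[R]_d), is_derive x z (H b a)
    (\sum_(i < d) z ord0 i * H (badd b i) (a + pi / 2) x).
  exact: is_derive_dmult.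
have W_le := potential_integral_le alpha_gt0 alpha_lt_d s_gt0 H_decay dH.
have W_hoelder := potential_integral_hoelder alpha_gt0 alpha_lt_d s_gt0 H_decay dH.
have dW := is_derive_potential_integral alpha_gt0 alpha_lt_d s_gt0 H_decay dH.
rewrite kE in W_le W_hoelder dW.
pose c : R := (@kappaF R d)^-1.
have z0 : (mi_size ([ffun=> 0%N] : {ffun 'I_d -> nat}))%:R = 0 :> R.
  by rewrite /mi_size big1// => j _; rewrite ffunE.
have [C0 C00 W0] : exists2 C, 0 <= C & forall a x, x != 0 ->
    lebesgue_measure.-integrable `]0%R, +oo[
      (EFin \o potential_integrand alpha H [ffun=> 0%N] a x) /\
    `|W [ffun=> 0%N] a x| <= C * enorm x `^ (alpha - d%:R - 0).
  by have := @W_le [ffun=> 0%N]; rewrite z0; exact.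
have pkE x : potential_kernel p x = (\int[lebesgue_measure]_(t in `]0%R, +oo[)
    (c * potential_integrand alpha H [ffun=> 0%N] 0 x t)%:E)%E.
  apply: eq_integral => t; rewrite inE/= in_itv/= andbT => t0; congr EFin.
  rewrite (density_dmult alpha_bounds d_gt0 mu_spectral P_stable p_density)// /potential_integrand natrD z0 addr0.
  by rewrite -powR_mulrn ?powR_ge0// -powRrM mulNr (mulrC d%:R).
have mD := @measurable_itv R `]0%R, +oo[.
have VE x : x != 0 -> V x = c * W [ffun=> 0%N] 0 x.
  move=> /(W0 0)[I _]; rewrite /V pkE -[LHS]/(\int[lebesgue_measure]_(t in `]0%R, +oo[) (c * potential_integrand alpha H [ffun=> 0%N] 0 x t)).
  by rewrite RintegralZl.
have mV := @derivative_form_mderiv R d W kappa0 c V VE dW.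
have V_deriv b i x : (mi_size b).+1%:R < kappa0 -> x != 0 ->
    derivable (mderiv b V) x (unit_vec i).
  move=> bk x0; have bk' : (mi_size b)%:R < kappa0 by apply: lt_trans bk; rewrite ltr_nat.
  by have h := derivative_form_is_derive dW i (mV b bk') bk x0; exact: ex_derive.
have V_le b : (mi_size b)%:R < kappa0 -> exists2 C, 0 <= C & forall x, x != 0 ->
    `|mderiv b V x| <= C * enorm x `^ (alpha - d%:R - (mi_size b)%:R).
  move=> bk; have [C C_ge0 hC] := W_le b bk.
  exists (`|c| * C) => [|x x0]; first exact: mulr_ge0.
  by rewrite (mV b bk x x0) normrM -mulrA ler_wpM2l// (hC _ x x0).2.
have V_bounded b rho : (mi_size b)%:R < kappa0 -> 0 < rho ->
    exists2 M, 0 <= M & forall x, rho <= enorm x -> `|mderiv b V x| <= M.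
  move=> bk r0; have [C C_ge0 hC] := V_le b bk.
  set e := alpha - d%:R - (mi_size b)%:R in hC.
  have e0 : 0 <= - e.
    by have : 0 <= (mi_size b)%:R :> R by []; rewrite /e; move: alpha_lt_d; lra.
  exists (C * rho `^ e) => [|x rx]; first by rewrite mulr_ge0// powR_ge0.
  have x0 : 0 < enorm x by exact: lt_le_trans rx.
  rewrite (le_trans (hC x _)) -?enorm_gt0// ler_wpM2l//.
  rewrite -[e]opprK !(powRN _ (- e)) lef_pV2 ?posrE ?powR_gt0//.
  by rewrite ge0_ler_powR// ?nnegrE ?(ltW r0) ?(ltW x0).
have V_hoelder b (sigma rho : R) : 0 < sigma -> sigma < 1 ->
    (mi_size b)%:R + sigma <= kappa0 -> 0 < rho -> exists2 C, 0 <= C &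
    forall x y, rho <= enorm x -> rho <= enorm y ->
    `|mderiv b V y - mderiv b V x| <= C * enorm (y - x) `^ sigma.
  move=> s0 s1 bk r0; have [C C_ge0 hC] := W_hoelder b sigma rho s0 s1 bk r0.
  have bk' : (mi_size b)%:R < kappa0 by apply: lt_le_trans bk; rewrite ltrDl.
  exists (`|c| * C) => [|x y rx ry]; first exact: mulr_ge0.
  have nz (z : 'rV[R]_d) : rho <= enorm z -> z != 0.
    by move=> rz; rewrite -enorm_gt0; exact: lt_le_trans rz.
  rewrite (mV b bk' x (nz x rx)) (mV b bk' y (nz y ry)) -mulrBr normrM -mulrA.
  by rewrite ler_wpM2l// hC.
have CV := C_space_away_from0 V_deriv V_bounded V_hoelder.
split.
- move=> x /(W0 0)[I _]; rewrite pkE.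
  under eq_integral do rewrite EFinM.
  rewrite integralZl// fin_numM//.
  by apply: integrable_fin_num; [exact: measurable_itv|exact: I].
- move=> kn U _ _ cU; apply: CV => //; first exact: ltW.
  by rewrite lt_neqAle truncn_le (ltW k0) andbT -natrE.
- move=> _ U _ _ cU delta /andP[d0 dk]; apply: CV => //.
  + by rewrite subr_ge0.
  + by rewrite lerBlDr lerDl ltW.
  + by apply: (@le_lt_trans _ _ (kappa0 - delta)); rewrite ?truncn_le ?subr_ge0// ltrBlDr ltrDl.
- by move=> b /V_le[C _ hC]; exists C.
Qed.
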